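(* Let $\mu>0$ and $\eta>0$ be fixed, let $\gamma_0<\infty$, and let $\mathbb M$ be a family of simplicial face-to-face meshes of $\Omega$ with shape coefficients $\gamma_{\mathcal M}\le\gamma_0$ for all $\mathcal M\in\mathbb M$. For $\lambda>0$, $f\in L^2(\Omega)^d$ and $\mathcal M\in\mathbb M$, let $u\in H^1_0(\Omega)^d$ be the solution of the linear elasticity problem, let $U\in CR^d$ be the solution of $$b_{\mathrm{HL}}(U,\sigma)=\int_\Omega f\cdot E_1\sigma\quad\forall\sigma\in CR^d,$$ let $\hat U\in CR^d$ be the solution of $$b_{\mathrm{HL}}(\hat U,\sigma)=\int_\Omega f\cdot\sigma\quad\forall\sigma\in CR^d,$$ and put $h_{\max}=\max_{K\in\mathcal M}h_K$. Let $C=C(\lambda)\in[0,\infty]$ and $\hat C=\hat C(\lambda)\in[0,\infty]$ be the best constants in $$\|u-U\|_{\lambda;\eta}\le C\,h_{\max}\|f\|_{L^2(\Omega)^d},\qquad\|u-\hat U\|_{\lambda;\eta}\le\hat C\,h_{\max}\|f\|_{L^2(\Omega)^d}$$ for all $\mathcal M\in\mathbb M$ and all $f\in L^2(\Omega)^d$. Then the first bound holds with a finite constant independent of $\lambda$ if and only if the second does, i.e. $\sup_{\lambda>0}C(\lambda)<\infty\iff\sup_{\lambda>0}\hat C(\lambda)<\infty$.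
   Context: Setting. $d\ge2$; $\Omega\subset\mathbb R^d$ is open, bounded, connected, polyhedral with Lipschitz boundary. A simplicial face-to-face mesh $\mathcal M$ of $\Omega$ is a finite collection of (closed) $d$-simplices with $\overline\Omega=\bigcup_{K\in\mathcal M}K$ such that the intersection of any two elements is empty or a simplex whose vertices are exactly their common vertices. $h_K$ is the diameter of $K$, $\rho_K$ the diameter of its largest inscribed ball; $\gamma_{\mathcal M}:=\max_{K\in\mathcal M}h_K/\rho_K$. $\mathcal F$ is the set of $(d-1)$-dimensional faces, $\mathcal F^i$ the set of interior faces (not contained in $\partial\Omega$), $\Sigma=\bigcup_{F\in\mathcal F}F$, $h|_F=h_F=\operatorname{diam}(F)$. On an interior face $F=K_1\cap K_2$, $[\![v]\!]=v|_{K_1}-v|_{K_2}$ and $\{\!\{v\}\!\}=\frac12(v|_{K_1}+v|_{K_2})$; on a boundary face $F\subset K$, $[\![v]\!]=\{\!\{v\}\!\}=v|_K$; componentwise for vectors. Elasticity. $\varepsilon(v)=\frac12(\nabla v+\nabla v^T)$; $\varepsilon_{\mathcal M}$, $\operatorname{div}_{\mathcal M}$ are elementwise versions; $G:H=\sum_{j,\ell}G_{j\ell}H_{j\ell}$. For elementwise $H^1$ vector fields, $$a_{\lambda;\eta}(v,w)=\int_\Omega\big(2\mu\,\varepsilon_{\mathcal M}(v):\varepsilon_{\mathcal M}(w)+\lambda\operatorname{div}_{\mathcal M}v\operatorname{div}_{\mathcal M}w\big)+\int_\Sigma\frac\eta h[\![v]\!]\cdot[\![w]\!],$$ $\|v\|_{\lambda;\eta}=a_{\lambda;\eta}(v,v)^{1/2}$,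 $a_\lambda=a_{\lambda;0}$. The linear elasticity problem is: find $u\in H^1_0(\Omega)^d$ with $a_\lambda(u,v)=\int_\Omega f\cdot v$ for all $v\in H^1_0(\Omega)^d$. The discrete form is $b_{\mathrm{HL}}=a_{\lambda;\eta}$ on $CR^d\times CR^d$. Discrete space. $S^0_1$ is the space of (discontinuous) elementwise affine functions; $CR=\{s\in S^0_1:\int_F[\![s]\!]=0\ \forall F\in\mathcal F\}$. Smoother $E_1$ (applied componentwise). For a vertex $z$ of $\mathcal M$ let $\Phi^1_z$ be the continuous elementwise affine hat function at $z$. For each vertex $z\notin\partial\Omega$ fix (once for each mesh) an element $K_z\ni z$ and set $A_1\sigma=\sum_{z\notin\partial\Omega}\sigma|_{K_z}(z)\Phi^1_z$. For $F\in\mathcal F^i$ let $\Phi_F=\prod_{z\text{ vertex of }F}\Phi_z^1$ and $B_1\sigma=\sum_{F\in\mathcal F^i}\frac{\int_F\{\!\{\sigma\}\!\}}{\int_F\Phi_F}\Phi_F$. Then $E_1\sigma=A_1\sigma+B_1(\sigma-A_1\sigma)\in H^1_0(\Omega)$. *)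

(* Defs.v *)
From HB Require Import structures.
From mathcomp Require Import all_boot all_order all_algebra.
From mathcomp Require Import all_classical all_reals all_analysis.

Set Implicit Arguments.
Unset Strict Implicit.
Unset Printing Implicit Defensive.
Import Order.TTheory GRing.Theory Num.Theory.
Import numFieldNormedType.Exports.

Local Open Scope classical_set_scope.
Local Open Scope ring_scope.

Section RowMeasurable.
Context (R : realType) (n : nat).

Let coord (i : 'I_n) (v : 'rV[R]_n) : R := v 0 i.

Let row_set0 : g_sigma_preimage coord set0.
Proof. exact: sigma_algebra0. Qed.

Let row_setC A : g_sigma_preimage coord A -> g_sigma_preimage coord (~` A).
Proof. exact: sigma_algebraC. Qed.

Let row_bigcup (F : (set 'rV[R]_n)^nat) :
  (forall i, g_sigma_preimage coord (F i)) ->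
  g_sigma_preimage coord (\bigcup_i (F i)).
Proof. exact: sigma_algebra_bigcup. Qed.

HB.instance Definition _ :=
  @isMeasurable.Build default_measure_display 'rV[R]_n
    (g_sigma_preimage coord) row_set0 row_setC row_bigcup.

Lemma measurable_coord (i : 'I_n) :
  measurable_fun [set: 'rV[R]_n] (fun v : 'rV[R]_n => v 0 i).
Proof.
move=> _ Y mY; rewrite setTI; apply: sub_sigma_algebra => /=.
rewrite -bigcup_seq/=; exists i => /=; first by rewrite mem_index_enum.
by exists Y => //; rewrite setTI.
Qed.

End RowMeasurable.

Lemma measurable_fun_rowP (R : realType) n d (T : measurableType d)
    (f : T -> 'rV[R]_n) :
  (forall i, measurable_fun [set: T] (fun x => f x 0 i)) ->
  measurable_fun [set: T] f.
Proof.
move=> mf _ Y; rewrite setTI; move: Y.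
pose G := [set Y : set 'rV[R]_n | measurable (f @^-1` Y)].
suff : @measurable _ 'rV[R]_n `<=` G by [].
apply: smallest_sub.
  split; rewrite /G /=.
  - by rewrite preimage_set0.
  - by move=> A mA; rewrite setTD preimage_setC; exact: measurableC.
  - by move=> F mF; rewrite preimage_bigcup; exact: bigcup_measurable.
move=> A; rewrite -bigcup_seq => -[i _ [B mB <-]].
by rewrite /G /= setTI; have := mf i measurableT _ mB; rewrite setTI.
Qed.


Section LebesgueStep.
Context (R : realType) (n : nat).
Variable m : {sigma_finite_measure set 'rV[R]_n -> \bar R}.

Definition row_cons (p : R * 'rV[R]_n) : 'rV[R]_n.+1 :=
  \row_i (if unlift ord0 i is Some j then p.2 0 j else p.1).

Lemma measurable_row_cons : measurable_fun setT row_cons.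
Proof.
apply: measurable_fun_rowP => i.
rewrite (_ : (fun x => _) = fun p : R * 'rV[R]_n =>
   if unlift ord0 i is Some j then p.2 0 j else p.1); last first.
  by apply/funext => p; rewrite mxE.
case: (unlift ord0 i) => [j|]; last exact: measurable_fst.
exact: (measurableT_comp (measurable_coord j) measurable_snd).
Qed.

Definition leb_step : set 'rV[R]_n.+1 -> \bar R :=
  pushforward (@lebesgue_measure R \x m)%E row_cons.

Let preimage_row_cons A : measurable A -> measurable (row_cons @^-1` A).
Proof. by move=> mA; rewrite -[X in measurable X]setTI; exact: measurable_row_cons. Qed.

Let leb_step0 : leb_step set0 = 0%E.
Proof. by rewrite /leb_step /pushforward preimage_set0 measure0. Qed.

Let leb_step_ge0 A : (0 <= leb_step A)%E.
Proof. by rewrite /leb_step /pushforward; exact: measure_ge0. Qed.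

Let leb_step_sigma_additive : semi_sigma_additive leb_step.
Proof.
move=> F mF tF mUF; rewrite /leb_step /pushforward preimage_bigcup.
apply: measure_semi_sigma_additive.
- by move=> k; exact: preimage_row_cons.
- apply/trivIsetP => /= i j _ _ ij; rewrite -preimage_setI.
  by move/trivIsetP : tF => /(_ _ _ _ _ ij) ->//; rewrite preimage_set0.
- by rewrite -preimage_bigcup; exact: preimage_row_cons.
Qed.

HB.instance Definition _ := isMeasure.Build _ _ _ leb_step
  leb_step0 leb_step_ge0 leb_step_sigma_additive.

Let leb_step_sigma_finite : sigma_finite setT leb_step.
Proof.
have /sigma_finiteP[F [TF ndF Foo]] := sigma_finiteT (@lebesgue_measure R).
have /sigma_finiteP[G [TG ndG Goo]] := sigma_finiteT m.
pose g (v : 'rV[R]_n.+1) : R * 'rV[R]_n := (v 0 ord0, \row_j v 0 (lift ord0 j)).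
have gK : cancel row_cons g.
  case=> x v; rewrite /g /row_cons !mxE unlift_none /=; congr pair.
  by apply/rowP => j; rewrite !mxE liftK.
have mg : measurable_fun setT g.
  apply/measurable_fun_pairP; split; first exact: measurable_coord.
  apply: measurable_fun_rowP => i.
  by under eq_fun do rewrite mxE; exact: measurable_coord.
exists (fun k => g @^-1` (F k `*` G k)).
  rewrite -preimage_bigcup (_ : \bigcup_k _ = setT) ?preimage_setT//.
  rewrite -setXTT TF TG predeqE => -[x y]; split.
    by move=> [k _ []/= ? ?]; split; exists k.
  move=> [/= [k _ Fkx] [l _ Gly]]; exists (maxn k l) => //; split.
  - by move: x Fkx; exact/subsetPset/ndF/leq_maxl.
  - by move: y Gly; exact/subsetPset/ndG/leq_maxr.
move=> k; have [? ?] := Foo k; have [? ?] := Goo k; split.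
  by rewrite -[X in measurable X]setTI; apply: mg => //; exact: measurableX.
rewrite /leb_step /pushforward -comp_preimage (_ : g \o row_cons = id); last first.
  by apply/funext => p; exact: gK.
by rewrite preimage_id product_measure1E// lte_mul_pinfty// ge0_fin_numE.
Qed.

HB.instance Definition _ := Measure_isSigmaFinite.Build _ _ _ leb_step
  leb_step_sigma_finite.

End LebesgueStep.

Fixpoint leb (R : realType) (n : nat) :
    {sigma_finite_measure set 'rV[R]_n -> \bar R} :=
  match n with
  | 0 => \d_(0 : 'rV[R]_0)
  | n'.+1 => leb_step (leb R n')
  end.

Section Euclidean.
Context (R : realType) (d : nat).
Implicit Types (x y : 'rV[R]_d) (A Omega : set 'rV[R]_d).

Definition dot x y : R := \sum_i x 0 i * y 0 i.

(* The library norm on ['rV[R]_d] is the maximum norm, whence [enorm]. *)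
Definition enorm x : R := Num.sqrt (dot x x).

Definition diam A : R := sup [set enorm (p.1 - p.2) | p in A `*` A].

Definition indiam A : R :=
  sup [set r *+ 2 | r in [set r | 0 <= r /\
    exists c, forall y, enorm (y - c) <= r -> A y]].

Definition bdry A := closure A `\` A°.

(* Near a boundary point, [Omega] is the part above a Lipschitz graph over the
   hyperplane orthogonal to the unit vector [e]. *)
Definition lipschitz_boundary Omega :=
  forall x, bdry Omega x ->
  exists (e : 'rV[R]_d) (rho L : R) (psi : 'rV[R]_d -> R),
    [/\ enorm e = 1, 0 < rho,
        (forall y z, `|psi y - psi z| <= L * enorm (y - z)) &
        (forall y, enorm (y - x) < rho ->
           (Omega y <-> psi (y - dot y e *: e) < dot y e))].

(* The closure is a finite union of finite intersections of half-spaces. *)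
Definition polyhedral Omega :=
  exists P : seq (seq ('rV[R]_d * R)),
    closure Omega =
    [set x | exists2 Q, Q \in P & forall h, h \in Q -> dot h.1 x <= h.2].

Definition polyhedral_domain Omega :=
  [/\ open Omega, bounded_set Omega, connected Omega,
      polyhedral Omega & lipschitz_boundary Omega].

End Euclidean.

Section Sobolev.
Context (R : realType) (d : nat).
Local Notation E := 'rV[R]_d.
Implicit Types (A : set E) (v phi : E -> R) (g : E -> 'rV[R]_d).

Definition partial (j : 'I_d) phi (x : E) : R := 'D_(delta_mx 0 j) phi x.

Fixpoint Cn (n : nat) phi : Prop :=
  continuous phi /\
  if n is n'.+1 then
    forall j, (forall x, derivable phi x (delta_mx 0 j)) /\ Cn n' (partial j phi)
  else True.

Definition smooth phi := forall n, Cn n phi.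

Definition test_fun A phi :=
  smooth phi /\
  exists2 S, compact S /\ S `<=` A & forall x, ~ S x -> phi x = 0.

Definition L2 A v :=
  measurable_fun A v /\ (\int[leb R d]_(x in A) (v x ^+ 2)%:E < +oo)%E.

Definition weak_grad A v g := forall phi, test_fun A phi -> forall j,
  \int[leb R d]_(x in A) (v x * partial j phi x) =
  - \int[leb R d]_(x in A) (g x 0 j * phi x).

(* [H1 A v g]: [v] is in H^1 of the interior of [A], with weak gradient [g];
   [A] is an open set or a closed simplex. *)
Definition H1 A v g :=
  [/\ L2 A v, (forall j, L2 A (fun x => g x 0 j)) & weak_grad A° v g].

Definition H1_cvg A (phi : nat -> E -> R) v g :=
  (fun n => \int[leb R d]_(x in A) ((phi n x - v x) ^+ 2)%:E)%E @ \oo --> 0%E /\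
  forall j, (fun n => \int[leb R d]_(x in A)
    ((partial j (phi n) x - g x 0 j) ^+ 2)%:E)%E @ \oo --> 0%E.

Definition H10 A v g :=
  H1 A v g /\
  exists2 phi : nat -> E -> R, (forall n, test_fun A (phi n)) & H1_cvg A phi v g.

(* For vector fields, row i of the gradient is the gradient of component i. *)
Definition H10v A (u : E -> 'rV[R]_d) (Du : E -> 'M[R]_d) :=
  forall i, H10 A (fun x => u x 0 i) (fun x => row i (Du x)).

Definition L2v A (f : E -> 'rV[R]_d) := forall i, L2 A (fun x => f x 0 i).

Definition L2norm A (f : E -> 'rV[R]_d) : R :=
  Num.sqrt (\int[leb R d]_(x in A) dot (f x) (f x)).

End Sobolev.

(* A mesh is given by its numbered vertices and by its elements, each element
   being the set of (the numbers of) its vertices. *)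
Record mesh (R : realType) (d : nat) := Mesh {
  nvert : nat;
  vtx : 'I_nvert -> 'rV[R]_d;
  elts : {set {set 'I_nvert}} }.

Section Mesh.
Context (R : realType) (d : nat).
Local Notation E := 'rV[R]_d.
Variables (Omega : set E) (M : mesh R d).
Local Notation I := 'I_(nvert M).
Implicit Types (S F K : {set I}) (z : I) (x : E).

Definition conv_coef S (c : I -> R) x :=
  [/\ forall z, 0 <= c z, forall z, z \notin S -> c z = 0,
      \sum_z c z = 1 & \sum_z c z *: vtx z = x].

Definition simplex S : set E := [set x | exists c, conv_coef S c x].

Definition aff_indep S :=
  forall c : I -> R, (forall z, z \notin S -> c z = 0) ->
  \sum_z c z = 0 -> \sum_z c z *: vtx z = 0 -> forall z, c z = 0.

(* [simplex set0] is empty. *)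
Definition is_mesh :=
  [/\ injective (@vtx _ _ M),
      (forall z, exists2 K, K \in elts M & z \in K),
      (forall K, K \in elts M -> #|K| = d.+1 /\ aff_indep K),
      closure Omega = [set x | exists2 K, K \in elts M & simplex K x] &
      (forall K K', K \in elts M -> K' \in elts M ->
         simplex K `&` simplex K' = simplex (K :&: K'))].

Definition shape_coef : R :=
  \big[Num.max/0]_(K in elts M) (diam (simplex K) / indiam (simplex K)).

Definition hmax : R := \big[Num.max/0]_(K in elts M) diam (simplex K).

Definition faces : {set {set I}} :=
  [set F : {set I} | (#|F| == d) && [exists K in elts M, F \subset K]].

Definition int_face F : bool := `[< ~ (simplex F `<=` bdry Omega) >].

(* Integrals over a face are taken through the affine parametrization by the
   reference simplex of R^(d-1); [face_jac] is its (constant) Jacobian. *)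
Definition ref_simplex : set 'rV[R]_d.-1 :=
  [set y | (forall i, 0 <= y 0 i) /\ \sum_i y 0 i <= 1].

Definition face_vtx F (i : nat) : E := nth 0 [seq vtx z | z <- enum F] i.

Definition face_edges F : 'M[R]_(d.-1, d) :=
  \matrix_(i, j) (face_vtx F i.+1 - face_vtx F 0) 0 j.

Definition face_param F (y : 'rV[R]_d.-1) : E :=
  face_vtx F 0 + y *m face_edges F.

Definition face_jac F : R :=
  Num.sqrt (\det (face_edges F *m (face_edges F)^T)).

Definition face_inte F (g : E -> \bar R) : \bar R :=
  ((face_jac F)%:E *
   \int[leb R d.-1]_(y in ref_simplex) g (face_param F y))%E.

Definition face_int F (g : E -> R) : R :=
  face_jac F * \int[leb R d.-1]_(y in ref_simplex) g (face_param F y).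

(* An elementwise function is a family indexed by the elements; its values for
   index sets that are not elements are irrelevant. *)
Definition efun (V : Type) := {set I} -> E -> V.

(* The two elements at an interior face are ordered by [enum]; reversing the
   order changes the sign of the jump. *)
Definition face_elt F (i : nat) : {set I} :=
  nth finset.set0 (enum [set K in elts M | F \subset K]) i.

Definition jump (V : zmodType) (v : efun V) F x : V :=
  if int_face F then v (face_elt F 0) x - v (face_elt F 1) x
  else v (face_elt F 0) x.

Definition avg (V : lmodType R) (v : efun V) F x : V :=
  if int_face F then 2^-1 *: (v (face_elt F 0) x + v (face_elt F 1) x)
  else v (face_elt F 0) x.

(* The function on the closure of [Omega] given by an elementwise function; the
   element is ambiguous only on the null set of points shared by elements. *)
Definition assemble (V : zmodType) (v : efun V) x : V :=
  if [pick K in elts M | `[< simplex K x >]] is Some K then v K x else 0.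

Definition L2face F (t : E -> R) :=
  measurable_fun ref_simplex (t \o face_param F) /\
  (face_inte F (fun x => (t x ^+ 2)%:E) < +oo)%E.

(* [t] is the trace on [F] of the function [v] in H^1(K) with gradient [g]:
   smooth functions are dense in H^1(K), and restriction to the face extends
   from them continuously. *)
Definition is_trace K F (v : E -> R) (g : E -> 'rV[R]_d) (t : E -> R) :=
  L2face F t /\
  exists phi : nat -> E -> R,
    [/\ forall n, smooth (phi n), H1_cvg (simplex K) phi v g &
        (fun n => face_inte F (fun x => ((phi n x - t x) ^+ 2)%:E)) @ \oo
          --> 0%E].

(* Elementwise H^1 vector fields are manipulated together with their elementwise
   gradients and traces, which they determine up to null sets. *)
Record efield := EField {
  ev : efun 'rV[R]_d;
  eD : efun 'M[R]_d;
  etr : {set I} -> {set I} -> E -> 'rV[R]_d }.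

Definition eH1 (v : efield) :=
  forall K, K \in elts M -> forall i,
    H1 (simplex K) (fun x => ev v K x 0 i) (fun x => row i (eD v K x)) /\
    forall F, F \in faces -> F \subset K ->
      is_trace K F (fun x => ev v K x 0 i) (fun x => row i (eD v K x))
        (fun x => etr v K F x 0 i).

Definition strain (G : 'M[R]_d) : 'M[R]_d := 2^-1 *: (G + G^T).

Definition ddot (G H : 'M[R]_d) : R := \sum_i \sum_j G i j * H i j.

Definition elas_density (mu lambda : R) (G H : 'M[R]_d) : R :=
  2 * mu * ddot (strain G) (strain H) + lambda * (\tr G * \tr H).

Definition a_form (mu lambda eta : R) (v w : efield) : R :=
  \int[leb R d]_(x in Omega)
    assemble (fun K y => elas_density mu lambda (eD v K y) (eD w K y)) x +
  \sum_(F in faces)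
    face_int F (fun x => eta / diam (simplex F) *
      dot (jump (fun K => etr v K F) F x) (jump (fun K => etr w K F) F x)).

Definition a_norm (mu lambda eta : R) (v : efield) : R :=
  Num.sqrt (a_form mu lambda eta v v).

Definition S01 (s : efun 'rV[R]_d) :=
  forall K, K \in elts M -> exists (A : 'M[R]_d) (b : 'rV[R]_d),
    forall x, s K x = x *m A + b.

Definition CR (s : efun 'rV[R]_d) :=
  S01 s /\ forall F, F \in faces -> forall i,
    face_int F (fun x => jump s F x 0 i) = 0.

(* Piecewise affine fields carry their classical gradients and traces. *)
Definition of_affine (s : efun 'rV[R]_d) : efield :=
  EField s
    (fun K x => \matrix_(i, j) partial j (fun y => s K y 0 i) x)
    (fun K _ => s K).

(* Barycentric coordinates of [x] in an element that contains it, indexed by all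
   vertices; 0 outside the mesh. *)
Definition bary x : I -> R :=
  xget (fun=> 0) [set c | exists2 K, K \in elts M & conv_coef K c x].

Definition hat z x : R := bary x z.

Definition bubble F x : R := \prod_(z in F) hat z x.

Section Smoother.
Variable Kz : I -> {set I}.

Definition A1 (s : efun 'rV[R]_d) x : 'rV[R]_d :=
  \sum_(z | `[< ~ bdry Omega (vtx z) >]) hat z x *: s (Kz z) (vtx z).

Definition B1 (s : efun 'rV[R]_d) x : 'rV[R]_d :=
  \sum_(F in faces | int_face F)
    bubble F x *:
    (\row_i (face_int F (fun y => avg s F y 0 i) / face_int F (bubble F))).

Definition E1 (s : efun 'rV[R]_d) x : 'rV[R]_d :=
  A1 s x + B1 (fun K y => s K y - A1 s y) x.

End Smoother.

Definition HL_sol (mu lambda eta : R) (rhs : efun 'rV[R]_d -> R)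
    (U : efun 'rV[R]_d) :=
  CR U /\ forall s, CR s ->
    a_form mu lambda eta (of_affine U) (of_affine s) = rhs s.

Definition HL_sol_smoothed (mu lambda eta : R) (Kz : I -> {set I})
    (f : E -> 'rV[R]_d) :=
  HL_sol mu lambda eta
    (fun s => \int[leb R d]_(x in Omega) dot (f x) (E1 Kz s x)).

Definition HL_sol_plain (mu lambda eta : R) (f : E -> 'rV[R]_d) :=
  HL_sol mu lambda eta
    (fun s => \int[leb R d]_(x in Omega) dot (f x) (assemble s x)).

End Mesh.

Section Bounds.
Context (R : realType) (d : nat).
Local Notation E := 'rV[R]_d.
Variable Omega : set E.

(* On H^1_0 the jumps vanish and the form does not depend on the mesh. *)
Definition elasticity_sol (mu lambda : R) (f u : E -> 'rV[R]_d) :=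
  exists2 Du : E -> 'M[R]_d, H10v Omega u Du &
  forall w Dw, H10v Omega w Dw ->
    \int[leb R d]_(x in Omega) elas_density mu lambda (Du x) (Dw x) =
    \int[leb R d]_(x in Omega) dot (f x) (w x).

(* [w] is the elementwise field u - U. *)
Definition error_field (M : mesh R d) (u : E -> 'rV[R]_d)
    (U : efun M 'rV[R]_d) (w : efield M) :=
  eH1 w /\ forall K, K \in elts M -> forall x, (simplex K)° x ->
    ev w K x = u x - U K x.

Definition best_const (MM : set (mesh R d)) (mu lambda eta : R)
    (sol : forall M : mesh R d, (E -> 'rV[R]_d) -> efun M 'rV[R]_d -> Prop) :
    \bar R :=
  ereal_inf [set C : \bar R | (0 <= C)%E /\
    forall M f u U w, MM M -> L2v Omega f ->
      elasticity_sol mu lambda f u -> sol M f U -> error_field u U w ->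
      ((a_norm Omega mu lambda eta w)%:E <=
        C * (hmax M * L2norm Omega f)%:E)%E].

End Bounds.

(* Main.v *)
Require Import Defs.
From HB Require Import structures.
From mathcomp Require Import all_boot all_order all_algebra.
From mathcomp Require Import all_classical all_reals all_analysis.
From mathcomp Require Import perm measurable_realfun ring lra.

Set Implicit Arguments.
Unset Strict Implicit.
Unset Printing Implicit Defensive.
Import Order.TTheory GRing.Theory Num.Theory.
Import numFieldNormedType.Exports.

Local Open Scope classical_set_scope.
Local Open Scope ring_scope.

(** The difference W of the two discrete solutions satisfies
    a(W, s) = int f . (E_1 s - s) for all s in CR^d. The smoother obeys
      |E_1 s - s|_{L^2}^2 <= c h_max^2 sum_F int_F (eta / h) |[[s]]|^2
    with c depending only on d, eta and gamma_0, and the right-hand side is part of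
    a(s, s); hence the norm of W is at most sqrt(c) h_max |f|, without Korn's
    inequality and uniformly in lambda. A W with this property exists by Riesz
    representation for the semidefinite form, and adding or subtracting it
    exchanges the two discrete problems, so the two best constants differ by at
    most sqrt(c).

    For the smoother estimate, the value of s in an element K at a vertex z is
    compared with the value chosen by A_1 along a chain of elements around z,
    consecutive elements sharing a face at z, which ends in K_z, or in an element
    with a boundary face at z if z lies on the boundary. Each step costs a jump at
    z, controlled by the L^2 norm of the affine jump on the face, and the number of
    steps is bounded by volume comparison. The chain exists because elements
    reachable from K that have only two-sided faces at z fill a neighbourhood of
    z. The coefficients of B_1 are face averages of s - A_1 s. *)

(** * Positive semidefinite forms, Gram determinants and the Euclidean norm *)

(** The best constants range over all discrete solutions and over all representatives of the error,
    each with its own gradients and traces. Passing from one constant to the other therefore means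
    turning an arbitrary solution [U] into [U + W] or [U - W] and, at the same time, an error field
    for [U] into one for the shifted solution. The latter subtracts an elementwise affine field, and
    this is why weak gradients of affine functions and integration by parts appear. The form is only
    treated as semidefinite: the bound of the functional by the form makes it vanish on the kernel,
    which is all that existence of W requires. The Lipschitz condition enters through one fact, that
    no boundary point is interior to the closure of [Omega]. Hence a face shared by two elements is
    never a boundary face, and the elements around a boundary vertex cannot close up. The factor
    h_max^2 is a matter of scaling: |K| is of order h^d, a squared vertex jump on F is at most of
    order h^(1-d) times the squared L^2 norm of the jump on F, which leaves one power of h, and the
    weight 1/h of the stabilization costs another. *)

Lemma eq_implies_le (disp : Order.disp_t) (T : porderType disp) (x y : T) : x = y -> (x <= y)%O.
Proof. by move=> ->. Qed.

(** The discriminant argument behind every Cauchy-Schwarz inequality below. The case [c = 0] is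
    included so that it applies to semidefinite forms. *)
Lemma quad_nonneg_disc (R : realFieldType) (a b c : R) : 0 <= c ->
  (forall t, 0 <= a + t * b *+ 2 + t ^+ 2 * c) -> b ^+ 2 <= a * c.
Proof.
move=> c0 H; have [c_eq0|cN0] := eqVneq c 0.
  have [->|bN0] := eqVneq b 0; first by rewrite c_eq0 expr0n mulr0.
  (* The polynomial is affine for [c = 0], and at this [t] its value is -1. *)
  have := H (- (a + 1) / (b *+ 2)).
  rewrite c_eq0 mulr0 addr0 -mulrnAr mulfVK//; lra.
have cp : 0 < c by rewrite lt_neqAle eq_sym cN0.
have := H (- b / c); rewrite (_ : _ + _ = a - b ^+ 2 / c); last by field.
by rewrite subr_ge0 ler_pdivrMr.
Qed.

Section Riesz.
Context (R : realFieldType) (vT : vectType R).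

(** A subspace of maximal dimension inside [P] is all of [P], since adjoining a missing vector would
    raise the dimension. This provides a basis for a space known only through a predicate, such as
    [CR]. *)
Lemma subspace_vspace (P : vT -> Prop) :
  P 0 -> (forall a u v, P u -> P v -> P (a *: u + v)) ->
  exists U : {vspace vT}, forall v, v \in U <-> P v.
Proof.
move=> P0 PD.
pose Q n := `[< exists U : {vspace vT}, (forall v, v \in U -> P v) /\ \dim U = n >].
have Q0 : exists n, Q n.
  exists 0%N; apply/asboolP; exists 0%VS; split; last by rewrite dimv0.
  by move=> v; rewrite memv0 => /eqP->.
have Qle n : Q n -> (n <= \dim {:vT})%N.
  by move=> /asboolP[U [_ <-]]; rewrite dimvS// subvf.
case: (ex_maxnP Q0 Qle) => n /asboolP[U [UP dU]] nmax.
exists U => v; split; first exact: UP.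
move=> Pv; apply: contrapT => vU.
have QU : Q (\dim (U + <[v]>)%VS).
  apply/asboolP; exists (U + <[v]>)%VS; split=> // w /memv_addP[u uU [x]].
  by move=> /vlineP[k ->] ->; rewrite addrC; apply: PD => //; exact: UP.
have := nmax _ QU; rewrite -dU => dle.
have /eqP e : U == (U + <[v]>)%VS by rewrite eqEdim addvSl.
by apply: vU; rewrite e memvE addvSr.
Qed.

(** Gram-Schmidt along a spanning list: the new vector is replaced by its part [q] orthogonal to the
    earlier span. The bound on [l] substitutes for definiteness, because it forces [l q = 0]
    whenever [B q q = 0]. *)
Lemma psd_riesz (P : vT -> Prop) (B : vT -> vT -> R) (l : vT -> R) (c : R) :
  P 0 -> (forall a u v, P u -> P v -> P (a *: u + v)) ->
  (forall a u v w, P u -> P v -> P w ->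
     B (a *: u + v) w = a * B u w + B v w) ->
  (forall u v, P u -> P v -> B u v = B v u) ->
  (forall u, P u -> 0 <= B u u) ->
  (forall a u v, P u -> P v -> l (a *: u + v) = a * l u + l v) ->
  (forall u, P u -> l u ^+ 2 <= c * B u u) ->
  exists w, P w /\ forall v, P v -> B w v = l v.
Proof.
move=> P0 PD BD BC Bge lD lB.
have [U UP] := subspace_vspace P0 PD.
have cs u v : P u -> P v -> B u v ^+ 2 <= B u u * B v v.
  move=> Pu Pv; apply: quad_nonneg_disc; first exact: Bge.
  move=> t; have /Bge : P (t *: v + u) by exact: PD.
  have Pt : P (t *: v + u) by exact: PD.
  rewrite BD// [B v _]BC// [B u (_ + _)]BC// !BD// [B v u]BC// => H.
  by rewrite (_ : _ + _ = t * (t * B v v + B u v) + (t * B u v + B u u)) //; ring.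
(* The functional and its constant are generalized because the induction hypothesis is also applied
   to [B v], to project [v] onto the span. *)
suff H (s : seq vT) : (forall v, v \in s -> P v) -> forall l' c',
    (forall a u v, P u -> P v -> l' (a *: u + v) = a * l' u + l' v) ->
    (forall u, P u -> l' u ^+ 2 <= c' * B u u) ->
    exists w, w \in << s >>%VS /\ forall v, v \in << s >>%VS -> B w v = l' v.
  have [|w [wU Hw]] := H (vbasis U) _ l c lD lB.
    by move=> v /vbasis_mem /UP.
  move: wU Hw; rewrite (span_basis (vbasisP U)) => wU Hw.
  by exists w; split; [exact/UP|move=> v /UP; exact: Hw].
elim: s => [_ l' c' l'D _|v s IH sP l' c' l'D l'B].
  exists 0; split; first exact: mem0v.
  move=> v; rewrite span_nil memv0 => /eqP->.
  have -> : l' 0 = 0 by have := l'D 1 0 0 P0 P0; rewrite scaler0 addr0; lra.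
  by have := BD 1 0 0 0 P0 P0 P0; rewrite scaler0 addr0; lra.
have sP' u : u \in s -> P u by move=> us; apply: sP; rewrite in_cons us orbT.
have Pv : P v by apply: sP; rewrite mem_head.
have spanP u : u \in << s >>%VS -> P u.
  have /subvP sU : (<< s >> <= U)%VS by apply/span_subvP => w /sP' /UP.
  by move=> /sU /UP.
have Bv a x y : P x -> P y -> B v (a *: x + y) = a * B v x + B v y.
  by move=> Px Py; rewrite BC ?BD// ?[B v _]BC//; exact: PD.
have [w [ws Hw]] := IH sP' l' c' l'D l'B.
have [p [ps Hp]] := IH sP' (B v) (B v v) Bv (fun u Pu => cs v u Pv Pu).
have Pw := spanP _ ws; have Pp := spanP _ ps.
pose q := -1 *: p + v; have Pq : P q by exact: PD.
have Bqs u : u \in << s >>%VS -> B q u = 0.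
  by move=> us; rewrite BD ?Hp//; [ring|exact: spanP].
have vE : v = 1 *: p + q by rewrite /q scale1r scaleN1r addrA subrr add0r.
have memE x : x \in << v :: s >>%VS -> exists k, exists2 u, u \in << s >>%VS & x = k *: q + u.
  rewrite span_cons => /memv_addP[_ /vlineP[k ->] [u us ->]].
  exists k, (k *: p + u); first by rewrite memvD ?memvZ.
  by rewrite {1}vE scale1r scalerDr addrA [k *: q + _]addrC.
have sub x : x \in << s >>%VS -> x \in << v :: s >>%VS.
  by rewrite span_cons; apply/subvP; rewrite addvSr.
have qs : q \in << v :: s >>%VS.
  by apply: memvD; [apply/memvZ/sub|apply/memv_span/mem_head].
clearbody q.
(* For [B q q = 0] the quotient is 0 by convention, which is correct since [l' q] vanishes as
   well. *)
exists ((l' q / B q q) *: q + w); split; first by apply: memvD; [exact: memvZ|exact: sub].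
move=> x /memE[k [u us ->]]; have Pu := spanP _ us.
have Pku : P (k *: q + u) by exact: PD.
rewrite l'D//.
rewrite BD// [B q (_ + _)]BC// [B w (_ + _)]BC// !BD// [B u q]BC// [B u w]BC// Hw//.
rewrite (Bqs u us) (Bqs w ws).
have [Bq0|BqN0] := eqVneq (B q q) 0.
  have := l'B q Pq; rewrite Bq0 mulr0 => lq.
  have /eqP : l' q ^+ 2 == 0 by rewrite eq_le lq sqr_ge0.
  by move=> /eqP; rewrite sqrf_eq0 => /eqP->; ring.
by field.
Qed.

End Riesz.

Section Gram.
Context (R : rcfType).

(** Leibniz expansion, each of the [n!] products being bounded separately. It serves to bound the
    determinant of the barycentric gradients in [face_jac_ge]. *)
Lemma det_le (n : nat) (A : 'M[R]_n) (c : R) :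
  (forall i j, `|A i j| <= c) -> `|\det A| <= (n`!)%:R * c ^+ n.
Proof.
move=> Ac; rewrite /determinant (le_trans (ler_norm_sum _ _ _))//.
have -> : (n`!)%:R * c ^+ n = \sum_(s : {perm 'I_n}) c ^+ n.
  by rewrite sumr_const card_Sn mulr_natl.
apply: ler_sum => s _; rewrite normrM normrX normrN1 expr1n mul1r normr_prod.
rewrite -[X in _ <= _ ^+ X]card_ord -prodr_const; apply: ler_prod => i _.
by rewrite normr_ge0 Ac.
Qed.

(* The last diagonal entry of (D D^T)^-1 = G^T G, computed by Cramer's rule. *)
Lemma gram_minor (n : nat) (D G : 'M[R]_n.+1) : D *m G = 1%:M ->
  let E := row' ord_max D in
  \det (E *m E^T) = \det D ^+ 2 * \sum_i G i ord_max ^+ 2.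
Proof.
move=> DG E; have GD : G *m D = 1%:M by exact: mulmx1C.
pose P := D *m D^T.
have PQ : P *m (G^T *m G) = 1%:M.
  rewrite /P -mulmxA [D^T *m _]mulmxA -trmx_mul GD trmx1 mul1mx; exact: DG.
have Pu : P \in unitmx by case: (mulmx1_unit PQ).
have : (\adj P) ord_max ord_max = \det P * (G^T *m G) ord_max ord_max.
  have -> : G^T *m G = invmx P by rewrite -[RHS]mulmx1 -PQ mulKmx.
  rewrite /invmx Pu !mxE mulrA mulfV ?mul1r//.
  by move: Pu; rewrite unitmxE unitfE.
have -> : \sum_i G i ord_max ^+ 2 = (G^T *m G) ord_max ord_max.
  by rewrite mxE; apply: eq_bigr => i _; rewrite mxE expr2.
rewrite mxE /cofactor -signr_odd oddD addbb mul1r.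
rewrite det_mulmx det_tr -expr2 => <-.
congr (\det _); apply/matrixP => i j; rewrite !mxE.
by apply: eq_bigr => k _; rewrite !mxE.
Qed.
End Gram.

Section Euclid.
Context (R : realType) (d : nat).
Implicit Types x y z : 'rV[R]_d.

Lemma dotC x y : dot x y = dot y x.
Proof. by apply: eq_bigr => i _; rewrite mulrC. Qed.

Lemma dotDl x y z : dot (x + y) z = dot x z + dot y z.
Proof. by rewrite -big_split; apply: eq_bigr => i _; rewrite mxE mulrDl. Qed.

Lemma dotZl a x y : dot (a *: x) y = a * dot x y.
Proof. by rewrite mulr_sumr; apply: eq_bigr => i _; rewrite mxE mulrA. Qed.

Lemma dotNl x y : dot (- x) y = - dot x y.
Proof. by rewrite -scaleN1r dotZl mulN1r. Qed.

Lemma dotBl x y z : dot (x - y) z = dot x z - dot y z.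
Proof. by rewrite dotDl dotNl. Qed.

Lemma dot0l x : dot 0 x = 0.
Proof. by rewrite -(scale0r 0) dotZl mul0r. Qed.

Lemma dotDr x y z : dot z (x + y) = dot z x + dot z y.
Proof. by rewrite !(dotC z) dotDl. Qed.

Lemma dotZr a x y : dot x (a *: y) = a * dot x y.
Proof. by rewrite !(dotC x) dotZl. Qed.

Lemma dotBr x y z : dot z (x - y) = dot z x - dot z y.
Proof. by rewrite !(dotC z) dotBl. Qed.

Lemma dot_suml (I : finType) (F : I -> 'rV[R]_d) x :
  dot (\sum_i F i) x = \sum_i dot (F i) x.
Proof.
apply: (big_morph (fun y => dot y x)); last exact: dot0l.
by move=> a b; rewrite dotDl.
Qed.

Lemma dotxx_ge0 x : 0 <= dot x x.
Proof. by apply: sumr_ge0 => i _; rewrite -expr2 sqr_ge0. Qed.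

Lemma dotxx_eq0 x : dot x x = 0 -> x = 0.
Proof.
move=> /eqP; rewrite psumr_eq0; last by move=> i _; rewrite -expr2 sqr_ge0.
move=> /allP H; apply/rowP => i; rewrite mxE; apply/eqP.
by have := H i (mem_index_enum _); rewrite -expr2 sqrf_eq0.
Qed.

Lemma enorm_ge0 x : 0 <= enorm x. Proof. exact: sqrtr_ge0. Qed.

Lemma sqr_enorm x : enorm x ^+ 2 = dot x x.
Proof. by rewrite sqr_sqrtr// dotxx_ge0. Qed.

Lemma enorm0 : enorm (0 : 'rV[R]_d) = 0.
Proof. by rewrite /enorm dot0l sqrtr0. Qed.

Lemma enorm_eq0 x : enorm x = 0 -> x = 0.
Proof. by move=> h; apply: dotxx_eq0; rewrite -sqr_enorm h expr0n. Qed.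

Lemma enormZ a x : enorm (a *: x) = `|a| * enorm x.
Proof. by rewrite /enorm dotZl dotZr mulrA -expr2 sqrtrM ?sqr_ge0// sqrtr_sqr. Qed.

Lemma enormN x : enorm (- x) = enorm x.
Proof. by rewrite -scaleN1r enormZ normrN1 mul1r. Qed.

Lemma dot_cauchy x y : `|dot x y| <= enorm x * enorm y.
Proof.
rewrite -(@ler_pXn2r _ 2)// ?nnegrE ?mulr_ge0 ?enorm_ge0//.
rewrite exprMn !sqr_enorm real_normK ?num_real//.
apply: quad_nonneg_disc; first exact: dotxx_ge0.
move=> t; have := dotxx_ge0 (x + t *: y); rewrite dotDl !dotDr !dotZl !dotZr.
rewrite [dot y x]dotC => h; apply: le_trans h _.
by apply: eq_implies_le; ring.
Qed.

Lemma ler_enormD x y : enorm (x + y) <= enorm x + enorm y.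
Proof.
rewrite -(@ler_pXn2r _ 2)// ?nnegrE ?addr_ge0 ?enorm_ge0//.
rewrite sqrrD !sqr_enorm dotDl !dotDr [dot y x]dotC.
have := le_trans (ler_norm _) (dot_cauchy x y); lra.
Qed.

Lemma coord_le_enorm x i : `|x 0 i| <= enorm x.
Proof.
rewrite -(@ler_pXn2r _ 2)// ?nnegrE ?enorm_ge0// sqr_enorm real_normK ?num_real//.
rewrite /dot (bigD1 i)//= -expr2 lerDl.
by apply: sumr_ge0 => j _; rewrite -expr2 sqr_ge0.
Qed.

Lemma enorm_le_sum x : enorm x <= \sum_i `|x 0 i|.
Proof.
have e : x = \sum_i x 0 i *: delta_mx 0 i.
  by rewrite {1}[x]matrix_sum_delta big_ord1.
have /= : enorm (\sum_i x 0 i *: delta_mx 0 i : 'rV[R]_d) <= \sum_i `|x 0 i|.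
  elim/big_ind2: _ => [|a b s t H1 H2|i _]; first by rewrite enorm0.
    exact: le_trans (ler_enormD _ _) (lerD H1 H2).
  rewrite enormZ -{2}[`|_|]mulr1 ler_wpM2l//.
  rewrite /enorm /dot (bigD1 i)//= big1 ?addr0; last first.
    by move=> j /negPf ji; rewrite !mxE ji andbF mulr0.
  by rewrite !mxE !eqxx mulr1 sqrtr1.
by rewrite -e.
Qed.

Lemma norm_le_enorm x : `|x| <= enorm x.
Proof.
rewrite [leLHS]/Num.norm/= mx_normrE.
apply: bigmax_le => [|[i j] _ /=]; first exact: enorm_ge0.
by rewrite (ord1 i) coord_le_enorm.
Qed.

Lemma coord_le_norm x i : `|x 0 i| <= `|x|.
Proof. by rewrite [leRHS]/Num.norm/= mx_normrE; exact: (le_bigmax _ (fun ij : 'I_1 * 'I_d => `|x ij.1 ij.2|) (0, i)). Qed.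

Lemma enorm_le_norm x : enorm x <= d%:R * `|x|.
Proof.
apply: le_trans (enorm_le_sum x) _.
have -> : d%:R * `|x| = \sum_(i < d) `|x| by rewrite sumr_const card_ord mulr_natl.
by apply: ler_sum => i _; exact: coord_le_norm.
Qed.
End Euclid.

(** * Lebesgue measure and square integrability on row vectors *)

Section RowSpace.
Context (R : realType) (n : nat).
Implicit Types (x y c : 'rV[R]_n) (A : set 'rV[R]_n).

(** For [0 <= r] the closed ball of the maximum norm, spelled out by coordinates so that it splits
    along [row_cons] and has a volume computable by induction on the dimension. *)
Definition cube c (r : R) : set 'rV[R]_n :=
  [set x | forall i, `|x 0 i - c 0 i| <= r].

Lemma measurable_cube c r : measurable (cube c r).
Proof.
rewrite (_ : cube c r = \bigcap_(i in [set: 'I_n]) [set x | `|x 0 i - c 0 i| <= r]).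
  apply: fin_bigcap_measurable => // i _.
  rewrite -[X in measurable X]setTI; apply: measurable_fun_le => //.
  apply: measurableT_comp => //; apply: measurable_funB => //.
  exact: measurable_coord.
by apply/seteqP; split => x /= H i; [move=> _|]; exact: H.
Qed.

Lemma cube_norm c r x : cube c r x -> 0 <= r -> `|x - c| <= r.
Proof.
move=> H r0; rewrite [leLHS]/Num.norm/= mx_normrE; apply: bigmax_le => // -[i j] _.
by rewrite (ord1 i) !mxE; exact: H.
Qed.

Lemma norm_cube c r x : `|x - c| <= r -> cube c r x.
Proof. by move=> H i; have := le_trans (coord_le_norm (x - c) i) H; rewrite !mxE. Qed.

Lemma nbhs_rowP x A : nbhs x A <-> exists2 e, 0 < e & forall y, `|y - x| < e -> A y.
Proof.
split=> [/nbhs_ballP[e /= e0 H]|[e e0 H]].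
  by exists e => // y yx; apply: H; rewrite -ball_normE /= distrC.
by apply/nbhs_ballP; exists e => // y; rewrite -ball_normE /= distrC => /H.
Qed.

(** The sigma-algebra on rows is generated by the coordinates. An open set is the union of the
    countably many cubes with rational centre and radius [1 / m.+1] that it contains. *)
Lemma open_row_measurable A : open A -> measurable A.
Proof.
move=> oA.
pose F (p : 'rV[rat]_n * nat) : set 'rV[R]_n :=
  cube (\row_i ratr (p.1 0 i)) (p.2.+1%:R^-1).
pose D := [set p | F p `<=` A].
have -> : A = \bigcup_p (if p \in D then F p else set0).
  apply/seteqP; split; last first.
    by move=> x [p _]; case: ifPn => //; rewrite inE; exact.
  move=> x Ax; have /nbhs_rowP[e e0 H] : nbhs x A by exact: open_nbhs_nbhs.
  (* Two points of a cube of radius [1 / m.+1] are at most [2 / m.+1 < e] apart, so a cube around a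
     rational point near [x] stays in [A]. *)
  pose m := Num.truncn (2 / e).
  have me : 2 * m.+1%:R^-1 < e.
    rewrite ltr_pdivrMr ?ltr0n// mulrC -ltr_pdivrMr//.
    by rewrite truncnS_gt.
  have m0 : 0 < m.+1%:R^-1 :> R by rewrite invr_gt0 ltr0n.
  have /choice[q Hq] : forall i : 'I_n, exists q : rat,
      `|x 0 i - ratr q| <= m.+1%:R^-1.
    move=> i; have : x 0 i - m.+1%:R^-1 < x 0 i + m.+1%:R^-1.
      by rewrite ltrD2l (lt_trans _ m0)// oppr_lt0.
    move=> /rat_in_itvoo[q]; rewrite in_itv /= => /andP[q1 q2]; exists q.
    by rewrite distrC ler_distl !ltW.
  exists (\row_i q i, m) => //.
  have xF : F (\row_i q i, m) x by move=> i; rewrite !mxE.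
  rewrite mem_set// => y yF; apply: H.
  have := ler_normB (y - \row_i ratr ((\row_j q j) 0 i)) (x - \row_i ratr ((\row_j q j) 0 i)).
  rewrite opprB addrA subrK => /le_lt_trans; apply; apply: le_lt_trans me.
  rewrite mulr_natl mulr2n lerD//; apply: cube_norm => //; exact: ltW.
apply: countable_bigcupT_measurable.
  exact: countableP.
by move=> p; case: ifP => // _; exact: measurable_cube.
Qed.

Lemma closed_row_measurable A : closed A -> measurable A.
Proof. by move=> /closed_openC/open_row_measurable/measurableC; rewrite setCK. Qed.

Lemma continuous_row_measurable (f : 'rV[R]_n -> R) :
  continuous f -> measurable_fun setT f.
Proof.
move=> cf; apply: (measurability _ (RGenOpens.measurableE R)) => //.
move=> _ [B [a [b ->] <-]]; rewrite setTI; apply: open_row_measurable.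
by apply: open_comp => //; exact: interval_open.
Qed.
End RowSpace.

Section LebCube.
Context (R : realType).

Lemma leb_cube n (c : 'rV[R]_n) (r : R) : 0 <= r ->
  leb R n (cube c r) = ((2 * r) ^+ n)%:E.
Proof.
move=> r0; elim: n c => [|n IH] c.
  by rewrite expr0 /= diracE mem_set// => -[].
have -> : leb R n.+1 (cube c r) =
    (@lebesgue_measure R \x leb R n)%E (@row_cons R n @^-1` cube c r) by [].
have -> : @row_cons R n @^-1` cube c r =
    `[c 0 ord0 - r, c 0 ord0 + r]%classic `*` cube (\row_j c 0 (lift ord0 j)) r.
  apply/seteqP; split=> -[t y] /=.
    move=> H; split.
      by have := H ord0; rewrite mxE unlift_none /= in_itv /= ler_distl.
    by move=> j; have := H (lift ord0 j); rewrite !mxE liftK.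
  rewrite in_itv /= -ler_distl => -[H1 H2] i; rewrite !mxE /=.
  by case: unliftP => [j|] -> //; have := H2 j; rewrite mxE.
rewrite product_measure1E//; last exact: measurable_cube.
rewrite IH.
set l := (X in (X * _)%E); have -> : l = (2 * r)%:E; last by rewrite -EFinM exprS.
rewrite /l; transitivity (@lebesgue_measure R `[c 0 ord0 - r, c 0 ord0 + r]%classic); first by [].
rewrite lebesgue_measure_itv /= lte_fin.
case: ifPn => [_|]; first by rewrite -EFinB; congr EFin; ring.
rewrite -leNgt; clear l; move: (c 0 ord0) r0 => a r0 h; have -> : r = 0 by lra.
by rewrite mulr0.
Qed.
Lemma leb_cube_lty n (c : 'rV[R]_n) (r : R) : 0 <= r -> (leb R n (cube c r) < +oo)%E.
Proof. by move=> r0; rewrite leb_cube// ltry. Qed.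
End LebCube.

Section SquareIntegrable.
Context (R : realType) (n : nat) (A : set 'rV[R]_n) (mA : measurable A).
Implicit Types v w : 'rV[R]_n -> R.
Local Notation mu := (leb R n).

Lemma L2_sqr_integrable v : L2 A v -> mu.-integrable A (EFin \o (fun x => v x ^+ 2)).
Proof.
move=> [mv vfin]; apply/integrableP; split.
  by apply/measurable_EFinP; exact: measurable_funX.
rewrite (eq_integral (fun x => (v x ^+ 2)%:E))// => x _.
by rewrite /= ger0_norm ?sqr_ge0.
Qed.

Lemma L2_mul_integrable v w : L2 A v -> L2 A w ->
  mu.-integrable A (EFin \o (fun x => v x * w x)).
Proof.
move=> Lv Lw.
apply: (@le_integrable _ _ _ _ _ mA _ (EFin \o (fun x => v x ^+ 2 + w x ^+ 2))).
- by apply/measurable_EFinP; apply: measurable_funM; [exact: Lv.1|exact: Lw.1].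
- move=> x _ /=; rewrite lee_fin [leRHS]ger0_norm ?addr_ge0 ?sqr_ge0//.
  rewrite ler_norml; have := sqr_ge0 (v x - w x); have := sqr_ge0 (v x + w x).
  have := sqr_ge0 (v x); have := sqr_ge0 (w x).
  by rewrite sqrrD sqrrB => *; apply/andP; split; lra.
- exact: (integrableD mA (L2_sqr_integrable Lv) (L2_sqr_integrable Lw)).
Qed.

Lemma integrable_L2 v : measurable_fun A v ->
  mu.-integrable A (EFin \o (fun x => v x ^+ 2)) -> L2 A v.
Proof. by move=> mv iv; split=> //; exact: (integrable_lty mA iv). Qed.

Lemma L2Z k v : L2 A v -> L2 A (fun x => k * v x).
Proof.
move=> Lv; apply: integrable_L2; first exact: (measurable_funM (measurable_cst _) Lv.1).
apply: eq_integrable (integrableZl mA (k ^+ 2) (L2_sqr_integrable Lv)) => //.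
by move=> x _ /=; rewrite -EFinM exprMn.
Qed.

Lemma L2D v w : L2 A v -> L2 A w -> L2 A (fun x => v x + w x).
Proof.
move=> Lv Lw; apply: integrable_L2; first exact: measurable_funD Lv.1 Lw.1.
have := integrableD mA (integrableD mA (L2_sqr_integrable Lv) (L2_sqr_integrable Lw))
  (integrableZl mA 2 (L2_mul_integrable Lv Lw)).
apply: eq_integrable => // x _ /=.
by rewrite -EFinM -!EFinD; congr EFin; ring.
Qed.

Lemma L2_bounded v (M : R) : (mu A < +oo)%E -> measurable_fun A v ->
  (forall x, A x -> `|v x| <= M) -> L2 A v.
Proof.
move=> Afin mv vM; apply: integrable_L2 => //.
apply: measurable_bounded_integrable => //; first exact: measurable_funX.
exists (M ^+ 2); split; first exact: num_real.
move=> y My x Ax; apply: le_trans (ltW My).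
by rewrite normrX lerXn2r ?nnegrE ?vM// (le_trans _ (vM _ Ax)).
Qed.

Lemma L2_integrable v : (mu A < +oo)%E -> L2 A v -> mu.-integrable A (EFin \o v).
Proof.
move=> Afin Lv; have L1 : L2 A (fun _ => 1).
  by apply: (L2_bounded (M := 1)) => // x _; rewrite normr1.
apply: eq_integrable (L2_mul_integrable Lv L1) => // x _ /=.
by rewrite mulr1.
Qed.

End SquareIntegrable.

(** * Integration by parts *)

Section DeriveLine.
Context (R : realType) (V W U : normedModType R).

(** The two difference quotients are the same function. This reduces partial derivatives of slices
    and of affine functions to derivatives in other spaces, in particular in one variable. *)
Lemma derive_line (f : V -> U) (a v : V) (g : W -> U) (b w : W) :
  (forall s, f (s *: v + a) = g (s *: w + b)) ->
  'D_v f a = 'D_w g b /\ (derivable f a v <-> derivable g b w).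
Proof.
move=> H; have H0 : f a = g b by have := H 0; rewrite !scale0r !add0r.
rewrite /derive /derivable.
have -> : (fun h : R => h^-1 *: ((f \o shift a) (h *: v) - f a)) =
          (fun h : R => h^-1 *: ((g \o shift b) (h *: w) - g b)).
  by apply/funext => h; rewrite /= /shift H H0.
by [].
Qed.
End DeriveLine.

Section IntPartial.
Context (R : realType).

Lemma row_cons_add n (t s : R) (x y : 'rV[R]_n) :
  row_cons (t, x) + row_cons (s, y) = row_cons (t + s, x + y).
Proof. by apply/rowP => i; rewrite !mxE; case: unlift => [j|] //; rewrite !mxE. Qed.

Lemma row_cons_scale n (k t : R) (x : 'rV[R]_n) :
  k *: row_cons (t, x) = row_cons (k * t, k *: x).
Proof. by apply/rowP => i; rewrite !mxE; case: unlift => [j|] //; rewrite !mxE. Qed.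

Lemma row_cons_delta0 n : delta_mx 0 ord0 = row_cons (1, 0 : 'rV[R]_n).
Proof.
apply/rowP => i; rewrite !mxE /=; case: unliftP => [j|] ->; rewrite ?mxE//.
Qed.

Lemma row_cons_delta n (j : 'I_n) :
  delta_mx 0 (lift ord0 j) = row_cons (0, delta_mx 0 j : 'rV[R]_n).
Proof.
apply/rowP => i; rewrite !mxE /=; case: unliftP => [k|] ->; rewrite ?mxE ?(inj_eq lift_inj)//.
Qed.

Lemma norm_row_cons_le n (t : R) (x : 'rV[R]_n) (e : R) :
  `|t| <= e -> `|x| <= e -> `|row_cons (t, x)| <= e.
Proof.
move=> te xe; rewrite -[row_cons _]subr0; apply: cube_norm; last first.
  exact: le_trans te.
move=> i; rewrite !mxE subr0 /=; case: unlift => [j|]//.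
exact: le_trans (coord_le_norm _ _) xe.
Qed.

Lemma row_consB n (t s : R) (x y : 'rV[R]_n) :
  row_cons (t, x) - row_cons (s, y) = row_cons (t - s, x - y).
Proof. by rewrite -scaleN1r row_cons_scale row_cons_add scaleN1r mulN1r. Qed.

Lemma continuous_row_consl n (y : 'rV[R]_n) : continuous (fun t => row_cons (t, y)).
Proof.
move=> t; apply/cvgrPdist_le => e e0; near=> s.
rewrite row_consB subrr; apply: norm_row_cons_le; last by rewrite normr0 ltW.
by near: s; exact: cvgr_dist_le.
Unshelve. all: by end_near. Qed.

Lemma continuous_row_consr n (t : R) : continuous (fun y : 'rV[R]_n => row_cons (t, y)).
Proof.
move=> y A /nbhs_rowP[e e0 H].
apply/(@nbhs_rowP R n y); exists e => // x yx; apply: H.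
apply: le_lt_trans yx; rewrite row_consB subrr.
by apply: norm_row_cons_le; rewrite ?normr0.
Qed.

(* [lebesgue_measure] lives on the carrier [measurableTypeR R] of R. *)
Local Notation TR := (measurableTypeR R).

Lemma measurable_row_consT n :
  @measurable_fun _ _ (TR * 'rV[R]_n)%type _ setT (@row_cons R n).
Proof. exact: measurable_row_cons. Qed.

Lemma closed_cube n (N : R) : 0 <= N -> closed (cube (0 : 'rV[R]_n) N).
Proof.
move=> N0; rewrite (_ : cube _ _ = (fun x => `|x|) @^-1` [set t | t <= N]).
  by apply: closed_comp => [x _|]; [exact: norm_continuous|exact: closed_le].
apply/seteqP; split=> x /=; last by move=> h; apply: norm_cube; rewrite subr0.
by move=> /cube_norm/(_ N0); rewrite subr0.
Qed.

Lemma partial_support n (S : set 'rV[R]_n) (f : 'rV[R]_n -> R) i : closed S ->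
  (forall x, ~ S x -> f x = 0) -> forall x, ~ S x -> partial i f x = 0.
Proof.
move=> cS f0 x xS; have : nbhs x (~` S).
  by apply: open_nbhs_nbhs; split=> //; exact: closed_openC.
move=> nx; rewrite /partial -(derive_cst (0 : R) x (delta_mx 0 i : 'rV[R]_n)).
by apply: near_eq_derive; apply: filterS nx => z; exact: f0.
Qed.

Lemma continuous_bounded_cube n (f : 'rV[R]_n -> R) (N : R) : 0 <= N -> continuous f ->
  exists M, forall x, cube 0 N x -> `|f x| <= M.
Proof.
move=> N0 cf; have cpt : compact (cube (0 : 'rV[R]_n) N).
  apply: (@bounded_closed_compact R n _ _ (@closed_cube n N N0)).
  exists N; split; first exact: num_real.
  by move=> M NM x /cube_norm/(_ N0); rewrite subr0 => /le_trans; apply; exact: ltW.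
have /compact_bounded[M [_ Mf]] := continuous_compact (continuous_subspaceT cf) cpt.
by exists (M + 1) => x xN; apply: Mf; [rewrite ltrDl|exists x].
Qed.

Lemma continuous_cube_integrable n (f : 'rV[R]_n -> R) (N : R) : 0 <= N ->
  continuous f -> (forall x, ~ cube 0 N x -> f x = 0) ->
  (leb R n).-integrable setT (EFin \o f).
Proof.
move=> N0 cf f0.
have fE : EFin \o f = (EFin \o f) \_ (cube 0 N).
  by apply/funext => x; rewrite patchE; case: ifPn => // /negP; rewrite inE => /f0 /= ->.
rewrite fE; apply: (proj1 (integrable_mkcond (EFin \o f) (measurable_cube 0 N))).
apply: measurable_bounded_integrable; [exact: measurable_cube| | |].
- exact: leb_cube_lty.
- by apply: measurable_funTS; exact: continuous_row_measurable.
- have [M HM] := continuous_bounded_cube N0 cf.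
  exists M; split; first exact: num_real.
  by move=> y My x xN; apply: le_trans (ltW My); exact: HM.
Qed.

(** Fubini along [row_cons] and induction on the dimension. In the first coordinate every line
    integral vanishes by the fundamental theorem of calculus; in any other coordinate the slices
    fall under the induction hypothesis. *)
Lemma integral_partial_eq0 n (psi : 'rV[R]_n -> R) (j : 'I_n) (N : R) : 0 <= N ->
  (forall x, derivable psi x (delta_mx 0 j)) -> continuous (partial j psi) ->
  (forall x, ~ cube 0 N x -> psi x = 0) ->
  (\int[leb R n]_x (partial j psi x)%:E = 0)%E.
Proof.
move=> N0.
have supp m (f : 'rV[R]_m -> R) i : (forall x, ~ cube 0 N x -> f x = 0) ->
    forall x, ~ cube 0 N x -> partial i f x = 0.
  by apply: partial_support; exact: closed_cube.
elim: n psi j => [psi []//|n IH psi j dpsi cpsi psi0].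
have int1 := continuous_cube_integrable N0 cpsi (supp _ _ _ psi0).
pose f := fun z : TR * 'rV[R]_n => (partial j psi (row_cons z))%:E.
have mpart : measurable_fun setT (EFin \o partial j psi).
  by apply/measurable_EFinP; exact: continuous_row_measurable.
have mf : measurable_fun setT f.
  exact: (measurableT_comp mpart (@measurable_row_consT n)).
have intf : ((@lebesgue_measure R \x leb R n)%E).-integrable setT f.
  apply/integrableP; split => //.
  have /integrableP[_] := int1; apply: le_lt_trans.
  apply: eq_implies_le; apply/esym.
  have := @ge0_integral_pushforward _ _ (TR * 'rV[R]_n)%type _ R _ (@measurable_row_consT n)
    (@lebesgue_measure R \x leb R n)%E setT (abse \o (EFin \o partial j psi)).
  rewrite preimage_setT => -> //; first exact: (measurableT_comp (@abse_measurable R setT) mpart).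
  by move=> x _; exact: abse_ge0.
transitivity (\int[(@lebesgue_measure R \x leb R n)]_z f z)%E.
  have := @integral_pushforward _ _ (TR * 'rV[R]_n)%type _ R _ (@measurable_row_consT n)
    (@lebesgue_measure R \x leb R n)%E setT (EFin \o partial j psi) mpart.
  by rewrite preimage_setT; apply.
have sliceN t y : ~ cube 0 N y -> psi (row_cons (t, y)) = 0.
  move=> yN; apply: psi0 => H; apply: yN => i.
  by have := H (lift ord0 i); rewrite !mxE liftK.
case: (unliftP ord0 j) => [i|] jE; last first.
  rewrite -integral21_prod_meas1//; apply: integral0_eq => y _; rewrite /fubini_G.
  pose h t := psi (row_cons (t, y)).
  have hD t : 'D_1 h t = partial j psi (row_cons (t, y)) /\ derivable h t 1.
    have [|e1 e2] := @derive_line R R _ _ h t 1 psi (row_cons (t, y)) (delta_mx 0 j).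
      move=> s; rewrite /h jE row_cons_delta0 row_cons_scale row_cons_add.
      by rewrite scaler0 add0r.
    by split; [exact: e1|apply/e2; exact: dpsi].
  have h0 t : ~ (`|t| <= N) -> h t = 0.
    move=> tN; apply: psi0 => H; apply: tN.
    by have := H ord0; rewrite !mxE unlift_none /= subr0.
  have dh0 t : ~ (`|t| <= N) -> partial j psi (row_cons (t, y)) = 0.
    move=> tN; apply: supp => // H; apply: tN.
    by have := H ord0; rewrite !mxE unlift_none /= subr0.
  (* The end points are [N + 1] and not [N], because the support condition gives [h = 0] only where
     the modulus exceeds [N]. *)
  transitivity (\int[lebesgue_measure]_(t in `[(- (N + 1))%R, (N + 1)%R]) f (t, y))%E.
    rewrite [RHS]integral_mkcond; apply: eq_integral => t _; rewrite patchE.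
    case: ifPn => // /negP; rewrite inE /= in_itv /= -ler_norml => tN.
    by rewrite /f dh0//; move=> tN'; apply: tN; rewrite (le_trans tN')// lerDl.
  have ch t : {for t, continuous h}.
    by apply: differentiable_continuous; apply/derivable1_diffP; have [] := hD t.
  transitivity ((h (N + 1))%:E - (h (- (N + 1)))%:E)%E; last first.
    by rewrite !h0 ?sube0// ?normrN ger0_norm ?addr_ge0//; apply/negP; rewrite -ltNge ltrDl.
  apply: (@continuous_FTC2 R (fun t => partial j psi (row_cons (t, y)))).
  - by rewrite (@lt_trans _ _ 0)// ?oppr_lt0; apply: ltr_wpDl.
  - apply: continuous_subspaceT => t.
    exact: (continuous_comp (@continuous_row_consl n y t) (cpsi _)).
  - split; first by move=> t _; have [] := hD t.
      by apply: cvg_at_right_filter; exact: ch.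
    by apply: cvg_at_left_filter; exact: ch.
  - by move=> t _; rewrite derive1E; have [] := hD t.
rewrite -integral12_prod_meas1//; apply: integral0_eq => t _; rewrite /fubini_F.
pose g (y : 'rV[R]_n) := psi (row_cons (t, y)).
have gD y : partial i g y = partial j psi (row_cons (t, y)) /\ derivable g y (delta_mx 0 i).
  have [|e1 e2] := @derive_line R _ _ _ g y (delta_mx 0 i) psi (row_cons (t, y)) (delta_mx 0 j).
    move=> s; rewrite /g jE row_cons_delta row_cons_scale row_cons_add.
    by rewrite mulr0 add0r.
  by split; [exact: e1|apply/e2; exact: dpsi].
have := IH g i _ _ (sliceN t); move=> <-.
- by apply: eq_integral => y _; rewrite /f; have [->] := gD y.
- by move=> y; have [] := gD y.
- move=> y; have -> : partial i g = fun x => partial j psi (row_cons (t, x)).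
    by apply/funext => x; have [] := gD x.
  exact: (continuous_comp (@continuous_row_consr n t y) (cpsi _)).
Qed.
End IntPartial.

(** * Affine functions: smoothness, weak gradients, subtraction from H^1 functions *)

Section Affine.
Context (R : realType) (n : nat).
Implicit Types (x g : 'rV[R]_n) (phi v : 'rV[R]_n -> R).

Lemma continuous_coord (i : 'I_n) : continuous (fun x : 'rV[R]_n => x 0 i).
Proof. exact: coord_continuous. Qed.

Lemma continuous_rowD phi v : continuous phi -> continuous v ->
  continuous (fun x => phi x + v x).
Proof. by move=> c1 c2 x; exact: (@continuousD _ _ _ phi v x (c1 x) (c2 x)). Qed.

Lemma continuous_rowM phi v : continuous phi -> continuous v ->
  continuous (fun x => phi x * v x).
Proof. by move=> c1 c2 x; exact: (@continuousM _ _ phi v x (c1 x) (c2 x)). Qed.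

Lemma continuous_rowB phi v : continuous phi -> continuous v ->
  continuous (fun x => phi x - v x).
Proof. by move=> c1 c2 x; exact: (@continuousB _ _ _ phi v x (c1 x) (c2 x)). Qed.

Lemma continuous_row_sum (T : Type) (s : seq T) (P : pred T) (f : T -> 'rV[R]_n -> R) :
  (forall t, continuous (f t)) -> continuous (fun x => \sum_(t <- s | P t) f t x).
Proof.
move=> cf; elim: s => [|t s IH].
  by under eq_fun do rewrite big_nil; exact: cst_continuous.
by under eq_fun do rewrite big_cons; case: (P t) => //; exact: continuous_rowD.
Qed.

Lemma continuous_row_prod (T : Type) (s : seq T) (P : pred T) (f : T -> 'rV[R]_n -> R) :
  (forall t, continuous (f t)) -> continuous (fun x => \prod_(t <- s | P t) f t x).
Proof.
move=> cf; elim: s => [|t s IH].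
  by under eq_fun do rewrite big_nil; exact: cst_continuous.
by under eq_fun do rewrite big_cons; case: (P t) => //; exact: continuous_rowM.
Qed.

Lemma continuous_affine g (c : R) : continuous (fun x => dot x g + c).
Proof.
apply: continuous_rowD; last exact: cst_continuous.
apply: continuous_row_sum => i.
by apply: continuous_rowM; [exact: continuous_coord|exact: cst_continuous].
Qed.

Lemma partial_affine g (c : R) j x : partial j (fun x => dot x g + c) x = g 0 j /\
  derivable (fun x => dot x g + c) x (delta_mx 0 j).
Proof.
have dl : dot (delta_mx 0 j) g = g 0 j.
  rewrite /dot (bigD1 j)//= big1 ?addr0; last first.
    by move=> i /negPf ij; rewrite !mxE ij andbF mul0r.
  by rewrite !mxE !eqxx mul1r.
have [|e1 e2] := @derive_line R _ _ _ (fun x => dot x g + c) x (delta_mx 0 j)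
   (fun t : R => t * g 0 j + (dot x g + c)) 0 1.
  by move=> s; rewrite dotDl dotZl dl addr0 addrA; congr (_ * _ + _ + _); rewrite /= [RHS]mulr1.
have h : is_derive (0 : R) 1 (fun t : R => t * g 0 j + (dot x g + c)) (g 0 j).
  apply: is_derive_eq; rewrite /GRing.scale /=; ring.
split; first by rewrite /partial e1; exact: derive_val.
by apply/e2; exact: ex_derive.
Qed.

Lemma smooth_cst (c : R) : smooth (fun _ : 'rV[R]_n => c).
Proof.
move=> m; elim: m c => [|m IH] c /=; (split; first exact: cst_continuous) => //.
move=> j; split; first by move=> x; exact: derivable_cst.
have -> : partial j (fun _ : 'rV[R]_n => c) = fun _ => 0.
  by apply/funext => x; exact: derive_cst.
exact: IH.
Qed.

Lemma smooth_affine g (c : R) : smooth (fun x => dot x g + c).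
Proof.
case=> [|m] /=; split => //; try exact: continuous_affine.
move=> j; split; first by move=> x; have [] := partial_affine g c j x.
have -> : partial j (fun x => dot x g + c) = fun _ => g 0 j.
  by apply/funext => x; have [] := partial_affine g c j x.
exact: smooth_cst.
Qed.

Lemma Cn_sub m phi v : Cn m phi -> Cn m v -> Cn m (fun x => phi x - v x).
Proof.
elim: m phi v => [|m IH] phi v /= [c1 d1] [c2 d2]; split=> //;
  try exact: continuous_rowB.
move=> j; have [dp Cp] := d1 j; have [dv Cv] := d2 j; split.
  by move=> x; exact: derivableB.
have -> : partial j (fun x => phi x - v x) = fun x => partial j phi x - partial j v x.
  by apply/funext => x; exact: deriveB.
exact: IH.
Qed.

Lemma measurable_affine g (c : R) : measurable_fun setT (fun x => dot x g + c).
Proof. by apply: continuous_row_measurable; exact: continuous_affine. Qed.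

Lemma test_fun_cube A phi : test_fun A phi ->
  exists N, [/\ 0 <= N, (forall x, ~ cube 0 N x -> phi x = 0),
   (forall j x, ~ cube 0 N x -> partial j phi x = 0) &
   (forall x, ~ A x -> phi x = 0 /\ forall j, partial j phi x = 0)].
Proof.
move=> [_ [S [cS SA] S0]].
have clS : closed S by apply: compact_closed => //; exact: norm_hausdorff.
have SN : exists N, 0 <= N /\ S `<=` cube 0 N.
  have [M [_ SM]] := compact_bounded cS; exists (`|M| + 1); split.
    exact: addr_ge0.
  move=> x Sx; apply: norm_cube; rewrite subr0; apply: SM => //.
  by rewrite (le_lt_trans (ler_norm _))// ltrDl.
have [N [N0 SN']] := SN; exists N; split => //.
- by move=> x xN; apply: S0 => /SN'.
- by move=> j x xN; apply: (partial_support j clS S0) => /SN'.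
- move=> x xA; split; first by apply: S0 => /SA.
  by move=> j; apply: (partial_support j clS S0) => /SA.
Qed.

(** By the product rule the two integrands add up to a partial derivative of the affine function
    times [phi], whose integral is 0. As [phi] is supported in [A], the integrals may be taken over
    the whole space. *)
Lemma weak_grad_affine A g (c : R) : weak_grad A (fun x => dot x g + c) (fun _ => g).
Proof.
move=> phi tphi j; have [N [N0 p0 dp0 pA]] := test_fun_cube tphi.
have [sphi _] := tphi; have [cphi dphi] := sphi 1.
have [dphij [cdphi _]] := dphi j.
have ca : continuous (fun x => dot x g + c) by exact: continuous_affine.
have rA (f : 'rV[R]_n -> R) : (forall x, ~ A x -> f x = 0) -> f \_ A = f.
  by move=> f0; apply/funext => x; rewrite patchE; case: ifPn => // /negP; rewrite inE => /f0 ->.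
rewrite Rintegral_mkcond rA; last by move=> x /pA[_ ->]; rewrite mulr0.
rewrite [in RHS]Rintegral_mkcond rA; last by move=> x /pA[-> _]; rewrite mulr0.
apply/eqP; rewrite -subr_eq0 opprK -RintegralD//; last 2 first.
- apply: (continuous_cube_integrable N0); first exact: continuous_rowM.
  by move=> x /dp0 ->; rewrite mulr0.
- apply: (continuous_cube_integrable N0); first by apply: continuous_rowM => //; exact: cst_continuous.
  by move=> x /p0 ->; rewrite mulr0.
have dprod x : derivable (fun x => (dot x g + c) * phi x) x (delta_mx 0 j).
  by apply: derivableM; [have [] := partial_affine g c j x|exact: dphij].
have pprod : partial j (fun x => (dot x g + c) * phi x) =
    fun x => (dot x g + c) * partial j phi x + g 0 j * phi x.
  apply/funext => x; have [e1 e2] := partial_affine g c j x.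
  rewrite /partial in e1 *.
  by rewrite deriveM// e1 /GRing.scale /= [phi x * _]mulrC.
rewrite -pprod /Rintegral (integral_partial_eq0 N0 dprod)//.
  rewrite pprod; apply: continuous_rowD; first exact: continuous_rowM.
  by apply: continuous_rowM => //; exact: cst_continuous.
by move=> x /p0 ->; rewrite mulr0.
Qed.

Lemma affine_bounded_cube g (c : R) (N : R) : 0 <= N ->
  exists M, forall x, cube 0 N x -> `|dot x g + c| <= M.
Proof. by move=> N0; apply: continuous_bounded_cube => //; exact: continuous_affine. Qed.

Lemma leb_sub_cube_lty A (N : R) : measurable A -> 0 <= N -> A `<=` cube 0 N ->
  (leb R n A < +oo)%E.
Proof.
move=> mA N0 AN; apply: (@le_lt_trans _ _ (leb R n (cube 0 N))).
  by apply: le_measure; rewrite ?inE//; exact: measurable_cube.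
exact: leb_cube_lty.
Qed.

Lemma L2_affine A (N : R) g (c : R) : measurable A -> 0 <= N -> A `<=` cube 0 N ->
  L2 A (fun x => dot x g + c).
Proof.
move=> mA N0 AN; have [M HM] := affine_bounded_cube g c N0.
apply: (L2_bounded mA (M := M)); first exact: leb_sub_cube_lty AN.
  by apply: measurable_funTS; exact: measurable_affine.
by move=> x /AN; exact: HM.
Qed.

Lemma weak_grad_integrable A v phi : L2 A v -> measurable A -> continuous phi ->
  (exists N, 0 <= N /\ A `<=` cube 0 N) ->
  (leb R n).-integrable A° (EFin \o (fun x => v x * phi x)).
Proof.
move=> Lv mA cphi [N [N0 AN]]; have [M HM] := continuous_bounded_cube N0 cphi.
apply: (@integrableS _ _ _ _ A) => //.
- by apply: open_row_measurable; exact: open_interior.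
- exact: interior_subset.
- apply: (L2_mul_integrable mA Lv).
  apply: (L2_bounded mA (M := M)); first exact: leb_sub_cube_lty AN.
    by apply: measurable_funTS; exact: continuous_row_measurable.
  by move=> x /AN; exact: HM.
Qed.

(** The errors of two discrete solutions differ on each element by an affine function; this keeps
    the shifted error in H^1. *)
Lemma H1_sub_affine A (N : R) v (Dv : 'rV[R]_n -> 'rV[R]_n) g (c : R) :
  measurable A -> 0 <= N -> A `<=` cube 0 N -> H1 A v Dv ->
  H1 A (fun x => v x - (dot x g + c)) (fun x => Dv x - g).
Proof.
move=> mA N0 AN [Lv LDv wv].
have La := L2_affine g c mA N0 AN.
have Lc (k : R) : L2 A (fun _ => k).
  apply: (L2_bounded mA (M := `|k|)) => //; exact: leb_sub_cube_lty AN.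
split.
- rewrite (_ : (fun _ => _) = fun x => v x + -1 * (dot x g + c)).
    by apply: L2D => //; exact: L2Z.
  by apply/funext => x; rewrite mulN1r.
- move=> j; rewrite (_ : (fun _ => _) = fun x => Dv x 0 j + (- g 0 j)).
    by apply: L2D.
  by apply/funext => x; rewrite !mxE.
- move=> phi tphi j; have [[sphi _]] := (tphi, tphi).
  have [cphi dphi] := sphi 1; have [_ [cdphi _]] := dphi j.
  have exN : exists N, 0 <= N /\ A `<=` cube 0 N by exists N.
  have mI : measurable A° by apply: open_row_measurable; exact: open_interior.
  transitivity (\int[leb R n]_(x in A°) (v x * partial j phi x) -
    \int[leb R n]_(x in A°) ((dot x g + c) * partial j phi x)).
    rewrite -RintegralB//; try exact: weak_grad_integrable.
    by apply: eq_Rintegral => x _; rewrite mulrBl.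
  rewrite (wv _ tphi) (weak_grad_affine g c tphi) opprK.
  transitivity (- (\int[leb R n]_(x in A°) (Dv x 0 j * phi x) -
    \int[leb R n]_(x in A°) (g 0 j * phi x))); first by rewrite opprB addrC.
  rewrite -RintegralB//; first last.
  + exact: (@weak_grad_integrable A (fun=> g 0 j)).
  + exact: (@weak_grad_integrable A (fun x => Dv x 0 j)).
  by congr (- _); apply: eq_Rintegral => x _; rewrite !mxE mulrBl.
Qed.
End Affine.

(** * Barycentric coordinates *)

Section Barycentric.
Context (R : realType) (d : nat) (M : mesh R d).
Local Notation I := 'I_(nvert M).
Implicit Types (K S F : {set I}) (z w : I) (x y : 'rV[R]_d).

(** Barycentric coordinates as pairs of gradient and constant, hence as affine functions on the
    whole space; vertices outside [K] receive the zero function. *)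
Definition bary_spec K (p : (I -> 'rV[R]_d) * (I -> R)) :=
  [/\ forall x, \sum_z (dot x (p.1 z) + p.2 z) = 1,
      forall x, \sum_z (dot x (p.1 z) + p.2 z) *: vtx z = x &
      forall z, z \notin K -> p.1 z = 0 /\ p.2 z = 0].

(** Affine independence makes the matrix [P] of the vertices of [K], each extended by a last entry
    1, invertible. The first [d] rows of the inverse [Q] hold the gradients and its last row the
    constants. *)
Lemma bary_spec_ex K : #|K| = d.+1 -> aff_indep K -> exists p, bary_spec K p.
Proof.
move=> cK aK.
pose ext (x : 'rV[R]_d) : 'rV[R]_d.+1 :=
  \row_j (if unlift ord_max j is Some j' then x 0 j' else 1).
pose P : 'M[R]_(#|K|, d.+1) := \matrix_(k, j) ext (vtx (enum_val k)) 0 j.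
pose co (u : 'rV[R]_#|K|) z :=
  if [pick k : 'I_#|K| | enum_val k == z] is Some k then u 0 k else 0.
have coE u k : co u (enum_val k) = u 0 k.
  rewrite /co; case: pickP => [k' /eqP/enum_val_inj ->//|/(_ k)].
  by rewrite eqxx.
have coN u z : z \notin K -> co u z = 0.
  move=> zK; rewrite /co; case: pickP => // k /eqP ez.
  by move: zK; rewrite -ez enum_valP.
have sumco (V : lmodType R) u (f : I -> V) :
    \sum_z co u z *: f z = \sum_k u 0 k *: f (enum_val k).
  rewrite (bigID (mem K)) /= [X in _ + X]big1 ?addr0.
    by rewrite big_enum_val; apply: eq_bigr => k _; rewrite coE.
  by move=> z zK; rewrite coN// scale0r.
have mulP u j : (u *m P) 0 j = \sum_k u 0 k * ext (vtx (enum_val k)) 0 j.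
  by rewrite mxE; apply: eq_bigr => k _; rewrite mxE.
have sum1 u : \sum_z co u z = (u *m P) 0 ord_max.
  have := sumco R^o u (fun _ => 1); rewrite mulP => e.
  transitivity (\sum_z co u z *: (1 : R^o)); first by apply: eq_bigr => z _; rewrite [RHS]mulr1.
  by rewrite e; apply: eq_bigr => k _; rewrite mxE unlift_none.
have sumv u j : (\sum_z co u z *: vtx z) 0 j = (u *m P) 0 (lift ord_max j).
  rewrite sumco summxE mulP; apply: eq_bigr => k _.
  by rewrite !mxE liftK.
have rfP : row_free P.
  apply: inj_row_free => u uP; apply/rowP => k; rewrite mxE -coE.
  apply: (aK (co u)); first exact: coN.
    by rewrite sum1 uP mxE.
  by apply/rowP => j; rewrite sumv uP !mxE.
have /row_fullP[Q QP] : row_full P by rewrite /row_full (eqP rfP) cK.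
have colE (x : 'rV[R]_d) (q : 'I_#|K|) : (ext x *m Q) 0 q =
    dot x (\row_j Q (lift ord_max j) q) + Q ord_max q.
  rewrite mxE (bigD1 ord_max)//= addrC mxE unlift_none mul1r; congr (_ + _).
  rewrite (reindex_omap (lift ord_max) (unlift ord_max)) /=; last first.
    by move=> i; case: unliftP => [j ->|->]; rewrite ?eqxx// liftK.
  by apply: eq_big => [j|j _]; rewrite ?liftK ?eqxx ?mxE ?liftK// eq_sym neq_lift.
pose g z := \row_j co (row (lift ord_max j) Q) z.
pose c z := co (row ord_max Q) z.
have coext x z : dot x (g z) + c z = co (ext x *m Q) z.
  rewrite /c /g /co; case: pickP => [k _|_]; last first.
    by rewrite addr0 /dot big1// => i _; rewrite mxE mulr0.
  rewrite colE !mxE; congr (_ + _); apply: eq_bigr => i _.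
  by rewrite !mxE.
exists (g, c); split => /= [x|x|z zK].
- under eq_bigr do rewrite coext.
  by rewrite sum1 -mulmxA QP mulmx1 mxE unlift_none.
- under eq_bigr do rewrite coext.
  by apply/rowP => j; rewrite sumv -mulmxA QP mulmx1 mxE liftK.
- by rewrite /c coN//; split=> //; apply/rowP => j; rewrite !mxE coN.
Qed.

Definition bary_coef K := xget (fun=> 0, fun=> 0) [set p | bary_spec K p].

Definition glam K z : 'rV[R]_d := (bary_coef K).1 z.

(* The barycentric coordinates of an element, extended to affine functions on
   the whole space. *)
Definition lam K z x : R := dot x (glam K z) + (bary_coef K).2 z.

Lemma lam_line K z x y t : lam K z (x + t *: (y - x)) = (1 - t) * lam K z x + t * lam K z y.
Proof. rewrite /lam dotDl dotZl dotBl; ring. Qed.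

Lemma lam_dir K z x v t : lam K z (x + t *: v) = lam K z x + t * dot v (glam K z).
Proof. rewrite /lam dotDl dotZl; ring. Qed.

Lemma lamB K z x y : lam K z x - lam K z y = dot (x - y) (glam K z).
Proof. rewrite /lam dotBl; ring. Qed.

Lemma continuous_lam K z : continuous (lam K z).
Proof. exact: continuous_affine. Qed.

Variable Omega : set 'rV[R]_d.
Hypothesis mM : is_mesh Omega M.

Section Element.
Variable K : {set I}.
Hypothesis hK : K \in elts M.

Lemma elt_card : #|K| = d.+1. Proof. by case: mM => _ _ /(_ _ hK)[]. Qed.

Lemma elt_indep : aff_indep K. Proof. by case: mM => _ _ /(_ _ hK)[]. Qed.

Let lamP : bary_spec K (bary_coef K).
Proof.
rewrite /bary_coef; case: xgetP => [p -> //|H].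
by have [p hp] := bary_spec_ex elt_card elt_indep; case: (H p).
Qed.

Lemma lam_sum x : \sum_z lam K z x = 1.
Proof. by case: lamP => + _ _; apply. Qed.

Lemma lam_vtx_sum x : \sum_z lam K z x *: vtx z = x.
Proof. by case: lamP => _ + _; apply. Qed.

Lemma glam_notin z : z \notin K -> glam K z = 0.
Proof. by case: lamP => _ _ + zK => /(_ _ zK)[]. Qed.

Lemma lam_notin z x : z \notin K -> lam K z x = 0.
Proof.
move=> zK; rewrite /lam glam_notin// dotC dot0l add0r.
by case: lamP => _ _ /(_ _ zK)[].
Qed.

(** Affine independence applied to the difference of the coefficients. It identifies any convex
    coefficients that come with a point of a simplex. *)
Lemma lam_unique (c : I -> R) x : (forall z, z \notin K -> c z = 0) ->
  \sum_z c z = 1 -> \sum_z c z *: vtx z = x -> forall z, c z = lam K z x.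
Proof.
move=> cN c1 cx z; apply/eqP; rewrite -subr_eq0; apply/eqP.
apply: (elt_indep (c := fun z => c z - lam K z x)).
- by move=> w wK; rewrite cN// lam_notin// subr0.
- by rewrite sumrB c1 lam_sum subrr.
- under eq_bigr do rewrite scalerBl.
  by rewrite sumrB cx lam_vtx_sum subrr.
Qed.

Lemma lam_vtx z w : z \in K -> lam K w (vtx z) = (w == z)%:R.
Proof.
move=> zK; apply/esym/(lam_unique (c := fun w => (w == z)%:R)).
- by move=> v vK; case: eqP vK => // ->; rewrite zK.
- by rewrite (bigD1 z)//= eqxx big1 ?addr0// => v /negPf ->.
- rewrite (bigD1 z)//= eqxx scale1r big1 ?addr0// => v /negPf ->.
  by rewrite scale0r.
Qed.

Lemma simplexE S x : S \subset K ->
  simplex S x <-> (forall z, 0 <= lam K z x) /\ (forall z, z \notin S -> lam K z x = 0).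
Proof.
move=> /fintype.subsetP SK; split=> [[c [c0 cN c1 cx]]|[l0 lN]].
  have cE := lam_unique (fun z zK => cN z (contra (SK z) zK)) c1 cx.
  by split=> z; rewrite -cE; [exact: c0|exact: cN].
exists (fun z => lam K z x); split => //; [exact: lam_sum|exact: lam_vtx_sum].
Qed.

Lemma eltE x : simplex K x <-> (forall z, 0 <= lam K z x).
Proof.
rewrite simplexE//; split=> [[]//|H]; split=> // z zK; exact: lam_notin.
Qed.

Lemma lam_affine g (c : R) x :
  dot x g + c = \sum_z lam K z x * (dot (vtx z) g + c).
Proof.
under eq_bigr do rewrite mulrDr.
rewrite big_split /= -mulr_suml lam_sum mul1r; congr (_ + _).
rewrite -[in LHS](lam_vtx_sum x) dot_suml.
by apply: eq_bigr => z _; rewrite dotZl.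
Qed.

Lemma elt_closed : closed (simplex K).
Proof.
rewrite (_ : simplex K = \bigcap_(z in [set: I]) (lam K z @^-1` [set t | 0 <= t])).
  apply: closed_bigI => z _; apply: closed_comp; last exact: closed_ge.
  by move=> ? _; exact: continuous_lam.
by apply/seteqP; split => x; [move=> /eltE H z _; exact: H|move=> H; apply/eltE => z; exact: H].
Qed.

Lemma measurable_elt : measurable (simplex K).
Proof. exact: closed_row_measurable elt_closed. Qed.

Lemma lam_pos_nbhs S x : (forall z, z \in S -> 0 < lam K z x) ->
  exists2 e, 0 < e & forall y, `|y - x| < e -> forall z, z \in S -> 0 < lam K z y.
Proof.
move=> lp; have H z : nbhs x [set y | z \in S -> 0 < lam K z y].
  have [zS|zS] := boolP (z \in S); last exact: filterS filterT.
  have : nbhs x (lam K z @^-1` [set t | 0 < t]).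
    apply: (@continuous_lam K z x); apply: open_nbhs_nbhs.
    by split; [exact: open_gt|exact: lp].
  by apply: filterS => y /=.
have /nbhs_rowP[e e0 He] := @filter_forall _ _ _ _ (@nbhs_filter _ x) H.
by exists e => // y ye z; exact: He.
Qed.

Lemma elt_int_nbhs x : (forall z, z \in K -> 0 < lam K z x) -> nbhs x (simplex K).
Proof.
move=> /lam_pos_nbhs[e e0 He]; apply/nbhs_rowP; exists e => // y /He H.
apply/eltE => z; have [/H/ltW//|zK] := boolP (z \in K).
by rewrite lam_notin.
Qed.

End Element.

(** The face-to-face condition writes a common point as a convex combination of common vertices, and
    these coefficients are its barycentric coordinates in both elements. Hat functions are
    single-valued for this reason. *)
Lemma elt_common K K' x : K \in elts M -> K' \in elts M ->
  simplex K x -> simplex K' x -> forall z, lam K z x = lam K' z x.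
Proof.
move=> hK hK' xK xK'.
have [c [c0 cN c1 cx]] : simplex (K :&: K') x.
  by case: mM => _ _ _ _ /(_ _ _ hK hK') <-; split.
move=> z; rewrite -(lam_unique hK _ c1 cx); last first.
  by move=> w wK; apply: cN; rewrite inE negb_and wK.
rewrite -(lam_unique hK' _ c1 cx)// => w wK.
by apply: cN; rewrite inE negb_and wK orbT.
Qed.

Lemma elt_pos_sub K K' x z : K \in elts M -> K' \in elts M ->
  simplex K x -> simplex K' x -> 0 < lam K z x -> z \in K'.
Proof.
move=> hK hK' xK xK' p; apply: contraPT p => zK'.
by rewrite (elt_common hK hK' xK xK') (lam_notin hK')// ltxx.
Qed.

Lemma elt_sub_eq K K' : K \in elts M -> K' \in elts M -> K \subset K' -> K = K'.
Proof. by move=> hK hK' KK'; apply/eqP; rewrite eqEcard KK' (elt_card hK) (elt_card hK') leqnn. Qed.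

Lemma elt_int_eq K K' x : K \in elts M -> K' \in elts M ->
  (forall z, z \in K -> 0 < lam K z x) -> simplex K' x -> K = K'.
Proof.
move=> hK hK' lp xK'; apply: elt_sub_eq => //; apply/fintype.subsetP => z zK.
have xK : simplex K x := nbhs_singleton (elt_int_nbhs hK lp).
exact: (elt_pos_sub hK hK' xK xK' (lp _ zK)).
Qed.

Lemma hatE K z x : K \in elts M -> simplex K x -> hat z x = lam K z x.
Proof.
move=> hK xK; have [K' hK' [c0 cN c1 cx]] :
    exists2 K, K \in elts M & conv_coef K (@bary _ _ M x) x.
  apply: (@xgetPex _ (fun=> 0) [set c | exists2 K, K \in elts M & conv_coef K c x]).
  exists (fun z => lam K z x); exists K => //.
  have lp := (eltE hK x).1 xK.
  by split => //; [move=> w; exact: lam_notin|exact: lam_sum|exact: lam_vtx_sum].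
have xK' : simplex K' x by exists (bary x); split.
by rewrite (elt_common hK hK' xK xK'); exact: (lam_unique hK' cN c1 cx).
Qed.

Lemma vtx_elt K z : z \in K -> simplex K (vtx z).
Proof.
move=> zK; exists (fun w => (w == z)%:R); split.
- by move=> w; exact: ler0n.
- by move=> w wK; case: eqP wK => // ->; rewrite zK.
- by rewrite (bigD1 z)//= eqxx big1 ?addr0// => w /negPf ->.
- by rewrite (bigD1 z)//= eqxx scale1r big1 ?addr0// => w /negPf ->; rewrite scale0r.
Qed.

Lemma mesh_closureE x : closure Omega x <-> exists2 K, K \in elts M & simplex K x.
Proof. by case: mM => _ _ _ -> _. Qed.

Lemma simplexS S S' : S \subset S' -> simplex S `<=` simplex S'.
Proof.
move=> /fintype.subsetP SS x [c [c0 cN c1 cx]]; exists c; split => // z zS'.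
by apply: cN; apply: contra zS' => /SS.
Qed.

Lemma simplex_segment S x y t : simplex S x -> simplex S y -> 0 <= t <= 1 ->
  simplex S (x + t *: (y - x)).
Proof.
move=> [c [c0 cN c1 cx]] [e [e0 eN e1 ey]] /andP[t0 t1].
exists (fun z => (1 - t) * c z + t * e z); split.
- by move=> z; rewrite addr_ge0 ?mulr_ge0 ?subr_ge0.
- by move=> z zS; rewrite cN// eN// !mulr0 addr0.
- by rewrite big_split /= -!mulr_sumr c1 e1; ring.
- under eq_bigr do rewrite scalerDl -!scalerA.
  rewrite big_split /= -!scaler_sumr cx ey scalerBr scalerBl scale1r.
  by rewrite addrA addrAC.
Qed.

(** Serves as a point of the relative interior: its coordinates at the vertices of [S] all equal
    [1 / #|S|]. *)
Definition centroid S : 'rV[R]_d := \sum_(z in S) #|S|%:R^-1 *: vtx z.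

Lemma centroid_conv S : S != finset.set0 ->
  conv_coef S (fun z => if z \in S then #|S|%:R^-1 else 0) (centroid S).
Proof.
move=> S0; have c0 : (#|S|%:R : R) != 0 by rewrite pnatr_eq0 cards_eq0.
split.
- by move=> z; case: ifP => // _; rewrite invr_ge0 ler0n.
- by move=> z /negPf ->.
- by rewrite -big_mkcond /= sumr_const -[X in X = _]mulr_natr mulVf.
- rewrite /centroid [RHS]big_mkcond; apply: eq_bigr => z _.
  by case: ifP => // _; rewrite scale0r.
Qed.

Lemma lam_centroid K S z : K \in elts M -> S \subset K -> S != finset.set0 ->
  lam K z (centroid S) = if z \in S then #|S|%:R^-1 else 0.
Proof.
move=> hK /fintype.subsetP SK S0; have [c0 cN c1 cx] := centroid_conv S0.
rewrite -(lam_unique hK _ c1 cx)// => w wK; apply: cN.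
by apply: contra wK => /SK.
Qed.

End Barycentric.

(** * Faces and stars of a mesh *)

Section LipschitzBoundary.
Context (R : realType) (d : nat) (Omega : set 'rV[R]_d).

Lemma bdry_open x : open Omega -> bdry Omega x <-> closure Omega x /\ ~ Omega x.
Proof. by move=> /interior_id oO; rewrite /bdry oO. Qed.

(** Otherwise the point [y], at depth [s] straight below [x], would be a limit of points of [Omega].
    Such points lie above the graph, while [x] lies on or below it, and the Lipschitz bound forbids
    the graph to drop by almost [s] over so short a horizontal distance. *)
Lemma lipschitz_bdry_not_nbhs x : open Omega -> lipschitz_boundary Omega ->
  bdry Omega x -> ~ nbhs x (closure Omega).
Proof.
move=> oO lip bx /nbhs_rowP[eps eps0 Heps].
have [_ xO] := (bdry_open x oO).1 bx.
have [e [rho [L [psi [e1 rho0 psiL psiO]]]]] := lip x bx.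
have xpsi : dot x e <= psi (x - dot x e *: e).
  rewrite leNgt; apply/negP => h; apply: xO; apply/psiO => //.
  by rewrite subrr enorm0.
pose s := Num.min eps rho / 2.
have m0 : 0 < Num.min eps rho by rewrite lt_min eps0.
have s0 : 0 < s by rewrite divr_gt0.
have se : s < eps.
  rewrite /s ltr_pdivrMr// (le_lt_trans (y := eps))//; first by rewrite ge_min lexx.
  by rewrite ltr_pMr// ltr1n.
have sr : s + s <= rho.
  by rewrite /s -splitr ge_min lexx orbT.
have ee : dot e e = 1 by rewrite -sqr_enorm e1 expr1n.
pose y := x - s *: e.
have cy : closure Omega y.
  apply: Heps; rewrite /y addrC addKr normrN normrZ gtr0_norm//.
  by apply: le_lt_trans se; rewrite ger_pMr// (le_trans (norm_le_enorm e))// e1.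
(* Chosen so that [2 dl + 4 |L| dl = s]: the descent by [s] exceeds the displacement [dl] plus the
   variation [2 |L| dl] of the graph. *)
pose dl := s / (2 * (1 + 2 * `|L|)).
have dl0 : 0 < dl by rewrite divr_gt0// mulr_gt0.
have dlE : 2 * (1 + 2 * `|L|) * dl = s by rewrite /dl mulrC mulfVK// gt_eqF// mulr_gt0.
have [y' [y'O y'y]] : (Omega `&` [set z | enorm (z - y) <= dl]) !=set0.
  apply: cy; apply/nbhs_rowP; exists (dl / d.+1%:R).
    by rewrite divr_gt0// ltr0n.
  move=> z; rewrite /= => zy; apply: le_trans (enorm_le_norm _) _.
  rewrite -[leRHS](@divfK _ d.+1%:R) ?pnatr_eq0//.
  rewrite [leRHS]mulrC ler_pM//; last exact: ltW.
  by rewrite ler_nat.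
have ny'x : enorm (y' - x) < rho.
  have -> : y' - x = (y' - y) + (- s) *: e.
    by rewrite /y opprB scaleNr addrA addrAC addrK.
  apply: le_lt_trans (ler_enormD _ _) _.
  rewrite enormZ e1 mulr1 normrN gtr0_norm//.
  have : 0 <= `|L| * dl by rewrite mulr_ge0// ltW.
  by move: y'y => /=; move: dlE; nra.
have {}psiO := (psiO _ ny'x).1 y'O.
pose w := y' - y; have wdl : enorm w <= dl by [].
have we : `|dot w e| <= enorm w by rewrite (le_trans (dot_cauchy _ _))// e1 mulr1.
have y'E : dot y' e = dot x e - s + dot w e.
  by rewrite /w /y !dotBl dotZl ee mulr1; ring.
have projE : (y' - dot y' e *: e) - (x - dot x e *: e) = w - dot w e *: e.
  rewrite y'E {1}/w {1}/y; apply/rowP => i; rewrite !mxE; ring.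
have en : enorm (w - dot w e *: e) <= 2 * dl.
  apply: le_trans (ler_enormD _ _) _; rewrite enormN enormZ e1 mulr1.
  have := le_trans we wdl; lra.
have psix : `|psi (y' - dot y' e *: e) - psi (x - dot x e *: e)| <= `|L| * (2 * dl).
  apply: le_trans (psiL _ _) _; rewrite projE.
  apply: le_trans (ler_wpM2r (enorm_ge0 _) (ler_norm L)) _.
  exact: ler_wpM2l.
have w1 : dot w e <= dl by rewrite (le_trans (ler_norm _))// (le_trans we).
move: psix; rewrite ler_norml => /andP[psix _].
have Ldl : 0 <= `|L| * dl by rewrite mulr_ge0// ltW.
have dlE' : 2 * dl + 4 * (`|L| * dl) = s by rewrite -dlE; ring.
have h2 : psi (y' - dot y' e *: e) < dot x e - s + dl.
  by apply: lt_le_trans psiO _; rewrite y'E lerD2l.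
have key (a b c l m : R) : - (l * (2 * m)) <= a - b -> a < c - s + m -> c <= b ->
    2 * m + 4 * (l * m) = s -> 0 <= l * m -> 0 < m -> False by lra.
exact: key psix h2 xpsi dlE' Ldl dl0.
Qed.
End LipschitzBoundary.

(** The minimum over [S] of [p / (1 + |q|) / 2]; the cap at 1 keeps the perturbed point on a
    segment. *)
Lemma small_pos (R : realFieldType) (I : finType) (S : {set I}) (p q : I -> R) :
  (forall i, i \in S -> 0 < p i) ->
  exists2 e, 0 < e <= 1 & forall t, 0 <= t <= e -> forall i, i \in S -> 0 < p i + t * q i.
Proof.
move=> pS; pose f i := p i / (1 + `|q i|) / 2.
have f0 i : i \in S -> 0 < f i.
  by move=> iS; rewrite !divr_gt0 ?pS// ltr_pwDl.
exists (\big[Num.min/1]_(i in S) f i).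
  apply/andP; split; first exact: lt_bigmin.
  exact: bigmin_le_id.
move=> t /andP[t0 te] i iS.
have tf : t <= f i by apply: le_trans te _; exact: bigmin_le_cond.
have h : t * (1 + `|q i|) <= p i / 2.
  rewrite -ler_pdivlMr ?ltr_pwDl//; apply: le_trans tf _.
  by rewrite /f mulrAC.
have := pS _ iS; have : - `|q i| <= q i by rewrite lerNl -normrN ler_norm.
have : 0 <= `|q i| by [].
by move: (p i) (q i) (`|q i|) h => a b c; nra.
Qed.

Section Generic.
Context (R : realType) (d : nat).
Implicit Types (x y p q n : 'rV[R]_d).

(** Induction on the list: if the point fails for the head [n], it is moved along [n] itself, by so
    little that the products with the tail stay nonzero. *)
Lemma generic_point (s : seq 'rV[R]_d) p q0 (e : R) : (forall n, n \in s -> n != 0) -> 0 < e ->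
  exists q, `|q - q0| < e /\ forall n, n \in s -> dot (q - p) n != 0.
Proof.
elim: s e => [|n s IH] e sN e0; first by exists q0; rewrite subrr normr0.
have [|//|q [qe qs]] := IH (e / 2); [by move=> m ms; apply: sN; rewrite in_cons ms orbT|by rewrite divr_gt0|].
have [qn|qn] := eqVneq (dot (q - p) n) 0; last first.
  exists q; split; first by apply: lt_trans qe _; rewrite ltr_pdivrMr// ltr_pMr// ltr1n.
  by move=> m; rewrite in_cons => /orP[/eqP->//|]; exact: qs.
have n0 : n != 0 by apply: sN; rewrite mem_head.
have [t0 t0p Ht] : exists2 t0, 0 < t0 & forall t, 0 < t <= t0 -> forall m, m \in s ->
    dot (q - p) m + t * dot n m != 0.
  elim: s qs {IH sN} => [|m s IHs] qs; first by exists 1.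
  have [|t0 t0p Ht] := IHs; first by move=> k ks; apply: qs; rewrite in_cons ks orbT.
  have qm : dot (q - p) m != 0 by apply: qs; rewrite mem_head.
  exists (Num.min t0 (`|dot (q - p) m| / 2 / (1 + `|dot n m|))).
    by rewrite lt_min t0p /= !divr_gt0 ?normr_gt0.
  move=> t /andP[tp]; rewrite le_min => /andP[tt0 tm] k.
  rewrite in_cons => /orP[/eqP->|ks]; last by apply: Ht => //; rewrite tp.
  move: tm; rewrite ler_pdivlMr// => tm; apply/negP => /eqP /(canRL (addrK _)).
  rewrite sub0r => h; move: tm; rewrite h normrN normrM (gtr0_norm tp).
  have : 0 < `|dot (q - p) m| by rewrite normr_gt0.
  rewrite h normrN normrM (gtr0_norm tp).
  by move: (`|dot n m|) => a; nra.
pose t := Num.min t0 (e / 2 / (1 + `|n|)).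
have tp : 0 < t by rewrite lt_min t0p !divr_gt0.
exists (q + t *: n); split.
  have -> : q + t *: n - q0 = (q - q0) + t *: n by rewrite addrAC.
  apply: le_lt_trans (ler_normD _ _) _; rewrite [ltRHS](splitr e).
  apply: ltr_leD => //; rewrite normrZ (gtr0_norm tp).
  apply: (@le_trans _ _ (e / 2 / (1 + `|n|) * `|n|)).
    by rewrite ler_wpM2r// ge_min lexx orbT.
  rewrite mulrAC ler_pdivrMr// ler_pM2l ?divr_gt0//.
  by rewrite lerDr.
move=> m; rewrite in_cons addrAC dotDl dotZl => /orP[/eqP->|ms]; last first.
  by apply: Ht => //; rewrite tp ge_min lexx.
rewrite qn add0r mulf_neq0 ?gt_eqF//.
by rewrite -sqr_enorm exprn_gt0// lt_neqAle enorm_ge0 andbT eq_sym; apply: contra n0 => /eqP/enorm_eq0->.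
Qed.

(** Fewer than [d] vectors form a matrix of rank below [d], which has a nonzero kernel row. With the
    vectors [vtx w - p] it places [p] and a simplex with fewer than [d] vertices in one
    hyperplane. *)
Lemma normal_exists (T : finType) (S : {set T}) (v : T -> 'rV[R]_d) : (#|S| < d)%N ->
  exists2 n : 'rV[R]_d, n != 0 & forall z, z \in S -> dot (v z) n = 0.
Proof.
move=> Sd; pose A : 'M[R]_(d, #|S|) := \matrix_(j, k) v (enum_val k) 0 j.
have : kermx A != 0.
  rewrite -mxrank_eq0 mxrank_ker subn_eq0 -ltnNge.
  exact: leq_ltn_trans (rank_leq_col A) Sd.
move=> /rowV0Pn[n /sub_kermxP nA n0]; exists n => // z zS.
have /rowP/(_ (enum_rank_in zS z)) := nA; rewrite !mxE => e.
rewrite -[RHS]e; apply: eq_bigr => j _; rewrite !mxE enum_rankK_in//.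
by rewrite mulrC.
Qed.
End Generic.

(** * Two-sided and one-sided faces, and chains of elements around a vertex *)

Section Faces.
Context (R : realType) (d : nat) (Omega : set 'rV[R]_d) (M : mesh R d).
Local Notation I := 'I_(nvert M).
Implicit Types (K S F : {set I}) (z w : I) (x y : 'rV[R]_d).
Hypothesis mM : is_mesh Omega M.
Hypothesis d0 : (0 < d)%N.

Lemma face_ext K F : K \in elts M -> F \subset K -> #|F| = d ->
  exists a, [/\ a \in K, a \notin F & K = a |: F].
Proof.
move=> hK FK cF; have : #|K :\: F| == 1%N.
  by rewrite cardsD (finset.setIidPr FK) (elt_card mM hK) cF subSnn.
move=> /cards1P[a Ka]; have : a \in K :\: F by rewrite Ka inE.
rewrite inE => /andP[aF aK]; exists a; split=> //.
apply/setP => z; rewrite !inE; apply/idP/orP => [zK|[/eqP->//|]]; last exact: (fintype.subsetP FK).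
have [zF|zF] := boolP (z \in F); [by right|left].
by have := finset.in_set1 z a; rewrite -Ka !inE zF zK => <-.
Qed.

Lemma face_neq0 F : #|F| = d -> F != finset.set0.
Proof. by move=> cF; rewrite -card_gt0 cF. Qed.

Lemma lam_centroid_face K F z : K \in elts M -> F \subset K -> #|F| = d ->
  (z \in F -> 0 < lam K z (centroid F)) /\ (z \notin F -> lam K z (centroid F) = 0).
Proof.
move=> hK FK cF; rewrite (lam_centroid mM _ hK FK (face_neq0 cF)).
by case: (z \in F); split => // _; rewrite invr_gt0 ltr0n cF.
Qed.

Section TwoElements.
Variables (K1 K2 F : {set I}) (a b : I).
Hypotheses (h1 : K1 \in elts M) (h2 : K2 \in elts M) (K12 : K1 != K2).
Hypotheses (F1 : F \subset K1) (F2 : F \subset K2) (cF : #|F| = d).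
Hypotheses (aK : a \in K1) (aF : a \notin F) (bK : b \in K2) (bF : b \notin F).

Lemma elt_face_add : K1 = a |: F.
Proof.
have [a' [aK' aF' E]] := face_ext h1 F1 cF.
by move: aK; rewrite {1}E !inE (negPf aF) orbF => /eqP ->.
Qed.

Lemma elt_cap_face : b \notin K1.
Proof.
apply: contra K12 => bK1; apply/eqP/esym/(elt_sub_eq mM) => //.
have [b' [bK' bF' E]] := face_ext h2 F2 cF.
have bb' : b = b' by move: bK; rewrite {1}E !inE (negPf bF) orbF => /eqP.
by rewrite E -bb'; apply/fintype.subsetP => z; rewrite !inE => /orP[/eqP->//|/(fintype.subsetP F1)].
Qed.

(* Otherwise the segment from the centroid of F to b enters K1 outside F. *)
Lemma opposite_side : lam K1 a (vtx b) < 0.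
Proof.
rewrite ltNge; apply/negP => ab.
pose x := centroid F : 'rV[R]_d.
have [e /andP[e0 e1] He] := small_pos (S := F) (p := fun z => lam K1 z x)
  (fun z => lam K1 z (vtx b) - lam K1 z x) (fun z zF => (lam_centroid_face z h1 F1 cF).1 zF).
pose y := x + e *: (vtx b - x).
have yl z : lam K1 z y = lam K1 z x + e * (lam K1 z (vtx b) - lam K1 z x).
  by rewrite lam_line; ring.
have y1 : simplex K1 y.
  apply/(eltE mM) => // z; have [zK|zK] := boolP (z \in K1); last by rewrite (lam_notin mM).
  rewrite yl; have [zF|zF] := boolP (z \in F).
    by apply: ltW; apply: He => //; rewrite lexx ltW.
  have -> : z = a by move: zK; rewrite elt_face_add !inE (negPf zF) orbF => /eqP.
  rewrite (lam_centroid_face a h1 F1 cF).2// add0r subr0.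
  by rewrite mulr_ge0// ltW.
have x2 : simplex K2 x.
  by apply: (simplexS F2); eexists; exact: (centroid_conv (face_neq0 cF)).
have y2 : simplex K2 y.
  apply: simplex_segment => //; first exact: vtx_elt.
  by rewrite ltW.
have : lam K2 b y = e.
  rewrite lam_line (lam_vtx mM)// eqxx (lam_centroid_face b h2 F2 cF).2//.
  by rewrite mulr0 mulr1 add0r.
have := elt_common mM h1 h2 y1 y2 b; rewrite (lam_notin mM)//; last exact: elt_cap_face.
by move=> <- e0'; move: e0; rewrite -e0' ltxx.
Qed.

(** Expansion of an affine function in the coordinates of [K2]: [lam K1 a] vanishes at the vertices
    of [F], so only its value at [b] survives. By [opposite_side] that factor is negative. *)
Lemma lam_across y : lam K1 a y = lam K1 a (vtx b) * lam K2 b y.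
Proof.
rewrite {1}/lam (lam_affine mM h2) (bigD1 b)//= [X in _ + X]big1 ?addr0.
  by rewrite mulrC.
move=> z zb; have [zK|zK] := boolP (z \in K2); last by rewrite (lam_notin mM)// mul0r.
have [b' [bK' bF' E]] := face_ext h2 F2 cF.
have bb' : b = b' by move: bK; rewrite {1}E !inE (negPf bF) orbF => /eqP.
have zF : z \in F by move: zK; rewrite E -bb' !inE (negPf zb).
rewrite -/(lam K1 a (vtx z)) (lam_vtx mM) ?(fintype.subsetP F1)//.
by case: eqP aF => [->|]; rewrite ?zF// mulr0.
Qed.

(** Nearby, the coordinates of the vertices of [F] stay positive in both elements. The two remaining
    coordinates have opposite signs by [lam_across], so one of the elements contains the point. *)
Lemma face_two_nbhs x : (forall z, z \in F -> 0 < lam K1 z x) ->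
  (forall z, z \notin F -> lam K1 z x = 0) ->
  nbhs x (simplex K1 `|` simplex K2).
Proof.
move=> xF xN.
have x1 : simplex F x.
  by apply/(simplexE mM h1 _ F1); split=> // z; have [/xF/ltW//|/xN->//] := boolP (z \in F).
have /(lam_pos_nbhs (S := F))[e e0 He] := xF.
have /(lam_pos_nbhs (S := F))[e' e0' He'] : forall z, z \in F -> 0 < lam K2 z x.
  by move=> z zF; rewrite -(elt_common mM h1 h2 (simplexS F1 x1) (simplexS F2 x1)) xF.
apply/nbhs_rowP; exists (Num.min e e'); first by rewrite lt_min e0.
move=> y; rewrite lt_min => /andP[/He y1 /He' y2].
have lp K c : K = c |: F -> K \in elts M -> 0 <= lam K c y ->
    (forall z, z \in F -> 0 < lam K z y) -> simplex K y.
  move=> KE hK cy py; apply/(eltE mM) => // z.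
  have [zK|zK] := boolP (z \in K); last by rewrite (lam_notin mM).
  by move: zK; rewrite {1}KE !inE => /orP[/eqP->//|/py/ltW].
have K2E : K2 = b |: F.
  have [b' [bK' bF' E]] := face_ext h2 F2 cF.
  by move: bK; rewrite {1}E !inE (negPf bF) orbF => /eqP ->.
have [ay|ay] := leP 0 (lam K1 a y); [left|right].
  exact: (lp _ _ elt_face_add).
apply: (lp _ _ K2E) => //; move: ay; rewrite lam_across.
by rewrite nmulr_rlt0 ?opposite_side// => /ltW.
Qed.

End TwoElements.

(** The three apexes would lie pairwise on opposite sides of the hyperplane of [F], which has only
    two sides. *)
Lemma face_third K1 K2 K3 F : K1 \in elts M -> K2 \in elts M -> K3 \in elts M ->
  F \subset K1 -> F \subset K2 -> F \subset K3 -> #|F| = d ->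
  K1 != K2 -> K1 != K3 -> K2 = K3.
Proof.
move=> h1 h2 h3 F1 F2 F3 cF n12 n13; apply/eqP/negPn/negP => n23.
have [a [aK aF _]] := face_ext h1 F1 cF.
have [b [bK bF _]] := face_ext h2 F2 cF.
have [c [cK cF' _]] := face_ext h3 F3 cF.
have := opposite_side h1 h3 n13 F1 F3 cF aK aF cK cF'.
rewrite (lam_across h1 h2 F1 F2 cF aF bK bF) nmulr_rlt0; last exact: (opposite_side h1 h2 n12 F1 F2 cF aK aF bK bF).
by apply/negP; rewrite -leNgt ltW//; exact: (opposite_side h2 h3 n23 F2 F3 cF bK bF cK cF').
Qed.

Hypothesis oOmega : open Omega.
Hypothesis lipOmega : lipschitz_boundary Omega.

Lemma closure_int x : nbhs x (closure Omega) -> Omega x.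
Proof.
move=> nx; apply: contrapT => xO.
apply: (lipschitz_bdry_not_nbhs oOmega lipOmega _ nx).
by apply/bdry_open => //; split => //; exact: nbhs_singleton nx.
Qed.

Lemma face_two_int K1 K2 F : K1 \in elts M -> K2 \in elts M -> K1 != K2 ->
  F \subset K1 -> F \subset K2 -> #|F| = d -> int_face Omega F.
Proof.
move=> h1 h2 n12 F1 F2 cF; apply/asboolP => H.
have [a [aK aF _]] := face_ext h1 F1 cF.
have [b [bK bF _]] := face_ext h2 F2 cF.
have /H /bdry_open -/(_ oOmega)[_] : simplex F (centroid F : 'rV[R]_d).
  by eexists; exact: (centroid_conv (face_neq0 cF)).
apply; apply: closure_int.
have := @face_two_nbhs _ _ _ a b h1 h2 n12 F1 F2 cF aK aF bK bF (centroid F)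
  (fun z => (lam_centroid_face z h1 F1 cF).1) (fun z => (lam_centroid_face z h1 F1 cF).2).
by apply: filterS => y [y1|y2]; apply/(mesh_closureE mM); [exists K1|exists K2].
Qed.

(** A point in the relative interior of [F] lies in no other element. If it were in [Omega], a
    neighbourhood would be covered by [K] alone, yet a small step away from the apex leaves [K]. The
    other points of [F] are limits of such points, and the boundary is closed. *)
Lemma face_unique_bdry K F : K \in elts M -> F \subset K -> #|F| = d ->
  (forall K', K' \in elts M -> F \subset K' -> K' = K) ->
  simplex F `<=` bdry Omega.
Proof.
move=> hK FK cF Huniq.
have [a [aK aF KE]] := face_ext hK FK cF.
have rel x : (forall z, z \in F -> 0 < lam K z x) ->
    (forall z, z \notin F -> lam K z x = 0) -> bdry Omega x.
  move=> xF xN.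
  have xK : simplex K x.
    by apply/(eltE mM) => // z; have [/xF/ltW//|/xN->//] := boolP (z \in F).
  apply/bdry_open => //; split; first by apply/(mesh_closureE mM); exists K.
  move=> xO; have nO : nbhs x Omega by exact: open_nbhs_nbhs.
  have nK K' : nbhs x [set y | K' \in elts M -> K' != K -> ~ simplex K' y].
    have [hK'|] := boolP (K' \in elts M); last by move=> _; apply: filterS filterT.
    have [->|K'K] := eqVneq K' K; first by apply: filterS filterT.
    have : nbhs x (~` simplex K').
      apply: open_nbhs_nbhs; split; first exact/closed_openC/(elt_closed mM).
      move=> xK'; case/eqP: K'K; apply: Huniq => //.
      by apply/fintype.subsetP => z /xF; exact: (elt_pos_sub mM hK hK' xK xK').
    by apply: filterS => y Hy _ _.
  have nA : nbhs x [set y | forall K', K' \in elts M -> K' != K -> ~ simplex K' y].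
    exact: (@filter_forall _ _ _ _ (@nbhs_filter _ x) nK).
  have /nbhs_rowP[e e0 He] : nbhs x (Omega `&`
      [set y | forall K', K' \in elts M -> K' != K -> ~ simplex K' y]).
    exact: (@filterI _ _ (@nbhs_filter _ x)).
  pose v := vtx a - x.
  pose t := e / 2 / (1 + `|v|).
  have v0 : 0 < 1 + `|v| by rewrite ltr_pwDl.
  have t0 : 0 < t by rewrite !divr_gt0.
  have [|yO yN] := He (x + (- t) *: v).
    rewrite addrC addKr normrZ normrN gtr0_norm// /t mulrAC ltr_pdivrMr//.
    have : 0 <= `|v| by [].
    by move: (`|v|) e0 => q; nra.
  have /(mesh_closureE mM)[K' hK' yK'] : closure Omega (x + - t *: v) by exact: subset_closure.
  have [K'K|K'K] := eqVneq K' K; last exact: yN hK' K'K yK'.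
  move: yK'; rewrite K'K => /(eltE mM hK)/(_ a); rewrite lam_line (lam_vtx mM)// eqxx xN//.
  by rewrite mulr0 add0r mulr1 oppr_ge0 leNgt t0.
move=> x xF.
have clb : closed (bdry Omega).
  rewrite (_ : bdry Omega = closure Omega `&` ~` Omega).
    by apply: closedI; [exact: closed_closure|exact: open_closedC].
  by apply/seteqP; split => y; rewrite bdry_open.
have /(simplexE mM hK _ FK)[x0 xN] := xF.
pose c := centroid F : 'rV[R]_d.
have -> : bdry Omega = closure (bdry Omega) by exact/closure_id.
move=> B /nbhs_rowP[e e0 HB].
pose t := Num.min 1 (e / 2 / (1 + `|c - x|)).
have t0 : 0 < t by rewrite lt_min ltr01 !divr_gt0.
have t1 : t <= 1 by rewrite ge_min lexx.
exists (x + t *: (c - x)); split; last first.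
  apply: HB; rewrite addrC addKr normrZ gtr0_norm//.
  apply: (@le_lt_trans _ _ (e / 2 / (1 + `|c - x|) * `|c - x|)).
    by rewrite ler_wpM2r// ge_min lexx orbT.
  rewrite mulrAC ltr_pdivrMr//.
  have : 0 <= `|c - x| by [].
  by move: (`|c - x|) e0 => q; nra.
apply: rel => z zF; rewrite lam_line; have [l1 l2] := lam_centroid_face z hK FK cF.
  by rewrite ltr_wpDl ?mulr_gt0 ?l1// mulr_ge0// subr_ge0.
by rewrite l2// xN// !mulr0 addr0.
Qed.

(** Requiring exactly [d] common vertices excludes [K = K'], since an element has [d.+1] of them. *)
Definition adj z : rel {set I} := fun K K' =>
  [&& K \in elts M, K' \in elts M, z \in K :&: K' & #|K :&: K'| == d].

Lemma adj_connect_elt z K K' : K \in elts M -> z \in K ->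
  connect (adj z) K K' -> K' \in elts M /\ z \in K'.
Proof.
move=> hK zK /connectP[p]; elim: p K hK zK => [|K1 p IH] K hK zK /=.
  by move=> _ ->.
move=> /andP[/and4P[_ h1 z1 _] pp] e; apply: (IH K1 h1 _ pp e).
by move: z1; rewrite inE => /andP[].
Qed.

Lemma adj_shared z K K' F : K \in elts M -> K' \in elts M -> K != K' ->
  F \subset K -> F \subset K' -> #|F| = d -> z \in F -> adj z K K'.
Proof.
move=> hK hK' KK' FK FK' cF zF.
have FI : F \subset K :&: K' by rewrite finset.subsetI FK.
have := subset_leq_card FI; rewrite cF => le1.
rewrite /adj hK hK' (fintype.subsetP FI _ zF) /= eqn_leq le1 andbT.
have : (#|K :&: K'| < #|K|)%N.
  apply: proper_card; rewrite properE subsetIl finset.subsetI subxx /=.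
  by apply: contra KK' => KK'; apply/eqP; exact: (elt_sub_eq mM).
by rewrite (elt_card mM hK) ltnS.
Qed.

(* A generic segment near z avoids the simplices of codimension 2, so it leaves an
   element through a face containing z and enters a second element there: the
   points of the segment in the star are open and closed in it. *)
Lemma star_nbhs z K : K \in elts M -> z \in K ->
  (forall K1, connect (adj z) K K1 -> forall F, F \subset K1 -> #|F| = d -> z \in F ->
     exists K2, [/\ K2 \in elts M, K2 != K1 & F \subset K2]) ->
  nbhs (vtx z) [set x | exists2 K1, connect (adj z) K K1 & simplex K1 x].
Proof.
move=> hK zK Htwo; set U := [set x | _].
have cU : closed U.
  rewrite (_ : U = \bigcup_(K1 in [set K1 | connect (adj z) K K1]) simplex K1).
    apply: closed_bigcup; first exact: finite_finset.
    by move=> K1 /(adj_connect_elt hK zK)[h1 _]; exact: (elt_closed mM).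
  by apply/seteqP; split => x [K1 ? ?]; exists K1.
(* Within this radius the coordinate of [z] stays positive in each element at [z], so every face
   through which the segment passes contains [z]. *)
have [r r0 Hr] : exists2 r, 0 < r & forall y, `|y - vtx z| < r ->
    forall K1, K1 \in elts M -> z \in K1 -> 0 < lam K1 z y.
  apply/(nbhs_rowP (vtx z)).
  apply: (@filter_forall _ _ _ _ (@nbhs_filter _ (vtx z : 'rV[R]_d))) => K1.
  have [h1|h1] := boolP (K1 \in elts M); last by apply: filterS filterT.
  have [z1|z1] := boolP (z \in K1); last by apply: filterS filterT.
  have /(lam_pos_nbhs (S := [set z]%SET))[e e0 He] :
    forall w, w \in [set z]%SET -> 0 < lam K1 w (vtx z).
    by move=> w /set1P ->; rewrite (lam_vtx mM)// eqxx ltr01.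
  apply/nbhs_rowP; exists e => // y /He H _ _; apply: H; exact: set11.
have K0 : K != finset.set0 by apply/set0Pn; exists z.
(* The segment starts at [p], interior to [K] and closer to the vertex than [r]. *)
pose c := centroid K : 'rV[R]_d.
pose t := Num.min 1 (r / 2 / (1 + `|c - vtx z|)).
have t0 : 0 < t by rewrite lt_min ltr01 !divr_gt0.
have t1 : t <= 1 by rewrite ge_min lexx.
pose p := vtx z + t *: (c - vtx z).
have pr : `|p - vtx z| < r.
  rewrite /p addrC addKr normrZ gtr0_norm//.
  apply: (@le_lt_trans _ _ (r / 2 / (1 + `|c - vtx z|) * `|c - vtx z|)).
    by rewrite ler_wpM2r// ge_min lexx orbT.
  rewrite mulrAC ltr_pdivrMr//.
  have : 0 <= `|c - vtx z| by [].
  by move: (`|c - vtx z|) r0 => q; nra.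
have pK w : w \in K -> 0 < lam K w p.
  move=> wK; rewrite lam_line (lam_vtx mM)// (lam_centroid mM _ hK (subxx _) K0) wK.
  rewrite ltr_wpDl// ?mulr_ge0 ?subr_ge0 ?ler0n// mulr_gt0// invr_gt0 ltr0n.
  by rewrite (elt_card mM hK).
(* For each set [T] of fewer than [d] vertices, a normal to a hyperplane through [p] and
   [simplex T]. A segment from [p] that is not orthogonal to this normal meets [simplex T] at most
   in [p]. *)
have /choice[nv Hnv] : forall T : {set I}, exists n : 'rV[R]_d, (#|T| < d)%N ->
    n != 0 /\ forall w, w \in T -> dot (vtx w - p) n = 0.
  move=> T; have [Td|Td] := boolP (#|T| < d)%N; last by exists 0.
  by have [n n0 Hn] := normal_exists (fun w => vtx w - p) Td; exists n.
pose ns := [seq nv T | T : {set I} in [pred T : {set I} | (#|T| < d)%N]].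
have ns0 n : n \in ns -> n != 0.
  by move=> /fintype.imageP[T /= Td ->]; have [n0 _] := Hnv T Td.
have gen q : `|q - vtx z| < r -> (forall n, n \in ns -> dot (q - p) n != 0) -> U q.
  move=> qr qn; pose x (s : R) := p + s *: (q - p).
  have xr s : 0 <= s <= 1 -> `|x s - vtx z| < r.
    move=> /andP[s0 s1].
    have -> : x s - vtx z = (1 - s) *: (p - vtx z) + s *: (q - vtx z).
      by rewrite /x; apply/rowP => i; rewrite !mxE; ring.
    apply: le_lt_trans (ler_normD _ _) _; rewrite !normrZ (ger0_norm s0) ger0_norm ?subr_ge0//.
    apply: (@le_lt_trans _ _ (Num.max `|p - vtx z| `|q - vtx z|)); last by rewrite gt_max pr.
    rewrite -[leRHS]mul1r -[X in X * Num.max _ _](subrK s 1) [leRHS]mulrDl.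
    by rewrite lerD// ler_wpM2l ?subr_ge0// le_max lexx ?orbT.
  have cx : continuous x.
    move=> s; apply: cvgD; first exact: cvg_cst.
    exact: scalel_continuous.
  (* Openness. Let [T] collect the vertices with nonzero coordinate at [x s]; genericity leaves at
     least [d] of them, so [x s] is interior to an element or to a face at [z], and [Htwo] supplies
     the element beyond that face. *)
  have loc s : 0 <= s <= 1 -> U (x s) -> nbhs (x s) U.
    move=> s01 [K1 cK1 xK1]; have [h1 z1] := adj_connect_elt hK zK cK1.
    have [s0|s0] := eqVneq s 0.
      have := elt_int_nbhs mM hK pK; rewrite /x s0 scale0r addr0.
      by apply: filterS => y yK; exists K.
    have l0 := (eltE mM h1 _).1 xK1.
    pose T := [set w in K1 | lam K1 w (x s) != 0]%SET.
    have TK : T \subset K1 by apply/fintype.subsetP => w; rewrite inE => /andP[].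
    have lT w : w \in T -> 0 < lam K1 w (x s).
      by rewrite inE => /andP[_ h]; rewrite lt_neqAle eq_sym h l0.
    have lN w : w \notin T -> lam K1 w (x s) = 0.
      rewrite inE negb_and negbK => /orP[w1|/eqP//]; exact: (lam_notin mM).
    have Td : (d <= #|T|)%N.
      rewrite leqNgt; apply/negP => Td; have [n0 Hn] := Hnv T Td.
      have nT : nv T \in ns by apply/fintype.imageP; exists T.
      have : dot (x s - p) (nv T) = 0.
        rewrite -(lam_vtx_sum mM h1 (x s)) -[p in _ - p]scale1r -(lam_sum mM h1 (x s)).
        rewrite scaler_suml -sumrB dot_suml big1// => w _; rewrite -scalerBr dotZl.
        have [/Hn ->|/lN ->] := boolP (w \in T); [by rewrite mulr0|by rewrite mul0r].
      rewrite /x addrC addKr dotZl => /eqP; rewrite mulf_eq0 (negPf s0) /=.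
      by apply/negP; exact: qn.
    have zT : z \in T by rewrite inE z1 gt_eqF// Hr// xr.
    have [TE|TE] := eqVneq T K1.
      have : nbhs (x s) (simplex K1) by apply: (elt_int_nbhs mM h1) => w w1; apply: lT; rewrite TE.
      by apply: filterS => y y1; exists K1.
    have cT : #|T| = d.
      apply/eqP; rewrite eqn_leq Td andbT -ltnS -(elt_card mM h1).
      by apply: proper_card; rewrite finset.properEneq TE.
    have [K2 [h2 n2 T2]] := Htwo _ cK1 T TK cT zT.
    have cK2 : connect (adj z) K K2.
      apply: connect_trans cK1 (connect1 _).
      by apply: adj_shared TK T2 cT zT => //; rewrite eq_sym.
    have [a [aK aF _]] := face_ext h1 TK cT.
    have [b [bK bF _]] := face_ext h2 T2 cT.
    rewrite eq_sym in n2.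
    have := face_two_nbhs h1 h2 n2 TK T2 cT aK aF bK bF lT lN.
    by apply: filterS => y [y1|y2]; [exists K1|exists K2].
  have := @segment_connected R 0 1; move=> /(_ [set s | 0 <= s <= 1 /\ U (x s)]) H.
  have HE : [set s | 0 <= s <= 1 /\ U (x s)] = `[0, 1]%classic.
    apply: H.
    - exists 0; split; first by rewrite lexx ler01.
      rewrite /x scale0r addr0; exists K; first exact: connect0.
      exact: nbhs_singleton (elt_int_nbhs mM hK pK).
    - exists (x @^-1` U°); first by apply: open_comp => //; exact: open_interior.
      apply/seteqP; split=> s /=; rewrite in_itv /=.
        by move=> [s01 Us]; split=> //; exact: loc.
      by move=> [s01 /nbhs_singleton].
    - exists (x @^-1` U); first by apply: closed_comp.
      by apply/seteqP; split=> s /=; rewrite in_itv /=.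
  have : `[0, 1]%classic (1 : R) by rewrite /= in_itv /= ler01 lexx.
  by rewrite -HE => -[_]; rewrite /x scale1r addrC subrK.
(* An arbitrary [q] is a limit of generic end points, and [U] is closed. *)
apply/nbhs_rowP; exists r => // q qr.
rewrite (closure_id U).1//; move=> B /nbhs_rowP[e e0 HB].
have [|q' [q'q q'n]] := @generic_point R d ns p q (Num.min e (r - `|q - vtx z|)) ns0.
  by rewrite lt_min e0 subr_gt0.
move: q'q; rewrite lt_min => /andP[q'e q'r].
exists q'; split; last exact: HB.
apply: gen => //; have -> : q' - vtx z = (q' - q) + (q - vtx z) by rewrite addrA subrK.
by apply: le_lt_trans (ler_normD _ _) _; rewrite -ltrBrDr.
Qed.

Lemma star_bdry_face z K : K \in elts M -> z \in K -> bdry Omega (vtx z) ->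
  exists K1 F, [/\ connect (adj z) K K1, F \subset K1, #|F| = d, z \in F &
    forall K', K' \in elts M -> F \subset K' -> K' = K1].
Proof.
move=> hK zK bz; apply: contrapT => H.
apply: (lipschitz_bdry_not_nbhs oOmega lipOmega bz).
have : nbhs (vtx z) [set x | exists2 K1, connect (adj z) K K1 & simplex K1 x].
  apply: star_nbhs => // K1 cK1 F F1 cF zF; apply: contrapT => HF; apply: H.
  exists K1, F; split => // K' hK' FK'; apply: contrapT => /eqP n.
  by apply: HF; exists K'.
apply: filterS => x [K1 cK1 x1]; apply/(mesh_closureE mM); exists K1 => //.
by have [] := adj_connect_elt hK zK cK1.
Qed.

(** A one-sided face at [z] would put [z] on the boundary, so the elements reachable from [K] cover
    a neighbourhood of [z]. That neighbourhood contains interior points of [K'], and these lie in no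
    other element. *)
Lemma star_int_connect z K K' : K \in elts M -> z \in K -> K' \in elts M -> z \in K' ->
  ~ bdry Omega (vtx z) -> connect (adj z) K K'.
Proof.
move=> hK zK hK' zK' bz.
have : nbhs (vtx z) [set x | exists2 K1, connect (adj z) K K1 & simplex K1 x].
  apply: star_nbhs => // K1 cK1 F F1 cF zF; apply: contrapT => HF; apply: bz.
  have [h1 z1] := adj_connect_elt hK zK cK1.
  have sub : simplex F `<=` bdry Omega.
    apply: (face_unique_bdry h1 F1 cF) => K2 h2 F2.
    by apply: contrapT => /eqP n; apply: HF; exists K2.
  by apply: sub; exact: vtx_elt.
move=> /nbhs_rowP[e e0 He].
have K0 : K' != finset.set0 by apply/set0Pn; exists z.
pose c := centroid K' : 'rV[R]_d.
pose t := Num.min 1 (e / 2 / (1 + `|c - vtx z|)).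
have t0 : 0 < t by rewrite lt_min ltr01 !divr_gt0.
have t1 : t <= 1 by rewrite ge_min lexx.
have [|K1 cK1 x1] := He (vtx z + t *: (c - vtx z)).
  rewrite addrC addKr normrZ gtr0_norm//.
  apply: (@le_lt_trans _ _ (e / 2 / (1 + `|c - vtx z|) * `|c - vtx z|)).
    by rewrite ler_wpM2r// ge_min lexx orbT.
  rewrite mulrAC ltr_pdivrMr//.
  have : 0 <= `|c - vtx z| by [].
  by move: (`|c - vtx z|) e0 => q; nra.
have [h1 z1] := adj_connect_elt hK zK cK1.
suff -> : K' = K1 by [].
apply: (elt_int_eq mM hK' h1 _ x1) => w wK.
rewrite lam_line (lam_vtx mM)// (lam_centroid mM _ hK' (subxx _) K0) wK.
rewrite ltr_wpDl// ?mulr_ge0 ?subr_ge0 ?ler0n// mulr_gt0// invr_gt0 ltr0n.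
by rewrite (elt_card mM hK').
Qed.

Lemma facesP F : F \in faces M <-> #|F| = d /\ exists2 K, K \in elts M & F \subset K.
Proof.
rewrite inE; split=> [/andP[/eqP cF /existsP[K /andP[hK FK]]]|[cF [K hK FK]]].
  by split => //; exists K.
by rewrite cF eqxx; apply/existsP; exists K; rewrite hK.
Qed.

Let fe F := [set K in elts M | F \subset K]%SET.

Let face_elt_in F i : (i < #|fe F|)%N -> face_elt F i \in elts M /\ F \subset face_elt F i.
Proof.
move=> iF; have : face_elt F i \in fe F.
  by rewrite -mem_enum mem_nth// -cardE.
by rewrite inE => /andP[].
Qed.

Let face_elt_mem F K : K \in elts M -> F \subset K ->
  exists2 i, (i < #|fe F|)%N & face_elt F i = K.
Proof.
move=> hK FK; have Kf : K \in enum (fe F) by rewrite mem_enum inE hK.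
by exists (index K (enum (fe F))); rewrite ?cardE ?index_mem// /face_elt nth_index.
Qed.

Let card_fe F : #|F| = d -> (#|fe F| <= 2)%N.
Proof.
move=> cF; rewrite leqNgt; apply/negP => h3.
have [h0 F0] := @face_elt_in F 0 (leq_trans (isT : 0 < 3)%N h3).
have [h1 F1] := @face_elt_in F 1 (leq_trans (isT : 1 < 3)%N h3).
have [h2 F2] := @face_elt_in F 2 h3.
have neq i j : (i < 3)%N -> (j < 3)%N -> i != j -> face_elt F i != face_elt F j.
  move=> i3 j3 ij; rewrite /face_elt nth_uniq ?enum_uniq// -cardE.
    exact: leq_trans i3 h3.
  exact: leq_trans j3 h3.
have := face_third h0 h1 h2 F0 F1 F2 cF (neq 0 1 isT isT isT) (neq 0 2 isT isT isT).
by apply/eqP; exact: (neq 1 2).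
Qed.

Lemma face_elt0 F : F \in faces M -> face_elt F 0 \in elts M /\ F \subset face_elt F 0.
Proof.
move=> /facesP[_ [K hK FK]]; apply: face_elt_in.
by have [i iF _] := face_elt_mem hK FK; exact: leq_ltn_trans iF.
Qed.

Lemma face_elt1 F : F \in faces M -> int_face Omega F ->
  face_elt F 1 \in elts M /\ F \subset face_elt F 1.
Proof.
move=> hF /asboolP iF; apply: face_elt_in; rewrite ltnNge; apply/negP => c1; apply: iF.
have [h0 F0] := face_elt0 hF; have [cF _] := (facesP F).1 hF.
apply: (face_unique_bdry h0 F0 cF) => K hK FK.
have [i iF <-] := face_elt_mem hK FK; congr face_elt.
by move: (leq_trans iF c1); rewrite ltnS leqn0 => /eqP.
Qed.

Lemma face_elt_two F K1 K2 : K1 \in elts M -> K2 \in elts M -> K1 != K2 ->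
  F \subset K1 -> F \subset K2 -> #|F| = d ->
  int_face Omega F /\ ((face_elt F 0 = K1 /\ face_elt F 1 = K2) \/
                       (face_elt F 0 = K2 /\ face_elt F 1 = K1)).
Proof.
move=> h1 h2 n12 F1 F2 cF; split; first exact: (face_two_int h1 h2).
have c2 := card_fe cF.
have [i iF E1] := face_elt_mem h1 F1; have [j jF E2] := face_elt_mem h2 F2.
move: (leq_trans iF c2) (leq_trans jF c2) E1 E2 n12 => {iF jF}.
case: i => [|[|i]] //; case: j => [|[|j]] // _ _ <- <-; rewrite ?eqxx//.
  by left.
by right.
Qed.

Lemma face_elt_unique F K : K \in elts M -> F \subset K -> #|F| = d ->
  (forall K', K' \in elts M -> F \subset K' -> K' = K) ->
  [/\ F \in faces M, int_face Omega F = false & face_elt F 0 = K].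
Proof.
move=> hK FK cF H; have hF : F \in faces M by apply/facesP; split => //; exists K.
split => //; last by have [h0 F0] := face_elt0 hF; exact: H.
by apply/negbTE/asboolPn; apply; exact: (face_unique_bdry hK FK cF).
Qed.

End Faces.

(** * Shape regularity *)

Section Diameter.
Context (R : realType) (d : nat) (M : mesh R d).
Local Notation I := 'I_(nvert M).
Implicit Types (K S F : {set I}) (z w : I) (x y : 'rV[R]_d).

Lemma simplex_enorm S x : simplex S x -> enorm x <= \sum_(z : I) enorm (vtx z).
Proof.
move=> [c [c0 cN c1 <-]]; elim/big_ind2: _ => [|a b u v H1 H2|z _].
- by rewrite enorm0.
- exact: le_trans (ler_enormD _ _) (lerD H1 H2).
- rewrite enormZ ger0_norm// ler_piMl ?enorm_ge0// -c1 (bigD1 z)//= lerDl.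
  exact: sumr_ge0.
Qed.

Lemma diam_has_ubound S : has_ubound [set enorm (p.1 - p.2) | p in simplex S `*` simplex S].
Proof.
exists (\sum_(z : I) enorm (vtx z) + \sum_(z : I) enorm (vtx z)).
move=> _ [[x y] /= [/simplex_enorm xS /simplex_enorm yS] <-].
by apply: le_trans (ler_enormD _ _) _; rewrite enormN lerD.
Qed.

Lemma le_diam S x y : simplex S x -> simplex S y -> enorm (x - y) <= diam (simplex S).
Proof. by move=> xS yS; apply: ub_le_sup; [exact: diam_has_ubound|exists (x, y)]. Qed.

Lemma diam_ge0 S : 0 <= diam (simplex S).
Proof.
have [[x xS]|H] := pselect (exists x, simplex S x).
  by apply: le_trans (le_diam xS xS); exact: enorm_ge0.
rewrite /diam (_ : [set _ | _ in _] = set0) ?sup0//.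
by apply/seteqP; split=> // t [[x y] /= [xS _] _]; apply: H; exists x.
Qed.

Lemma diamS S S' : S != finset.set0 -> S \subset S' ->
  diam (simplex S) <= diam (simplex S').
Proof.
move=> /set0Pn[z zS] SS'; apply: ge_sup.
  by exists 0, (vtx z, vtx z); rewrite /= ?subrr ?enorm0//; split; exact: vtx_elt.
by move=> _ [[x y] /= [xS yS] <-]; apply: le_diam; apply: (simplexS SS').
Qed.

Lemma simplex_sub_cube S : exists2 N, 0 <= N & simplex S `<=` cube 0 N.
Proof.
exists (\sum_(z : I) enorm (vtx z)); first by apply: sumr_ge0 => z _; exact: enorm_ge0.
move=> x /simplex_enorm H; apply: norm_cube; rewrite subr0.
exact: le_trans (norm_le_enorm _) H.
Qed.
End Diameter.

(** The sets are removed from [B] one at a time; disjointness keeps the others inside the remainder.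
    This is the volume comparison that bounds the number of elements at a vertex. *)
Lemma leb_packing (R : realType) (n : nat) (T : eqType) (s : seq T)
    (A : T -> set 'rV[R]_n) (B : set 'rV[R]_n) (v : R) :
  uniq s -> (forall i, i \in s -> measurable (A i)) -> measurable B ->
  (forall i, i \in s -> A i `<=` B) -> (forall i, i \in s -> (v%:E <= leb R n (A i))%E) ->
  (forall i j, i \in s -> j \in s -> i != j -> A i `&` A j = set0) ->
  (((size s)%:R * v)%:E <= leb R n B)%E.
Proof.
elim: s B => [|i s IH] B /=; first by move=> *; rewrite mul0r; exact: measure_ge0.
move=> /andP[is_ us] mA mB AB vA dA.
have mAi : measurable (A i) by apply: mA; rewrite mem_head.
have ins j : j \in s -> j \in i :: s by rewrite in_cons => ->; rewrite orbT.
rewrite (measureDI _ mB mAi) -natr1 mulrDl mul1r EFinD; apply: leeD.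
  apply: IH => //.
  - by move=> j /ins; exact: mA.
  - exact: measurableD.
  - move=> j js x xj; split; first exact: AB (ins _ js) _ xj.
    move=> xi; have ji : j != i by apply: contraNneq is_ => <-.
    by have /seteqP[H _] := dA _ _ (ins _ js) (mem_head _ _) ji; apply: (H x).
  - by move=> j /ins; exact: vA.
  - by move=> j k /ins js /ins ks; exact: dA.
rewrite (_ : B `&` A i = A i); first by apply: vA; rewrite mem_head.
by apply/seteqP; split=> x; [case|move=> xi; split => //; apply: (AB i) => //; rewrite mem_head].
Qed.

Section Shape.
Context (R : realType) (d : nat) (Omega : set 'rV[R]_d) (M : mesh R d).
Local Notation I := 'I_(nvert M).
Implicit Types (K S F : {set I}) (z w : I) (x y : 'rV[R]_d).
Hypothesis mM : is_mesh Omega M.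
Hypothesis d1 : (1 < d)%N.
Let d0 : (0 < d)%N := ltnW d1.

Local Notation h K := (diam (simplex K)).
Local Notation rho K := (indiam (simplex K)).

(** Across a diameter parallel to the gradient, the coordinate grows by the diameter times the
    length of the gradient, while on [K] it stays between 0 and 1. *)
Lemma ball_glam K z c r : K \in elts M -> 0 <= r ->
  (forall y, enorm (y - c) <= r -> simplex K y) -> r *+ 2 * enorm (glam K z) <= 1.
Proof.
move=> hK r0 H; have [g0|gN] := eqVneq (enorm (glam K z)) 0.
  by rewrite g0 mulr0 ler01.
have gp : 0 < enorm (glam K z) by rewrite lt_neqAle eq_sym gN enorm_ge0.
pose v := (r / enorm (glam K z)) *: glam K z.
have nv : enorm v = r by rewrite enormZ ger0_norm ?divfK// divr_ge0// ltW.
have /(eltE mM hK)/(_ z) : simplex K (c - v).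
  by apply: H; rewrite addrC addKr enormN nv.
have xK : simplex K (c + v) by apply: H; rewrite addrC addKr nv.
have := (eltE mM hK _).1 xK.
move=> l0; have : lam K z (c + v) <= 1.
  by rewrite -(lam_sum mM hK (c + v)) (bigD1 z)//= lerDl sumr_ge0.
have -> : c + v = (c - v) + 2 *: v by apply/rowP => i; rewrite !mxE; ring.
rewrite lam_dir /v dotZl.
have -> : r / enorm (glam K z) * dot (glam K z) (glam K z) = r * enorm (glam K z).
  by rewrite -sqr_enorm expr2 mulrA divfK.
have -> : r *+ 2 * enorm (glam K z) = r * enorm (glam K z) + r * enorm (glam K z).
  by rewrite mulrnAl mulr2n.
have key (a b : R) : a + 2 * b <= 1 -> 0 <= a -> b + b <= 1 by lra.
exact: key.
Qed.

Lemma rho_nonempty K : K \in elts M -> [set r *+ 2 | r in [set r | 0 <= r /\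
    exists c, forall y, enorm (y - c) <= r -> simplex K y]] !=set0.
Proof.
move=> hK; have : (0 < #|K|)%N by rewrite (elt_card mM hK).
move=> /card_gt0P[z zK]; exists 0, 0; rewrite ?mul0rn//; split=> //.
exists (vtx z) => y yz; have /eqP : enorm (y - vtx z) = 0.
  by apply/eqP; rewrite eq_le yz enorm_ge0.
by move=> /eqP/enorm_eq0/eqP; rewrite subr_eq0 => /eqP ->; exact: vtx_elt.
Qed.

Lemma glam_neq0 K z : K \in elts M -> z \in K -> 0 < enorm (glam K z).
Proof.
move=> hK zK; rewrite lt_neqAle enorm_ge0 andbT eq_sym; apply/eqP => /enorm_eq0 g0.
have : (1 < #|K|)%N by rewrite (elt_card mM hK).
rewrite (cardD1 z) zK ltnS => /card_gt0P[w]; rewrite !inE => /andP[wz wK].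
have := lamB K z (vtx z) (vtx w); rewrite !(lam_vtx mM)// eqxx eq_sym (negPf wz) g0.
by rewrite dotC dot0l subr0 => /eqP; rewrite oner_eq0.
Qed.

Lemma rho_has_sup K : K \in elts M -> has_sup [set r *+ 2 | r in [set r | 0 <= r /\
    exists c, forall y, enorm (y - c) <= r -> simplex K y]].
Proof.
move=> hK; split; first exact: rho_nonempty.
have : (0 < #|K|)%N by rewrite (elt_card mM hK).
move=> /card_gt0P[z zK]; have gp := glam_neq0 hK zK.
exists (1 / enorm (glam K z)) => _ [r [r0 [c Hc]] <-].
by rewrite ler_pdivlMr//; exact: ball_glam Hc.
Qed.

Lemma rho_glam K z : K \in elts M -> rho K * enorm (glam K z) <= 1.
Proof.
move=> hK; have [zK|zK] := boolP (z \in K); last first.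
  by rewrite (glam_notin mM)// enorm0 mulr0 ler01.
have gp := glam_neq0 hK zK; rewrite -ler_pdivlMr//.
apply: ge_sup; first exact: rho_nonempty.
by move=> _ [r [r0 [c Hc]] <-]; rewrite ler_pdivlMr//; exact: ball_glam Hc.
Qed.

Lemma rho_gt0 K : K \in elts M -> 0 < rho K.
Proof.
move=> hK; have K0 : K != finset.set0 by rewrite -card_gt0 (elt_card mM hK).
have : nbhs (centroid K : 'rV[R]_d) (simplex K).
  apply: (elt_int_nbhs mM hK) => z zK; rewrite (lam_centroid mM)// zK.
  by rewrite invr_gt0 ltr0n (elt_card mM hK).
move=> /nbhs_rowP[e e0 He].
apply: (@lt_le_trans _ _ ((e / 2) *+ 2)); first by rewrite pmulrn_lgt0// divr_gt0.
apply: ub_le_sup; first by have [] := rho_has_sup hK.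
exists (e / 2) => //; split; first by rewrite divr_ge0// ltW.
exists (centroid K) => y yc; apply: He; apply: le_lt_trans (norm_le_enorm _) _.
by apply: le_lt_trans yc _; rewrite ltr_pdivrMr// ltr_pMr// ltr1n.
Qed.

(** A ball with more than half of the supremal diameter, hence radius at least [rho / 4], instead of
    a ball that attains the supremum. *)
Lemma inscribed_ball K : K \in elts M -> exists c r,
  rho K / 4 <= r /\ forall y, enorm (y - c) <= r -> simplex K y.
Proof.
move=> hK; have rp := rho_gt0 hK.
have [|_ [r [r0 [c Hc]] <-] Hr] := @sup_adherent _ _ (rho K / 2) _ (rho_has_sup hK).
  by rewrite divr_gt0.
have {}Hr : rho K - rho K / 2 < 2 * r by rewrite mulr_natl.
exists c, r; split => //; move: (rho K) Hr => a; lra.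
Qed.

Lemma lam_edge K z w : K \in elts M -> z \in K -> w \in K -> z != w ->
  1 <= enorm (vtx z - vtx w) * enorm (glam K z).
Proof.
move=> hK zK wK zw; have e : 1 = dot (vtx z - vtx w) (glam K z).
  by rewrite -lamB !(lam_vtx mM)// eqxx (negPf zw) subr0.
rewrite [leLHS]e; exact: le_trans (ler_norm _) (dot_cauchy _ _).
Qed.

(** Along the edge the coordinate of [z] drops from 1 to 0, with a gradient of length at most
    [1 / rho K]. *)
Lemma rho_le_edge K z w : K \in elts M -> z \in K -> w \in K -> z != w ->
  rho K <= enorm (vtx z - vtx w).
Proof.
move=> hK zK wK zw; have gp := glam_neq0 hK zK.
rewrite -(ler_pM2r gp); apply: le_trans (rho_glam z hK) _.
exact: lam_edge.
Qed.

Variable gam : R.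
Hypothesis gam1 : 1 <= gam.
Hypothesis shape : shape_coef M <= gam.

Lemma h_le_rho K : K \in elts M -> h K <= gam * rho K.
Proof.
move=> hK; rewrite -ler_pdivrMr ?rho_gt0//; apply: le_trans shape.
exact: (le_bigmax_cond _ (fun K => h K / rho K)).
Qed.

Lemma face_vertices F : #|F| = d -> exists z w, [/\ z \in F, w \in F & z != w].
Proof.
move=> cF; have : (0 < #|F|)%N by rewrite cF.
move=> /card_gt0P[z zF]; exists z; have : (1 < #|F|)%N by rewrite cF.
by rewrite (cardD1 z) zF ltnS => /card_gt0P[w]; rewrite !inE => /andP[wz wF];
  exists w; split; rewrite // eq_sym.
Qed.

Lemma rho_le_face K F : K \in elts M -> F \subset K -> #|F| = d -> rho K <= h F.
Proof.
move=> hK /fintype.subsetP FK cF; have [z [w [zF wF zw]]] := face_vertices cF.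
apply: le_trans (rho_le_edge hK (FK _ zF) (FK _ wF) zw) _.
by apply: le_diam; exact: vtx_elt.
Qed.

Lemma h_le_face K F : K \in elts M -> F \subset K -> #|F| = d -> h K <= gam * h F.
Proof.
move=> hK FK cF; apply: le_trans (h_le_rho hK) _.
by rewrite ler_pM2l ?rho_le_face// (lt_le_trans ltr01).
Qed.

Lemma h_gt0 K : K \in elts M -> 0 < h K.
Proof.
move=> hK; have : (1 < #|K|)%N by rewrite (elt_card mM hK).
have : (0 < #|K|)%N by rewrite (elt_card mM hK).
move=> /card_gt0P[z zK]; rewrite (cardD1 z) zK ltnS => /card_gt0P[w].
rewrite !inE => /andP[wz wK]; apply: lt_le_trans (rho_gt0 hK) _.
apply: le_trans (rho_le_edge hK wK zK wz) _.
by apply: le_diam; exact: vtx_elt.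
Qed.

Lemma h_face_gt0 K F : K \in elts M -> F \subset K -> #|F| = d -> 0 < h F.
Proof. by move=> hK FK cF; apply: lt_le_trans (rho_gt0 hK) (rho_le_face hK FK cF). Qed.

Lemma face_le_h K F : K \in elts M -> F \subset K -> #|F| = d -> h F <= h K.
Proof. by move=> hK FK cF; apply: diamS => //; exact: face_neq0. Qed.

Lemma hmax_ge K : K \in elts M -> h K <= hmax M.
Proof. exact: (le_bigmax_cond _ (fun K => h K)). Qed.

Lemma hmax_ge0 : 0 <= hmax M.
Proof. exact: bigmax_ge_id. Qed.

Lemma adj_h z K K' : adj z K K' -> h K <= gam * h K'.
Proof.
move=> /and4P[hK hK' zI /eqP cI].
apply: le_trans (h_le_face hK (finset.subsetIl _ _) cI) _.
rewrite ler_pM2l ?(lt_le_trans ltr01)//.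
exact: face_le_h (finset.subsetIr _ _) cI.
Qed.

(** If the coordinate were 0, a small step away from [vtx z] would make it negative without leaving
    [K]. *)
Lemma nbhs_elt_pos K x z : K \in elts M -> nbhs x (simplex K) -> z \in K -> 0 < lam K z x.
Proof.
move=> hK /[dup]/nbhs_singleton /(eltE mM hK)/(_ z) l0 /nbhs_rowP[e e0 He] zK.
rewrite lt_neqAle l0 andbT eq_sym; apply/eqP => lx.
pose v := vtx z - x.
pose t := e / 2 / (1 + `|v|).
have t0 : 0 < t by rewrite !divr_gt0.
have : simplex K (x + (- t) *: v).
  apply: He; rewrite addrC addKr normrZ normrN gtr0_norm// /t mulrAC ltr_pdivrMr//.
  have : 0 <= `|v| by [].
  by move: (`|v|) e0 => q; nra.
move=> /(eltE mM hK)/(_ z); rewrite lam_line lx (lam_vtx mM)// eqxx.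
by rewrite mulr0 add0r mulr1 oppr_ge0 leNgt t0.
Qed.

Definition star z := [set K in elts M | z \in K]%SET.

(* Scaled about z to a common size, the elements of the star contain disjoint
   cubes of comparable size. *)
Lemma star_card z : (#|star z|%:R : R) <= (8 * gam * d%:R) ^+ d.
Proof.
have g0 : 0 < gam := lt_le_trans ltr01 gam1.
have dp : 0 < d%:R :> R by rewrite ltr0n.
have [->|/set0Pn[K0 K0s]] := eqVneq (star z) finset.set0.
  by rewrite cards0 exprn_ge0// !mulr_ge0// ltW.
pose s := \big[Num.min/h K0]_(K in star z) h K.
have sE K : K \in star z -> K \in elts M /\ z \in K by rewrite inE => /andP[].
have sle K : K \in star z -> s <= h K.
  by move=> Ks; exact: (bigmin_le_cond _ (fun K => h K)).
have s0 : 0 < s.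
  by apply: lt_bigmin => [|K /sE[hK _]]; apply: h_gt0; have [] := sE _ K0s.
have /choice[cr Hcr] : forall K, exists cr : 'rV[R]_d * R, K \in elts M ->
    rho K / 4 <= cr.2 /\ forall y, enorm (y - cr.1) <= cr.2 -> simplex K y.
  move=> K; have [hK|hK] := boolP (K \in elts M); last by exists (0, 0).
  by have [c [r H]] := inscribed_ball hK; exists (c, r).
pose t K := s / h K.
pose c' K := vtx z + t K *: ((cr K).1 - vtx z).
(* After scaling, the inscribed radius is at least [s / (4 gam)]. The factor [d] passes from the
   maximum norm to the Euclidean norm, and a further 2 leaves room for a second cube about each
   point, so that the points of the cube are interior to [K]. *)
pose dl := s / (8 * gam * d%:R).
have dl0 : 0 < dl by rewrite divr_gt0// !mulr_gt0.
have tp K : K \in star z -> 0 < t K <= 1.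
  move=> Ks; have [hK _] := sE _ Ks; have hp := h_gt0 hK.
  by rewrite divr_gt0//= ler_pdivrMr// mul1r sle.
have scaled K y : K \in star z -> enorm (y - c' K) <= dl *+ 2 * d%:R ->
    simplex K y /\ enorm (y - vtx z) <= s.
  move=> Ks yc; have [hK zK] := sE _ Ks; have hp := h_gt0 hK.
  have /andP[tp0 t1] := tp _ Ks; have [Hr Hb] := Hcr _ hK.
  pose y0 := vtx z + (t K)^-1 *: (y - vtx z).
  have yE : y = vtx z + t K *: (y0 - vtx z).
    have -> : y0 - vtx z = (t K)^-1 *: (y - vtx z) by rewrite /y0 addrC addKr.
    by rewrite scalerA mulfV ?gt_eqF// scale1r addrC subrK.
  have y0K : simplex K y0.
    apply: Hb; rewrite -(ler_pM2l tp0).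
    have -> : t K * enorm (y0 - (cr K).1) = enorm (y - c' K).
      rewrite -[in LHS](gtr0_norm tp0) -enormZ {1}yE /c'; congr enorm.
      by apply/rowP => i; rewrite !mxE; ring.
    apply: le_trans yc _; apply: (@le_trans _ _ (t K * (rho K / 4))); last by rewrite ler_pM2l.
    have := h_le_rho hK; rewrite /t /dl => hr.
    have -> : s / (8 * gam * d%:R) *+ 2 * d%:R = s / (4 * gam).
      by rewrite -mulr_natl; field; rewrite !gt_eqF.
    rewrite ler_pdivrMr ?mulr_gt0//.
    have -> : s / h K * (rho K / 4) * (4 * gam) = s * (gam * rho K / h K).
      by field; rewrite gt_eqF.
    by rewrite ler_peMr ?ler_pdivlMr ?mul1r// ltW.
  split; first by rewrite yE; apply: simplex_segment => //; [exact: vtx_elt|rewrite (ltW tp0)].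
  have -> : y - vtx z = t K *: (y0 - vtx z) by rewrite {1}yE addrC addKr.
  rewrite enormZ gtr0_norm// /t mulrAC ler_pdivrMr// ler_pM2l//.
  by apply: le_diam => //; exact: vtx_elt.
have cubeK K y : K \in star z -> cube (c' K) dl y -> forall w, w \in K -> 0 < lam K w y.
  move=> Ks yc w wK; have [hK zK] := sE _ Ks.
  apply: nbhs_elt_pos => //; apply/nbhs_rowP; exists dl => // x xy.
  apply: (scaled _ _ Ks _).1; apply: le_trans (enorm_le_norm _) _.
  rewrite mulrC ler_pM2r//.
  have -> : x - c' K = (x - y) + (y - c' K) by rewrite addrA subrK.
  apply: le_trans (ler_normD _ _) _; rewrite mulr2n.
  by apply: lerD; [exact: ltW|apply: cube_norm => //; exact: ltW].
have H : #|star z|%:R * (2 * dl) ^+ d <= (2 * s) ^+ d.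
  suff : ((#|star z|%:R * (2 * dl) ^+ d)%:E <= leb R d (cube (vtx z) s))%E.
    by rewrite leb_cube ?(ltW s0)// lee_fin.
  rewrite cardE; apply: (leb_packing (A := fun K => cube (c' K) dl)).
  - exact: enum_uniq.
  - by move=> K _; exact: measurable_cube.
  - exact: measurable_cube.
  - move=> K; rewrite mem_enum => Ks y yc i.
    have [_ ys] : simplex K y /\ enorm (y - vtx z) <= s.
      apply: (scaled _ _ Ks); apply: le_trans (enorm_le_norm _) _.
      rewrite mulrC ler_pM2r//; apply: (@le_trans _ _ dl).
        by apply: cube_norm => //; exact: ltW.
      by rewrite mulr2n lerDl ltW.
    by have := le_trans (coord_le_enorm _ i) ys; rewrite !mxE.
  - by move=> K _; rewrite leb_cube ?(ltW dl0)// lexx.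
  - move=> K K'; rewrite !mem_enum => Ks K's KK'; apply/seteqP; split => // y [yK yK'].
    have [hK zK] := sE _ Ks; have [hK' zK'] := sE _ K's.
    case/eqP: KK'; apply: (elt_int_eq mM hK hK' (cubeK _ _ Ks yK)).
    exact: nbhs_singleton (elt_int_nbhs mM hK' (cubeK _ _ K's yK')).
have sdl : 2 * s = (8 * gam * d%:R) * (2 * dl).
  by rewrite /dl; field; rewrite !gt_eqF.
move: H; rewrite sdl [leRHS]exprMn ler_pM2r//.
by rewrite exprn_gt0// mulr_gt0.
Qed.

Definition star_bound : nat := Num.truncn ((8 * gam * d%:R) ^+ d).

Lemma star_le z : (#|star z : {set {set I}}| <= star_bound)%N.
Proof.
have g0 : 0 <= gam by exact: le_trans ler01 gam1.
rewrite truncn_ge_nat; first exact: star_card.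
by rewrite exprn_ge0// !mulr_ge0.
Qed.

(** A path without repetitions stays in the star of [z] and is no longer than the star is large. *)
Lemma connect_short z K K' : K \in elts M -> z \in K -> connect (adj z) K K' ->
  exists p, [/\ path (adj z) K p, last K p = K' & (size p <= star_bound)%N].
Proof.
move=> hK zK /connectP[p0 /shortenP[p pp up _] ->]; exists p; split => //.
have ps : {subset p <= star z}.
  move=> K1 K1p; move: pp; case/splitPr: K1p => p1 p2; rewrite cat_path /= => /andP[_ /andP[/and4P[_ h1 zI _] _]].
  by rewrite inE h1; move: zI; rewrite inE => /andP[].
apply: leq_trans (star_le z).
move: up => /= /andP[_ up]; rewrite cardE; apply: uniq_leq_size => // K1 /ps.
by rewrite mem_enum.
Qed.

Lemma path_h z K p : path (adj z) K p -> h K <= gam ^+ size p * h (last K p).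
Proof.
elim: p K => [|K1 p IH] K /=; first by rewrite mul1r.
move=> /andP[a1 pp]; apply: le_trans (adj_h a1) _.
by rewrite exprS -mulrA ler_wpM2l ?IH// (le_trans ler01).
Qed.

Lemma connect_h z K K' : K \in elts M -> z \in K -> connect (adj z) K K' ->
  h K <= gam ^+ star_bound * h K'.
Proof.
move=> hK zK /(connect_short hK zK)[p [pp <- sp]].
apply: le_trans (path_h pp) _; rewrite ler_wpM2r ?diam_ge0//.
exact: ler_weXn2l.
Qed.

Lemma connect_diff z K K' (f : {set I} -> R) (J : R) : K \in elts M -> z \in K -> 0 <= J ->
  (forall K1 K2, connect (adj z) K K1 -> adj z K1 K2 -> `|f K1 - f K2| <= J) ->
  connect (adj z) K K' -> `|f K - f K'| <= star_bound%:R * J.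
Proof.
move=> hK zK J0 HJ /(connect_short hK zK)[p [pp <- sp]].
apply: (@le_trans _ _ ((size p)%:R * J)); last by rewrite ler_wpM2r// ler_nat.
suff H : forall q K1, connect (adj z) K K1 -> path (adj z) K1 q ->
    `|f K1 - f (last K1 q)| <= (size q)%:R * J.
  by apply: H => //; exact: connect0.
elim=> [|K2 q IH] K1 /=; first by move=> _ _; rewrite subrr normr0 mul0r.
move=> c1 /andP[a1 qp]; have c2 := connect_trans c1 (connect1 a1).
rewrite -natr1 mulrDl mul1r [leRHS]addrC.
have -> : f K1 - f (last K2 q) = (f K1 - f K2) + (f K2 - f (last K2 q)) by ring.
by apply: le_trans (ler_normD _ _) _; apply: lerD; [exact: HJ|exact: IH].
Qed.
End Shape.

(** * The reference simplex and integrals over faces *)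

Section ReferenceSimplex.
Context (R : realType) (n : nat).
Local Notation S := (@ref_simplex R n.+1 : set 'rV[R]_n).
Local Notation mu := (leb R n).
Implicit Types (y : 'rV[R]_n) (g : 'I_n.+1 -> R).

(** Barycentric coordinates of the reference simplex, where [ord0] stands for the vertex at the
    origin. *)
Definition ref_bary (k : 'I_n.+1) y : R :=
  if unlift ord0 k is Some j then y 0 j else 1 - \sum_i y 0 i.

Lemma ref_bary_sum y : \sum_k ref_bary k y = 1.
Proof.
rewrite big_ord_recl /ref_bary unlift_none.
rewrite [X in _ + X](eq_bigr (fun j => y 0 j)) ?subrK// => j _.
by rewrite liftK.
Qed.

Lemma ref_bary_ge0 y k : S y -> 0 <= ref_bary k y.
Proof. by move=> [y0 y1]; rewrite /ref_bary; case: unlift => [j|]; rewrite ?subr_ge0. Qed.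

Lemma ref_baryP y : (forall k, 0 <= ref_bary k y) -> S y.
Proof.
move=> H; split=> [i|]; first by have := H (lift ord0 i); rewrite /ref_bary liftK.
by have := H ord0; rewrite /ref_bary unlift_none subr_ge0.
Qed.

Lemma continuous_ref_bary k : continuous (ref_bary k).
Proof.
rewrite /ref_bary; case: unlift => [j|]; first exact: continuous_coord.
apply: continuous_rowB; first exact: cst_continuous.
by apply: continuous_row_sum => i; exact: continuous_coord.
Qed.

Lemma ref_simplex_closed : closed S.
Proof.
rewrite (_ : S = \bigcap_(k in [set: 'I_n.+1]) (ref_bary k @^-1` [set t | 0 <= t])).
  apply: closed_bigI => z _; apply: closed_comp; last exact: closed_ge.
  by move=> ? _; exact: continuous_ref_bary.
apply/seteqP; split => y; first by move=> H k _; exact: ref_bary_ge0.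
by move=> H; apply: ref_baryP => k; exact: H.
Qed.

Lemma measurable_ref_simplex : measurable S.
Proof. exact: closed_row_measurable ref_simplex_closed. Qed.

Lemma ref_simplex_cube : S `<=` cube 0 1.
Proof.
move=> y yS i; rewrite mxE subr0.
have := ref_bary_ge0 (lift ord0 i) yS; rewrite /ref_bary liftK => y0.
rewrite ger0_norm//; case: yS => h0 h1; apply: le_trans h1.
by rewrite (bigD1 i)//= lerDl sumr_ge0.
Qed.

Lemma ref_simplex_lty : (mu S < +oo)%E.
Proof. exact: (leb_sub_cube_lty measurable_ref_simplex ler01 ref_simplex_cube). Qed.

Lemma continuous_ref_L2 (f : 'rV[R]_n -> R) : continuous f -> L2 S f.
Proof.
move=> cf; have [B HB] := continuous_bounded_cube ler01 cf.
apply: (L2_bounded measurable_ref_simplex (M := B)); first exact: ref_simplex_lty.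
  by apply: measurable_funTS; exact: continuous_row_measurable.
by move=> y /ref_simplex_cube; exact: HB.
Qed.

Lemma continuous_ref_sum g : continuous (fun y => \sum_k g k * ref_bary k y).
Proof.
apply: continuous_row_sum => k.
by apply: continuous_rowM; [exact: cst_continuous|exact: continuous_ref_bary].
Qed.

Lemma Rintegral_cube_le (f : 'rV[R]_n -> R) c (r m : R) : 0 <= r ->
  cube c r `<=` S -> mu.-integrable S (EFin \o f) -> (forall y, S y -> 0 <= f y) ->
  (forall y, cube c r y -> m <= f y) -> 0 <= m ->
  m * (2 * r) ^+ n <= \int[mu]_(y in S) f y.
Proof.
move=> r0 cS intf f0 mf m0.
have mS := measurable_ref_simplex; have mc := measurable_cube c r.
rewrite -lee_fin /Rintegral fineK; last exact: integrable_fin_num.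
apply: (@le_trans _ _ (\int[mu]_(y in cube c r) (f y)%:E)%E).
  rewrite EFinM -(leb_cube c r0).
  rewrite -(integral_cst mu mc); apply: ge0_le_integral => //.
  by apply: measurable_funS cS _ => //; exact: measurable_int intf.
apply: ge0_subset_integral => //; exact: measurable_int intf.
Qed.

(** Volume of the cube of radius [1 / (8 n.+1)] used in [ref_vertex_le], times the square of the
    factor 1/2 that an affine function retains there. *)
Definition ref_mass : R := ((2 * (8 * n.+1%:R)^-1) ^+ n) / 4.

Lemma ref_mass_gt0 : 0 < ref_mass.
Proof. by rewrite divr_gt0// exprn_gt0// mulr_gt0// invr_gt0 mulr_gt0// ltr0n. Qed.

(* Around the vertex where an affine function is largest in modulus there is a
   cube on which it is at least half as large. *)
Lemma ref_vertex_le g k : g k ^+ 2 * ref_mass <=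
  \int[mu]_(y in S) (\sum_k g k * ref_bary k y) ^+ 2.
Proof.
pose k0 := [arg max_(i > ord0) `|g i| : R]%O.
have k0P i : `|g i| <= `|g k0|.
  by rewrite /k0; case: arg_maxP => //= j _ H; exact: H.
clearbody k0.
pose r : R := (8 * n.+1%:R)^-1.
have r0 : 0 < r by rewrite invr_gt0 mulr_gt0.
have rn : 2 * r * n%:R <= 1 / 4.
  have -> : 1 / 4 = 2 * r * n.+1%:R by rewrite /r; field; rewrite gt_eqF.
  by rewrite ler_pM2l ?mulr_gt0// ler_nat.
(* On this cube the coordinate [k0] is at least 3/4 and the others sum to at most 1/4, so the
   modulus is at least [(3/4 - 1/4) |g k0|]. *)
pose c : 'rV[R]_n := \row_j (r + (k0 == lift ord0 j)%:R * (3 / 4)).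
have cubeP y : cube c r y -> S y /\ 3 / 4 <= ref_bary k0 y.
  move=> yc; have yj j : (k0 == lift ord0 j)%:R * (3 / 4) <= y 0 j <=
      2 * r + (k0 == lift ord0 j)%:R * (3 / 4).
    have := yc j; rewrite mxE ler_distl; move: (_%:R * _) (y 0 j) => a b.
    by move=> /andP[h1 h2]; apply/andP; split; move: h1 h2; lra.
  have sumy : \sum_j y 0 j <= 2 * r * n%:R + (k0 != ord0)%:R * (3 / 4).
    apply: (@le_trans _ _ (\sum_j (2 * r + (k0 == lift ord0 j)%:R * (3 / 4)))).
      by apply: ler_sum => j _; have /andP[] := yj j.
    rewrite big_split /= sumr_const card_ord -mulr_suml mulr_natr lerD2l.
    rewrite ler_wpM2r ?divr_ge0//; case: (unliftP ord0 k0) => [j ->|->]; last first.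
      by rewrite eqxx big1// => j _; rewrite (negPf (neq_lift _ _)).
    rewrite (bigD1 j)//= eqxx big1 ?addr0 ?lexx//.
    by move=> i ij; rewrite (inj_eq lift_inj) eq_sym (negPf ij).
  have H0 : (k0 == ord0)%:R * (3 / 4) <= 1 - \sum_j y 0 j.
    move: sumy rn; move: (\sum_j _) => a.
    by case: (k0 == ord0); rewrite /= ?mulr1n ?mulr0n; lra.
  have Hk i : (k0 == i)%:R * (3 / 4) <= ref_bary i y.
    rewrite /ref_bary; case: unliftP => [j ->|->//].
    by have /andP[] := yj j.
  split; last by have := Hk k0; rewrite eqxx mul1r.
  by apply: ref_baryP => k'; apply: le_trans (Hk k'); rewrite mulr_ge0// divr_ge0.
have gc y : cube c r y -> (g k0 / 2) ^+ 2 <= (\sum_k g k * ref_bary k y) ^+ 2.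
  move=> /cubeP[yS yk]; rewrite -[leLHS]real_normK ?num_real// -[leRHS]real_normK ?num_real//.
  rewrite lerXn2r ?nnegrE// (bigD1 k0)//=.
  set s := \sum_(i | _) _.
  have sle : `|s| <= `|g k0| * (1 - ref_bary k0 y).
    apply: le_trans (ler_norm_sum _ _ _) _.
    have -> : 1 - ref_bary k0 y = \sum_(i | i != k0) ref_bary i y.
      by apply/eqP; rewrite subr_eq -(ref_bary_sum y) (bigD1 k0)//= addrC.
    rewrite mulr_sumr.
    apply: ler_sum => i _; rewrite normrM (ger0_norm (ref_bary_ge0 _ yS)).
    by rewrite ler_wpM2r// ref_bary_ge0.
  have := lerB_normD (g k0 * ref_bary k0 y) s; rewrite normrM.
  have b0 : 0 <= ref_bary k0 y by apply: le_trans yk; rewrite divr_ge0.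
  rewrite (ger0_norm b0) normrM [`|2^-1|]ger0_norm ?invr_ge0//.
  have : 0 <= `|g k0| by [].
  move: sle yk b0; move: (`|s|) (`|g k0|) (ref_bary k0 y) (`|_ + _|) => a b e f; nra.
have intG := L2_sqr_integrable (continuous_ref_L2 (@continuous_ref_sum g)).
apply: le_trans (Rintegral_cube_le (ltW r0) (fun y yc => (cubeP y yc).1) intG _ gc _).
- rewrite /ref_mass -/r.
  have -> : (g k0 / 2) ^+ 2 * (2 * r) ^+ n = g k0 ^+ 2 * ((2 * r) ^+ n / 4).
    by move: ((2 * r) ^+ n) (g k0) => a b; field.
  rewrite ler_wpM2r ?divr_ge0 ?exprn_ge0 ?mulr_ge0 ?(ltW r0)//.
  rewrite -[leLHS]real_normK ?num_real// -[leRHS]real_normK ?num_real//.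
  by rewrite lerXn2r ?nnegrE.
- by move=> y _; exact: sqr_ge0.
- exact: sqr_ge0.
Qed.

(** With [r = 1 / (4 n.+1)], all [n.+1] coordinates are at least [r] on the cube of radius [r]
    chosen in [ref_bubble_ge]. The first factor bounds their product, the second is the volume of
    the cube. *)
Definition bubble_mass : R := (4 * n.+1%:R)^-1 ^+ n.+1 * (2 * (4 * n.+1%:R)^-1) ^+ n.

Lemma bubble_mass_gt0 : 0 < bubble_mass.
Proof.
by rewrite mulr_gt0// exprn_gt0// ?mulr_gt0// invr_gt0 mulr_gt0// ltr0n.
Qed.

Lemma continuous_ref_bubble : continuous (fun y => \prod_k ref_bary k y).
Proof. by apply: continuous_row_prod => k; exact: continuous_ref_bary. Qed.

Lemma ref_bubble_ge : bubble_mass <= \int[mu]_(y in S) \prod_k ref_bary k y.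
Proof.
pose r : R := (4 * n.+1%:R)^-1.
have r0 : 0 < r by rewrite invr_gt0 mulr_gt0.
pose c : 'rV[R]_n := \row_j (2 * r).
have cubeP y : cube c r y -> forall k, r <= ref_bary k y.
  move=> yc k; have yj j : r <= y 0 j <= 3 * r.
    have := yc j; rewrite mxE ler_distl; move: (y 0 j) => b.
    by move=> /andP[h1 h2]; apply/andP; split; move: h1 h2; lra.
  rewrite /ref_bary; case: unliftP => [j _|_]; first by have /andP[] := yj j.
  have : \sum_j y 0 j <= 3 * r * n%:R.
    rewrite mulr_natr -[X in _ *+ X]card_ord -sumr_const.
    by apply: ler_sum => j _; have /andP[] := yj j.
  have : 4 * r * n.+1%:R = 1 by rewrite /r; field; rewrite gt_eqF.
  have : 0 <= r * n%:R by rewrite mulr_ge0// ltW.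
  rewrite -(natr1 n) => h1 h2 h3.
  have key (a b q : R) : 0 <= q * b -> 4 * q * (b + 1) = 1 -> a <= 3 * q * b -> 0 < q ->
      q <= 1 - a by move=> *; nra.
  exact: key h1 h2 h3 r0.
apply: (Rintegral_cube_le (c := c) (ltW r0)).
- by move=> y yc; apply: ref_baryP => k; apply: le_trans (cubeP _ yc k); exact: ltW.
- apply: (L2_integrable measurable_ref_simplex ref_simplex_lty).
  by apply: continuous_ref_L2; exact: continuous_ref_bubble.
- by move=> y yS; apply: prodr_ge0 => k _; exact: ref_bary_ge0.
- move=> y yc; rewrite -[X in _ ^+ X]card_ord -prodr_const.
  by apply: ler_prod => k _; rewrite (ltW r0) cubeP.
- by rewrite exprn_ge0// ltW.
Qed.

End ReferenceSimplex.

Section FaceParam.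
Context (R : realType) (n : nat) (Omega : set 'rV[R]_n.+1) (M : mesh R n.+1).
Local Notation E := 'rV[R]_n.+1.
Local Notation I := 'I_(nvert M).
Local Notation S := (@ref_simplex R n.+1 : set 'rV[R]_n).
Implicit Types (K F : {set I}) (z w : I) (x : E) (y : 'rV[R]_n).
Hypothesis mM : is_mesh Omega M.

Section Indexed.
Variables (F : {set I}) (cF : #|F| = n.+1).

Definition face_idx (k : 'I_n.+1) : I := enum_val (cast_ord (esym cF) k).

Lemma face_idx_in k : face_idx k \in F.
Proof. exact: enum_valP. Qed.

Lemma face_idx_inj : injective face_idx.
Proof. by move=> k l /enum_val_inj/cast_ord_inj. Qed.

Lemma face_idxP z : z \in F -> exists k, z = face_idx k.
Proof.
move=> zF; exists (cast_ord cF (enum_rank_in zF z)).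
by rewrite /face_idx cast_ordK enum_rankK_in.
Qed.

Lemma big_face (V : nmodType) (f : I -> V) :
  \sum_(z in F) f z = \sum_k f (face_idx k).
Proof.
rewrite big_enum_val (reindex (cast_ord (esym cF)))//.
by exists (cast_ord cF) => i _; rewrite ?cast_ordK ?cast_ordKV.
Qed.

Lemma big_face_prod (f : I -> R) : \prod_(z in F) f z = \prod_k f (face_idx k).
Proof.
rewrite big_enum_val (reindex (cast_ord (esym cF)))//.
by exists (cast_ord cF) => i _; rewrite ?cast_ordK ?cast_ordKV.
Qed.

Lemma face_vtxE (k : 'I_n.+1) : face_vtx F k = vtx (face_idx k).
Proof.
rewrite /face_vtx (nth_map (face_idx k)) -?cardE ?cF//; congr vtx.
by rewrite /face_idx /enum_val; apply: set_nth_default; rewrite -cardE cF.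
Qed.

Lemma face_paramE y : face_param F y = \sum_k ref_bary k y *: vtx (face_idx k).
Proof.
rewrite big_ord_recl {1}/ref_bary unlift_none scalerBl scale1r.
rewrite /face_param -(face_vtxE ord0) -addrA; congr (_ + _).
rewrite [X in _ + X](eq_bigr (fun j => y 0 j *: vtx (face_idx (lift ord0 j)))); last first.
  by move=> j _; rewrite /ref_bary liftK.
rewrite addrC scaler_suml -sumrB; apply/rowP => i; rewrite mxE summxE.
apply: eq_bigr => j _; rewrite !mxE -(face_vtxE (lift ord0 j)) /= /bump /= add1n.
by rewrite mulrBr.
Qed.

Lemma face_param_simplex y : S y -> simplex F (face_param F y).
Proof.
move=> yS; exists (fun z => \sum_(k | face_idx k == z) ref_bary k y); split.
- by move=> z; apply: sumr_ge0 => k _; exact: ref_bary_ge0.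
- move=> z zF; apply: big1 => k /eqP kz; move: zF.
  by rewrite -kz face_idx_in.
- rewrite -(ref_bary_sum y) [RHS](partition_big face_idx predT)//.
- rewrite face_paramE [RHS](partition_big face_idx predT)//=.
  apply: eq_bigr => z _; rewrite scaler_suml.
  by apply: eq_bigr => k /eqP ->.
Qed.

Lemma affine_face_param (g : E) (c : R) y :
  dot (face_param F y) g + c = \sum_k (dot (vtx (face_idx k)) g + c) * ref_bary k y.
Proof.
under eq_bigr do rewrite mulrDl.
rewrite big_split /= -mulr_sumr ref_bary_sum mulr1 face_paramE dot_suml.
by congr (_ + _); apply: eq_bigr => k _; rewrite dotZl mulrC.
Qed.

Lemma lam_face_param K k y : K \in elts M -> F \subset K ->
  lam K (face_idx k) (face_param F y) = ref_bary k y.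
Proof.
move=> hK /fintype.subsetP FK; rewrite /lam affine_face_param (bigD1 k)//= big1.
  by rewrite addr0 -/(lam K _ _) (lam_vtx mM)// ?FK ?face_idx_in// eqxx mul1r.
move=> l lk; rewrite -/(lam K _ _) (lam_vtx mM)// ?FK ?face_idx_in//.
by rewrite (inj_eq face_idx_inj) eq_sym (negPf lk) mul0r.
Qed.

Lemma bubble_face_param K y : K \in elts M -> F \subset K -> S y ->
  bubble F (face_param F y) = \prod_k ref_bary k y.
Proof.
move=> hK FK yS; rewrite /bubble big_face_prod; apply: eq_bigr => k _.
rewrite (hatE mM _ hK) ?lam_face_param//.
exact: simplexS FK _ (face_param_simplex yS).
Qed.

Lemma face_jac_ge0 : 0 <= face_jac F.
Proof. exact: sqrtr_ge0. Qed.

Lemma face_int_ge0 (f : E -> R) : (forall x, simplex F x -> 0 <= f x) ->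
  0 <= face_int F f.
Proof.
move=> f0; apply: mulr_ge0; first exact: face_jac_ge0.
by apply: Rintegral_ge0 => y yS; apply: f0; exact: face_param_simplex.
Qed.

(** [ref_vertex_le] transported to the face by the constant Jacobian: the inverse estimate that pays
    for a jump at a vertex with its L^2 norm. *)
Lemma affine_face_int (g : E) (c : R) z : z \in F ->
  (dot (vtx z) g + c) ^+ 2 * (ref_mass R n * face_jac F) <=
  face_int F (fun x => (dot x g + c) ^+ 2).
Proof.
move=> /face_idxP[k ->]; rewrite mulrA mulrC ler_wpM2l ?face_jac_ge0//.
apply: le_trans (ref_vertex_le (fun k => dot (vtx (face_idx k)) g + c) k) _.
apply: eq_implies_le; apply: eq_Rintegral => y _.
by rewrite affine_face_param.
Qed.

End Indexed.

Hypothesis n1 : (0 < n)%N.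
Let d1 : (1 < n.+1)%N. Proof. by []. Qed.

Local Notation h K := (diam (simplex K)).
Local Notation rho K := (indiam (simplex K)).

(** Base times height. The edge matrix [D] of [K] is inverse to the matrix [G] of barycentric
    gradients, so the bound of these by [1 / rho K] bounds [|det D|] from below. By [gram_minor] the
    Jacobian is [|det D|] times the length of the gradient at the apex, and that length is at least
    [1 / h K]. *)
Lemma face_jac_ge K F : K \in elts M -> F \subset K -> #|F| = n.+1 ->
  rho K ^+ n.+1 <= face_jac F * ((n.+1)`!%:R * h K).
Proof.
move=> hK FK cF.
have [a [aK aF KE]] := face_ext mM hK FK cF.
have FK' z : z \in F -> z \in K := fintype.subsetP FK z.
(* The vertices of [K] other than the base vertex [z0], with the apex last, so that deleting the
   last row of [D] leaves the edges of [F]. *)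
pose p (k : 'I_n.+1) : I :=
  if unlift ord_max k is Some j then face_idx cF (lift ord0 j) else a.
have pK k : p k \in K.
  by rewrite /p; case: unlift => [j|]//; apply/FK'/face_idx_in.
pose z0 := face_idx cF ord0.
have z0K : z0 \in K by apply/FK'/face_idx_in.
have pz0 k : p k != z0.
  rewrite /p; case: unlift => [j|]; first by rewrite (inj_eq (@face_idx_inj _ cF)) eq_sym neq_lift.
  by apply: contraNneq aF => ->; exact: face_idx_in.
have p_inj k l : (p l == p k) = (k == l).
  rewrite /p; case: unliftP => [j ->|->]; case: unliftP => [j' ->|->].
  - by rewrite (inj_eq (@face_idx_inj _ cF)) !(inj_eq lift_inj) eq_sym.
  - rewrite (negPf (neq_lift _ _)); apply/negbTE; apply: contraNneq aF => <-.
    exact: face_idx_in.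
  - rewrite eq_sym [RHS]eq_sym (negPf (neq_lift _ _)); apply/negbTE.
    by apply: contraNneq aF => <-; exact: face_idx_in.
  - by rewrite !eqxx.
pose D : 'M[R]_n.+1 := \matrix_(k, j) (vtx (p k) - vtx z0) 0 j.
pose G : 'M[R]_n.+1 := \matrix_(j, l) glam K (p l) 0 j.
have DG : D *m G = 1%:M.
  apply/matrixP => k l; rewrite !mxE.
  transitivity (dot (vtx (p k) - vtx z0) (glam K (p l))).
    by apply: eq_bigr => j _; rewrite !mxE.
  rewrite -lamB !(lam_vtx mM)// p_inj (negPf (pz0 l)) subr0.
  by case: eqP.
have E : row' ord_max D = face_edges F.
  apply/matrixP => k j; rewrite !mxE /p liftK -(face_vtxE cF ord0) -(face_vtxE cF (lift ord0 k)).
  by rewrite /= /bump add1n.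
have pmax : p ord_max = a by rewrite /p unlift_none.
have rp := rho_gt0 mM d1 hK.
have gle z : enorm (glam K z) <= (rho K)^-1.
  by rewrite -div1r ler_pdivlMr// mulrC; exact: (rho_glam mM d1).
have detG : `|\det G| <= (n.+1)`!%:R * (rho K)^-1 ^+ n.+1.
  apply: det_le => i j; rewrite mxE; apply: le_trans (gle (p j)).
  exact: coord_le_enorm.
have detDG : `|\det D| * `|\det G| = 1 by rewrite -normrM -det_mulmx DG det1 normr1.
have detD : rho K ^+ n.+1 <= `|\det D| * (n.+1)`!%:R.
  have -> : rho K ^+ n.+1 = `|\det D| * (`|\det G| * rho K ^+ n.+1).
    by rewrite mulrA detDG mul1r.
  by rewrite ler_wpM2l// -ler_pdivlMr ?exprn_gt0// -exprVn.
have ga : 1 <= h K * enorm (glam K a).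
  apply: le_trans (lam_edge mM hK aK z0K _) _.
    by have := pz0 ord_max; rewrite pmax.
  by rewrite ler_wpM2r ?enorm_ge0// le_diam//; exact: vtx_elt.
have -> : face_jac F = `|\det D| * enorm (glam K a).
  rewrite /face_jac -E (gram_minor DG) sqrtrM ?sqr_ge0// sqrtr_sqr; congr (_ * _).
  rewrite /enorm; congr Num.sqrt; apply: eq_bigr => i _.
  by rewrite mxE pmax expr2.
apply: le_trans detD _.
have -> : `|\det D| * enorm (glam K a) * ((n.+1)`!%:R * h K) =
  `|\det D| * (n.+1)`!%:R * (h K * enorm (glam K a)) by ring.
by rewrite ler_peMr// mulr_ge0.
Qed.

Lemma face_jac_gt0 K F : K \in elts M -> F \subset K -> #|F| = n.+1 -> 0 < face_jac F.
Proof.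
move=> hK FK cF; rewrite lt_neqAle sqrtr_ge0 andbT eq_sym; apply/eqP => j0.
have := face_jac_ge hK FK cF; rewrite j0 mul0r leNgt.
by rewrite exprn_gt0// (rho_gt0 mM d1).
Qed.

End FaceParam.

(** * The bilinear form *)

Section RealIntegrable.
Context (R : realType) (n : nat) (D : set 'rV[R]_n) (mD : measurable D).
Local Notation mu := (leb R n).
Local Notation Rint f := (mu.-integrable D (EFin \o f)).
Implicit Types f g : 'rV[R]_n -> R.

Lemma RintD f g : Rint f -> Rint g -> Rint (fun x => f x + g x).
Proof. by move=> If Ig; apply: eq_integrable (integrableD mD If Ig). Qed.

Lemma RintZ k f : Rint f -> Rint (fun x => k * f x).
Proof. by move=> If; apply: eq_integrable (integrableZl mD k If). Qed.

Lemma Rint0 : Rint (fun _ => 0).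
Proof. exact: integrable0. Qed.

Lemma Rint_sum (I : Type) (s : seq I) (f : I -> 'rV[R]_n -> R) :
  (forall i, Rint (f i)) -> Rint (fun x => \sum_(i <- s) f i x).
Proof.
move=> If; elim: s => [|i s IH].
  by under eq_fun do rewrite big_nil; exact: Rint0.
by under eq_fun do rewrite big_cons; exact: RintD.
Qed.

Lemma L2_sum (I : Type) (s : seq I) (f : I -> 'rV[R]_n -> R) :
  (forall i, L2 D (f i)) -> L2 D (fun x => \sum_(i <- s) f i x).
Proof.
move=> Lf; elim: s => [|i s IH]; last first.
  by under eq_fun do rewrite big_cons; exact: L2D.
under eq_fun do rewrite big_nil; apply: integrable_L2 => //.
by under eq_fun do rewrite expr0n; exact: Rint0.
Qed.

Lemma RintegralZD a f g : Rint f -> Rint g ->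
  \int[mu]_(x in D) (a * f x + g x) = a * \int[mu]_(x in D) f x + \int[mu]_(x in D) g x.
Proof. by move=> If Ig; rewrite RintegralD// ?RintegralZl//; exact: RintZ. Qed.

Lemma L2_eq f g : (forall x, D x -> f x = g x) -> L2 D f -> L2 D g.
Proof.
move=> fg [mf ff]; split.
  by apply: eq_measurable_fun mf => x; rewrite inE => /fg.
apply: le_lt_trans ff; apply: eq_implies_le.
by apply: eq_integral => x; rewrite inE => /fg ->.
Qed.

End RealIntegrable.

Section Density.
Context (R : realType) (d : nat).
Implicit Types (G H : 'M[R]_d).

Lemma strain_lin a G H : strain (a *: G + H) = a *: strain G + strain H.
Proof.
apply/matrixP => i j; rewrite !mxE; ring.
Qed.

Lemma ddotC G H : ddot G H = ddot H G.
Proof. by apply: eq_bigr => i _; apply: eq_bigr => j _; rewrite mulrC. Qed.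

Lemma ddot_lin a G H L : ddot (a *: G + H) L = a * ddot G L + ddot H L.
Proof.
rewrite mulr_sumr -big_split; apply: eq_bigr => i _ /=.
rewrite mulr_sumr -big_split; apply: eq_bigr => j _ /=.
by rewrite !mxE; ring.
Qed.

Lemma ddot_ge0 G : 0 <= ddot G G.
Proof. by do 2!apply: sumr_ge0 => ? _; rewrite -expr2 sqr_ge0. Qed.

Variables mu lambda : R.

Lemma elas_densityC G H : elas_density mu lambda G H = elas_density mu lambda H G.
Proof. by rewrite /elas_density ddotC [\tr G * _]mulrC. Qed.

Lemma elas_density_lin a G H L : elas_density mu lambda (a *: G + H) L =
  a * elas_density mu lambda G L + elas_density mu lambda H L.
Proof. by rewrite /elas_density strain_lin ddot_lin linearP /=; ring. Qed.

Lemma elas_density_ge0 G : 0 <= mu -> 0 <= lambda -> 0 <= elas_density mu lambda G G.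
Proof.
move=> m0 l0; apply: addr_ge0.
  by apply: mulr_ge0; [rewrite mulr_ge0|exact: ddot_ge0].
by apply: mulr_ge0 => //; rewrite -expr2 sqr_ge0.
Qed.

Lemma elas_density_integrable (D : set 'rV[R]_d) (A B : 'rV[R]_d -> 'M[R]_d) :
  measurable D -> (forall i j, L2 D (fun x => A x i j)) ->
  (forall i j, L2 D (fun x => B x i j)) ->
  (leb R d).-integrable D (EFin \o (fun x => elas_density mu lambda (A x) (B x))).
Proof.
move=> mD LA LB.
have Ls (C : 'rV[R]_d -> 'M[R]_d) : (forall i j, L2 D (fun x => C x i j)) ->
    forall i j, L2 D (fun x => strain (C x) i j).
  move=> LC i j; apply: (@L2_eq _ _ _ (fun x => 2^-1 * (C x i j + C x j i))).
    by move=> x _; rewrite !mxE.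
  by apply: L2Z => //; apply: L2D.
have Lt (C : 'rV[R]_d -> 'M[R]_d) : (forall i j, L2 D (fun x => C x i j)) -> L2 D (fun x => \tr (C x)).
  by move=> LC; apply: L2_sum.
apply: RintD => //; apply: RintZ => //; last first.
  by apply: L2_mul_integrable => //; exact: Lt.
apply: Rint_sum => // i; apply: Rint_sum => // j.
by apply: L2_mul_integrable => //; exact: Ls.
Qed.
End Density.

(** * Measurability and integrability of assembled elementwise functions *)

Section Assemble.
Context (R : realType) (d : nat) (Omega : set 'rV[R]_d) (M : mesh R d).
Local Notation I := 'I_(nvert M).
Implicit Types (K F : {set I}) (z : I) (x : 'rV[R]_d).
Hypothesis mM : is_mesh Omega M.
Hypothesis oOmega : open Omega.

Definition elt_at x : option {set I} := [pick K in elts M | `[< simplex K x >]].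

Lemma assembleE (V : zmodType) (v : efun M V) x :
  assemble v x = if elt_at x is Some K then v K x else 0.
Proof. by []. Qed.

Lemma elt_at_some x K : elt_at x = Some K -> K \in elts M /\ simplex K x.
Proof. by rewrite /elt_at; case: pickP => // K' /andP[h /asboolP xK] [<-]. Qed.

Lemma elt_at_ex x : closure Omega x -> exists K, elt_at x = Some K.
Proof.
move=> /(mesh_closureE mM)[K hK xK]; rewrite /elt_at.
case: pickP => [K' _|/(_ K)]; first by exists K'.
by rewrite /= hK /= => /asboolP.
Qed.

(** The [pick] in [assemble] depends only on the set of elements that contain [x]. This set takes
    finitely many values, each on a measurable set, and so the regions where a given element is
    picked are measurable. *)
Definition eltset x : {set {set I}} := [set K in elts M | `[< simplex K x >]]%SET.

Lemma measurable_eltset (Q : {set {set I}}) : measurable [set x | eltset x = Q].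
Proof.
rewrite (_ : [set x | _] = \bigcap_(K in [set: {set I}]) [set x | (K \in eltset x) = (K \in Q)]).
  apply: fin_bigcap_measurable; [exact: finite_finset|move=> K _].
  have [hK|hK] := boolP (K \in elts M); last first.
    have [KQ|KQ] := boolP (K \in Q).
      rewrite (_ : [set _ | _] = set0) ?measurable0//.
      by apply/seteqP; split => // x /=; rewrite inE (negPf hK).
    rewrite (_ : [set _ | _] = setT) ?measurableT//.
    by apply/seteqP; split => // x _ /=; rewrite inE (negPf hK).
  have mK := measurable_elt mM hK.
  have [KQ|KQ] := boolP (K \in Q).
    rewrite (_ : [set _ | _] = simplex K)//.
    by apply/seteqP; split => // x /=; rewrite inE hK /=; move/asboolP.
  rewrite (_ : [set _ | _] = ~` simplex K); first exact: measurableC.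
  apply/seteqP; split => // x /=; rewrite inE hK /=; first by move/negbT/asboolPn.
  by move=> h; apply/negbTE/asboolPn.
apply/seteqP; split => x.
  by move=> xQ K _; have {}xQ : eltset x = Q := xQ; rewrite -xQ.
by move=> H; apply/setP => K; exact: (H K Logic.I).
Qed.

Lemma elt_at_eltset x : elt_at x = [pick K in eltset x].
Proof. by apply: eq_pick => K; rewrite /= inE. Qed.

Lemma measurable_elt_at K : measurable [set x | elt_at x = Some K].
Proof.
rewrite (_ : [set x | _] = \bigcup_(Q in [set Q : {set {set I}} | [pick K in Q] = Some K])
    [set x | eltset x = Q]).
  apply: fin_bigcup_measurable; first exact: finite_finset.
  by move=> Q _; exact: measurable_eltset.
apply/seteqP; split => x.
  by rewrite /= elt_at_eltset => H; exists (eltset x).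
by move=> [Q HQ xQ]; rewrite /= elt_at_eltset; rewrite /= in xQ; rewrite xQ.
Qed.

Lemma assemble_sum (v : efun M R) :
  assemble v = fun x => \sum_(K in elts M) (v K \_ [set x | elt_at x = Some K]) x.
Proof.
apply/funext => x; rewrite assembleE; case E: (elt_at x) => [K|].
  have [hK xK] := elt_at_some E.
  rewrite (bigD1 K)//= big1 ?addr0.
    by rewrite patchE mem_set.
  move=> K' /andP[_ K'K]; rewrite patchE memNset//= E => -[KK'].
  by rewrite KK' eqxx in K'K.
by rewrite big1// => K _; rewrite patchE memNset//= E.
Qed.

Lemma assemble_integrable (v : efun M R) :
  (forall K, K \in elts M -> (leb R d).-integrable (simplex K) (EFin \o v K)) ->
  (leb R d).-integrable Omega (EFin \o assemble v).
Proof.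
move=> vI; have mO := open_row_measurable oOmega.
rewrite assemble_sum.
have -> : (fun x => \sum_(K in elts M) (v K \_ [set x | elt_at x = Some K]) x) =
    (fun x => \sum_K (if K \in elts M then v K \_ [set x | elt_at x = Some K] else cst 0) x).
  apply/funext => x; rewrite big_mkcond; apply: eq_bigr => K _.
  by case: ifP.
apply: Rint_sum => // K; case: ifPn => [hK|_]; last exact: Rint0.
apply: (integrableS measurableT) => //.
rewrite (_ : EFin \o _ = (EFin \o v K) \_ [set x | elt_at x = Some K]); last first.
  by apply/funext => x /=; rewrite !patchE; case: ifP.
apply: (proj1 (integrable_mkcond _ (measurable_elt_at K))).
apply: (integrableS (measurable_elt mM hK)) (vI _ hK); first exact: measurable_elt_at.
by move=> x /elt_at_some[].
Qed.

Lemma assemble_measurable (v : efun M R) :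
  (forall K, K \in elts M -> measurable_fun (simplex K) (v K)) ->
  measurable_fun Omega (assemble v).
Proof.
move=> vI; rewrite assemble_sum.
have -> : (fun x => \sum_(K in elts M) (v K \_ [set x | elt_at x = Some K]) x) =
    (fun x => \sum_K (if K \in elts M then v K \_ [set x | elt_at x = Some K] else cst 0) x).
  apply/funext => x; rewrite big_mkcond; apply: eq_bigr => K _.
  by case: ifP.
apply: measurable_funTS; apply: measurable_sum => K.
case: ifPn => [hK|_]; last exact: measurable_cst.
apply/(measurable_restrictT _ (measurable_elt_at K)).
apply: measurable_funS (vI _ hK); first exact: (measurable_elt mM hK).
by move=> x /elt_at_some[].
Qed.

Lemma assemble_L2 (v : efun M R) : (forall K, K \in elts M -> L2 (simplex K) (v K)) ->
  L2 Omega (assemble v).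
Proof.
move=> vL; apply: integrable_L2; first exact: open_row_measurable.
  by apply: assemble_measurable => K /vL[].
have -> : (fun x => assemble v x ^+ 2) = assemble (fun K x => v K x ^+ 2).
  apply/funext => x; rewrite !assembleE; case: elt_at => //.
  by rewrite expr0n.
by apply: assemble_integrable => K /vL; exact: L2_sqr_integrable.
Qed.

End Assemble.

Section Forms.
Context (R : realType) (n : nat) (Omega : set 'rV[R]_n.+1) (M : mesh R n.+1).
Local Notation E := 'rV[R]_n.+1.
Local Notation I := 'I_(nvert M).
Local Notation S := (@ref_simplex R n.+1 : set 'rV[R]_n).
Let mS : measurable S := @measurable_ref_simplex R n.
Implicit Types (K F : {set I}) (z : I) (x : E) (y : 'rV[R]_n).
Implicit Types (v w u : efield M) (s : efun M E).
Hypothesis mM : is_mesh Omega M.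
Hypothesis n0 : (0 < n)%N.
Hypothesis oOmega : open Omega.
Hypothesis lipOmega : lipschitz_boundary Omega.
Variables mu lambda eta : R.

(** The square integrability from which bilinearity of the form follows. It holds for [eH1] fields
    and for affine fields alike, so errors and discrete functions share one calculus. *)
Definition form_field v :=
  (forall K, K \in elts M -> forall i j, L2 (simplex K) (fun x => eD v K x i j)) /\
  (forall F K, F \in faces M -> K \in elts M -> F \subset K -> forall i,
     L2 S (fun y => etr v K F (face_param F y) 0 i)).

Lemma eH1_form_field v : eH1 v -> form_field v.
Proof.
move=> Hv; split=> [K hK i j|F K hF hK FK i].
  have [[_ /(_ j) HD _] _] := Hv K hK i.
  by apply: L2_eq HD => x _; rewrite mxE.
have [_ /(_ F hF FK)[[mt ft] _]] := Hv K hK i.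
have [cF _] := (facesP F).1 hF.
split; first exact: mt.
(* With Jacobian 0 the weighted integral would be finite for every trace; positivity carries
   finiteness over to the reference simplex. *)
have jp := face_jac_gt0 mM n0 hK FK cF.
have X0 : (0 <= \int[leb R n]_(y in S) ((etr v K F (face_param F y) 0 i) ^+ 2)%:E)%E.
  by apply: integral_ge0 => y _; rewrite lee_fin sqr_ge0.
have : ((face_jac F)%:E *
    \int[leb R n]_(y in S) ((etr v K F (face_param F y) 0 i) ^+ 2)%:E < +oo)%E := ft.
move: X0; case: (\int[leb R n]_(y in S) ((etr v K F (face_param F y) 0 i) ^+ 2)%:E)%E => [r| |]//.
  by move=> _ _; rewrite ltry.
by move=> _; rewrite gt0_muley ?lte_fin.
Qed.

Lemma S01_affine s K : S01 s -> K \in elts M -> exists (g : 'I_n.+1 -> E) (c : 'I_n.+1 -> R),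
  forall x i, s K x 0 i = dot x (g i) + c i.
Proof.
move=> Ss hK; have [A [b Hs]] := Ss K hK.
exists (fun i => \row_j A j i), (fun i => b 0 i) => x i.
by rewrite Hs !mxE; congr (_ + _); apply: eq_bigr => j _; rewrite mxE.
Qed.

Lemma affine_simplex_L2 K (g : E) c : K \in elts M ->
  L2 (simplex K) (fun x => dot x g + c).
Proof.
move=> hK; have [N N0 KN] := simplex_sub_cube K.
exact: (L2_affine g c (measurable_elt mM hK) N0 KN).
Qed.

Lemma continuous_face_param F (g : E) (c : R) : #|F| = n.+1 ->
  continuous (fun y => dot (face_param F y) g + c).
Proof.
move=> cF; under eq_fun do rewrite (affine_face_param cF).
exact: continuous_ref_sum.
Qed.

Lemma affine_form_field s : S01 s -> form_field (of_affine s).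
Proof.
move=> Ss; split=> [K hK i j|F K hF hK FK i].
  have [g [c Hs]] := S01_affine Ss hK.
  apply: (@L2_eq _ _ _ (fun x => dot x 0 + g i 0 j)); last exact: affine_simplex_L2.
  move=> x _; rewrite mxE dotC dot0l add0r.
  under [in RHS]eq_fun do rewrite Hs.
  by have [] := partial_affine (g i) (c i) j x.
have [g [c Hs]] := S01_affine Ss hK; have [cF _] := (facesP F).1 hF.
apply: (@L2_eq _ _ _ (fun y => dot (face_param F y) (g i) + c i)).
  by move=> y _; rewrite /= Hs.
by apply: continuous_ref_L2; exact: continuous_face_param.
Qed.

Definition field_add a v w : efield M :=
  EField (fun K x => a *: ev v K x + ev w K x)
         (fun K x => a *: eD v K x + eD w K x)
         (fun K F x => a *: etr v K F x + etr w K F x).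

Lemma form_field_add a v w : form_field v -> form_field w -> form_field (field_add a v w).
Proof.
move=> [v1 v2] [w1 w2]; split=> [K hK i j|F K hF hK FK i].
  have mK := measurable_elt mM hK.
  apply: (@L2_eq _ _ _ (fun x => a * eD v K x i j + eD w K x i j)).
    by move=> x _; rewrite !mxE.
  by apply: L2D => //; [apply: L2Z => //; exact: v1|exact: w1].
apply: (@L2_eq _ _ _ (fun y => a * etr v K F (face_param F y) 0 i +
   etr w K F (face_param F y) 0 i)).
  by move=> x _; rewrite !mxE.
by apply: L2D => //; [apply: L2Z => //; exact: v2|exact: w2].
Qed.

Definition tjump v F x := jump Omega (fun K => etr v K F) F x.

Lemma tjump_add a v w F x : tjump (field_add a v w) F x = a *: tjump v F x + tjump w F x.
Proof.
rewrite /tjump /jump; case: ifP => _ //=.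
by rewrite scalerBr opprD addrACA.
Qed.

Lemma tjump_L2 v F i : form_field v -> F \in faces M ->
  L2 S (fun y => tjump v F (face_param F y) 0 i).
Proof.
move=> [_ v2] hF; have [h0 F0] := face_elt0 hF.
rewrite /tjump /jump; case: (boolP (int_face Omega F)) => iF; last exact: v2.
have [h1 F1] := face_elt1 mM isT oOmega hF iF.
apply: (@L2_eq _ _ _ (fun y => etr v (face_elt F 0) F (face_param F y) 0 i +
   -1 * etr v (face_elt F 1) F (face_param F y) 0 i)).
  by move=> y _; rewrite !mxE mulN1r.
by apply: L2D => //; [exact: v2|apply: L2Z => //; exact: v2].
Qed.

Definition vol_form v w : R := \int[leb R n.+1]_(x in Omega)
  assemble (fun K t => elas_density mu lambda (eD v K t) (eD w K t)) x.

Definition face_form v w F : R := face_int F (fun x => eta / diam (simplex F) *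
  dot (tjump v F x) (tjump w F x)).

Lemma a_formE v w : a_form Omega mu lambda eta v w =
  vol_form v w + \sum_(F in faces M) face_form v w F.
Proof. by []. Qed.

Lemma face_dot_integrable v w F : form_field v -> form_field w -> F \in faces M ->
  (leb R n).-integrable S (EFin \o (fun y => eta / diam (simplex F) *
    dot (tjump v F (face_param F y)) (tjump w F (face_param F y)))).
Proof.
move=> gv gw hF.
apply: RintZ => //; apply: Rint_sum => // i.
by apply: L2_mul_integrable => //; exact: tjump_L2.
Qed.

Lemma a_form_add a v w u : form_field v -> form_field w -> form_field u ->
  a_form Omega mu lambda eta (field_add a v w) u =
  a * a_form Omega mu lambda eta v u + a_form Omega mu lambda eta w u.
Proof.
move=> gv gw gu; rewrite !a_formE mulrDr addrACA; congr (_ + _).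
  rewrite -RintegralZD; first last.
  - apply: (assemble_integrable mM oOmega) => K hK.
    by apply: elas_density_integrable; [exact: (measurable_elt mM hK)|exact: (gw.1 K hK)|exact: (gu.1 K hK)].
  - apply: (assemble_integrable mM oOmega) => K hK.
    by apply: elas_density_integrable; [exact: (measurable_elt mM hK)|exact: (gv.1 K hK)|exact: (gu.1 K hK)].
  - exact: open_row_measurable.
  apply: eq_Rintegral => x _; rewrite !assembleE; case: elt_at => [K|]; last by rewrite mulr0 addr0.
  exact: elas_density_lin.
rewrite mulr_sumr -big_split; apply: eq_bigr => F hF /=.
rewrite /face_form /face_int mulrCA -mulrDr; congr (_ * _).
rewrite -RintegralZD//; try exact: face_dot_integrable.
by apply: eq_Rintegral => y _; rewrite tjump_add dotDl dotZl; ring.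
Qed.

Lemma a_formC v w : a_form Omega mu lambda eta v w = a_form Omega mu lambda eta w v.
Proof.
rewrite !a_formE; congr (_ + _).
  apply: eq_Rintegral => x _; rewrite !assembleE; case: elt_at => // K.
  exact: elas_densityC.
by apply: eq_bigr => F _; congr (_ * _); apply: eq_Rintegral => y _; rewrite dotC.
Qed.

Hypotheses (mu0 : 0 <= mu) (lambda0 : 0 <= lambda) (eta0 : 0 <= eta).

Lemma face_form_ge0 v F : 0 <= face_form v v F.
Proof.
apply: mulr_ge0; first exact: sqrtr_ge0.
by apply: Rintegral_ge0 => y _; rewrite mulr_ge0 ?divr_ge0 ?diam_ge0// dotxx_ge0.
Qed.

Lemma vol_form_ge0 v : 0 <= vol_form v v.
Proof.
apply: Rintegral_ge0 => x _; rewrite assembleE; case: elt_at => // K.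
exact: elas_density_ge0.
Qed.

Lemma a_form_ge0 v : 0 <= a_form Omega mu lambda eta v v.
Proof. by rewrite a_formE addr_ge0 ?vol_form_ge0// sumr_ge0// => F _; exact: face_form_ge0. Qed.

Lemma face_form_le v : \sum_(F in faces M) face_form v v F <= a_form Omega mu lambda eta v v.
Proof. by rewrite a_formE lerDr vol_form_ge0. Qed.

Lemma a_norm_add a v w : form_field v -> form_field w ->
  a_norm Omega mu lambda eta (field_add a v w) <=
  `|a| * a_norm Omega mu lambda eta v + a_norm Omega mu lambda eta w.
Proof.
move=> gv gw; pose B (p q : efield M) := a_form Omega mu lambda eta p q.
have cs : B v w ^+ 2 <= B v v * B w w.
  rewrite mulrC; apply: quad_nonneg_disc; first exact: a_form_ge0.
  move=> t; have := a_form_ge0 (field_add t v w).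
  rewrite a_form_add//; last exact: form_field_add.
  rewrite a_formC [a_form _ _ _ _ w _]a_formC !a_form_add// -!/(B _ _) [B w v]a_formC -!/(B _ _) => h.
  apply: le_trans h _; apply: eq_implies_le; ring.
have Bv0 := a_form_ge0 v; have Bw0 := a_form_ge0 w; rewrite -!/(B _ _) in Bv0 Bw0.
have cs' : `|B v w| <= Num.sqrt (B v v) * Num.sqrt (B w w).
  by rewrite -sqrtrM// -sqrtr_sqr ler_wsqrtr.
rewrite -[leRHS]ger0_norm ?addr_ge0 ?mulr_ge0 ?sqrtr_ge0// -sqrtr_sqr ler_wsqrtr//.
rewrite a_form_add//; last exact: form_field_add.
rewrite a_formC [a_form _ _ _ _ w _]a_formC !a_form_add// -!/(B _ _) [B w v]a_formC -!/(B _ _).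
rewrite sqrrD exprMn !sqr_sqrtr// real_normK ?num_real//.
have h : a * B v w <= `|a| * (Num.sqrt (B v v) * Num.sqrt (B w w)).
  apply: le_trans (ler_norm _) _; rewrite normrM ler_wpM2l//.
have -> : a * (a * B v v + B v w) + (a * B v w + B w w) =
   a ^+ 2 * B v v + (a * B v w) *+ 2 + B w w by ring.
by rewrite lerD2r lerD2l lerMn2r -mulrA h.
Qed.

(** The form reads only gradients on elements and traces on their faces. Values at other index sets,
    which are arbitrary, do not affect it. *)
Lemma a_form_ext v v' w :
  (forall K, K \in elts M -> eD v K =1 eD v' K) ->
  (forall F K, F \in faces M -> K \in elts M -> F \subset K -> etr v K F =1 etr v' K F) ->
  a_form Omega mu lambda eta v w = a_form Omega mu lambda eta v' w.
Proof.
move=> HD Ht; rewrite !a_formE; congr (_ + _).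
  apply: eq_Rintegral => x _; rewrite !assembleE.
  by case E: (elt_at M x) => [K|//]; rewrite HD//; have [] := elt_at_some E.
apply: eq_bigr => F hF; congr (_ * _); apply: eq_Rintegral => y _.
congr (_ * dot _ _); rewrite /tjump /jump; have [h0 F0] := face_elt0 hF.
case: (boolP (int_face Omega F)) => iF; last by rewrite Ht.
by have [h1 F1] := face_elt1 mM isT oOmega hF iF; rewrite !Ht.
Qed.

End Forms.

(** * The smoother *)

Lemma sqr_sum_le (R : realFieldType) (T : finType) (A : {pred T}) (a : T -> R) :
  (\sum_(i in A) a i) ^+ 2 <= #|A|%:R * \sum_(i in A) a i ^+ 2.
Proof.
rewrite mulrC; have -> : #|A|%:R = \sum_(i in A) (1 : R) ^+ 2.
  by under eq_bigr do rewrite expr1n; rewrite sumr_const.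
have -> : \sum_(i in A) a i = \sum_(i in A) a i * 1 by under [RHS]eq_bigr do rewrite mulr1.
apply: quad_nonneg_disc; first by apply: sumr_ge0 => i _; exact: sqr_ge0.
move=> t; rewrite -mulrnAl !mulr_sumr -!big_split /=.
apply: sumr_ge0 => i _; have -> : a i ^+ 2 + t *+ 2 * (a i * 1) + t ^+ 2 * 1 ^+ 2 = (a i + t) ^+ 2.
  by ring.
exact: sqr_ge0.
Qed.

Section Smoother.
Context (R : realType) (n : nat) (Omega : set 'rV[R]_n.+1) (M : mesh R n.+1).
Local Notation E := 'rV[R]_n.+1.
Local Notation I := 'I_(nvert M).
Local Notation S := (@ref_simplex R n.+1 : set 'rV[R]_n).
Let mS : measurable S := @measurable_ref_simplex R n.
Implicit Types (K F : {set I}) (z : I) (x : E) (y : 'rV[R]_n).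
Hypothesis mM : is_mesh Omega M.
Hypothesis n0 : (0 < n)%N.
Hypothesis oOmega : open Omega.
Hypothesis lipOmega : lipschitz_boundary Omega.
Let d1 : (1 < n.+1)%N. Proof. by []. Qed.
Variable gam : R.
Hypothesis gam1 : 1 <= gam.
Hypothesis shape : shape_coef M <= gam.
Variable Kz : I -> {set I}.
Hypothesis hKz : forall z, ~ bdry Omega (vtx z) -> Kz z \in elts M /\ z \in Kz z.

Local Notation h K := (diam (simplex K)).
Local Notation N := (star_bound n.+1 gam).

(** One scalar component of an elementwise affine field, with its gradients and constants; the
    smoother acts componentwise. *)
Variables (sg : {set I} -> E -> R) (gs : {set I} -> E) (cs : {set I} -> R).
Hypothesis sgE : forall K, K \in elts M -> forall x, sg K x = dot x (gs K) + cs K.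

Definition snode z : R := if `[< ~ bdry Omega (vtx z) >] then sg (Kz z) (vtx z) else 0.
Definition sA1 x : R := \sum_(z | `[< ~ bdry Omega (vtx z) >]) hat z x * sg (Kz z) (vtx z).
Definition sjump F x : R :=
  if int_face Omega F then sg (face_elt F 0) x - sg (face_elt F 1) x else sg (face_elt F 0) x.
Definition savg F x : R :=
  2^-1 * ((sg (face_elt F 0) x - sA1 x) + (sg (face_elt F 1) x - sA1 x)).
Definition scoef F : R := face_int F (savg F) / face_int F (bubble F).
Definition sE1 x : R := sA1 x + \sum_(F in faces M | int_face Omega F) bubble F x * scoef F.

Definition defect K z : R := sg K (vtx z) - snode z.

(** The faces at [z] of the elements reachable from [K]: exactly the jumps that can be met by a
    chain around [z] starting in [K]. *)
Definition linked K z F : bool :=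
  [&& F \in faces M, z \in F & [exists K1, connect (adj z) K K1 && (F \subset K1)]].

Definition jumps K z : R := \sum_(F | linked K z F) sjump F (vtx z) ^+ 2.

Lemma jumps_ge0 K z : 0 <= jumps K z.
Proof. by apply: sumr_ge0 => F _; exact: sqr_ge0. Qed.

Lemma linked_jump K z F : linked K z F -> `|sjump F (vtx z)| <= Num.sqrt (jumps K z).
Proof.
move=> lF; rewrite -sqrtr_sqr ler_wsqrtr// /jumps (bigD1 F)//= lerDl.
by apply: sumr_ge0 => F' _; exact: sqr_ge0.
Qed.

Lemma linked_connect K z K1 F : connect (adj z) K K1 -> K1 \in elts M -> F \subset K1 ->
  #|F| = n.+1 -> z \in F -> linked K z F.
Proof.
move=> c1 h1 F1 cF zF; rewrite /linked zF andTb; apply/andP; split.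
  by apply/facesP; split => //; exists K1.
by apply/existsP; exists K1; rewrite c1.
Qed.

Lemma star_diff K z K' : K \in elts M -> z \in K -> connect (adj z) K K' ->
  `|sg K (vtx z) - sg K' (vtx z)| <= N%:R * Num.sqrt (jumps K z).
Proof.
move=> hK zK; apply: (connect_diff mM d1 gam1 shape hK zK (f := fun K => sg K (vtx z))).
  exact: sqrtr_ge0.
move=> K1 K2 c1 /[dup] a12 /and4P[h1 h2 zI /eqP cI].
have F1 : K1 :&: K2 \subset K1 := finset.subsetIl _ _.
have F2 : K1 :&: K2 \subset K2 := finset.subsetIr _ _.
apply: le_trans (linked_jump (linked_connect c1 h1 F1 cI zI)).
have n12 : K1 != K2.
  apply/eqP => e; move: cI; rewrite -e finset.setIid (elt_card mM h1) => /eqP.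
  by rewrite eqn_leq ltnn.
have [iF] := face_elt_two mM isT oOmega lipOmega h1 h2 n12 F1 F2 cI.
by rewrite /sjump iF => -[[-> ->]|[-> ->]] //; rewrite distrC.
Qed.

(** At most [N] steps lead through the star. One more jump is needed at a boundary vertex, where
    [snode] is 0 and the jump of the final one-sided face is the value itself; hence [N.+1]. *)
Lemma defect_le K z : K \in elts M -> z \in K ->
  defect K z ^+ 2 <= N.+1%:R ^+ 2 * jumps K z.
Proof.
move=> hK zK; rewrite -[X in _ * X]sqr_sqrtr ?jumps_ge0// -exprMn.
rewrite -[leLHS]real_normK ?num_real// lerXn2r ?nnegrE ?mulr_ge0 ?sqrtr_ge0//.
rewrite /defect /snode; case: asboolP => bz.
  have [hz zz] := hKz bz.
  apply: le_trans (star_diff hK zK _) _.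
    exact: (star_int_connect mM isT oOmega).
  by rewrite ler_wpM2r ?sqrtr_ge0// ler_nat.
have [K1 [F [c1 F1 cF zF uF]]] :=
  star_bdry_face mM isT oOmega lipOmega hK zK (contrapT bz).
have [h1 z1] := adj_connect_elt hK zK c1.
have [_ iF fE] := face_elt_unique mM isT oOmega h1 F1 cF uF.
rewrite subr0 -[sg K _](subrK (sg K1 (vtx z))).
apply: le_trans (ler_normD _ _) _.
rewrite -natr1 mulrDl mul1r lerD ?star_diff//.
apply: le_trans (linked_jump (linked_connect c1 h1 F1 cF zF)).
by rewrite /sjump iF fE.
Qed.

Lemma bdry_sum (f : I -> R) : \sum_(z | `[< ~ bdry Omega (vtx z) >]) f z * sg (Kz z) (vtx z) =
  \sum_z f z * snode z.
Proof.
rewrite big_mkcond; apply: eq_bigr => z _; rewrite /snode.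
by case: ifP => // _; rewrite mulr0.
Qed.

Lemma sA1E K x : K \in elts M -> simplex K x -> sA1 x = \sum_z lam K z x * snode z.
Proof.
move=> hK xK; rewrite /sA1 bdry_sum; apply: eq_bigr => z _.
by rewrite (hatE mM _ hK xK).
Qed.

Lemma sg_defect K x : K \in elts M -> simplex K x ->
  sg K x - sA1 x = \sum_z lam K z x * defect K z.
Proof.
move=> hK xK; rewrite (sA1E hK xK) sgE// (lam_affine mM hK) -sumrB.
by apply: eq_bigr => z _; rewrite /defect sgE// mulrBr.
Qed.

Definition dsum K : R := \sum_(z in K) `|defect K z|.

Lemma dsum_ge0 K : 0 <= dsum K. Proof. exact: sumr_ge0. Qed.

Lemma lam_le1 K z x : K \in elts M -> simplex K x -> lam K z x <= 1.
Proof.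
move=> hK xK; rewrite -(lam_sum mM hK x) (bigD1 z)//= lerDl sumr_ge0// => w _.
exact: ((eltE mM hK x).1 xK).
Qed.

Lemma sg_defect_le K x : K \in elts M -> simplex K x -> `|sg K x - sA1 x| <= dsum K.
Proof.
move=> hK xK; rewrite (sg_defect hK xK) (bigID (mem K)) /= [X in _ + X]big1 ?addr0; last first.
  by move=> z zK; rewrite (lam_notin mM)// mul0r.
apply: le_trans (ler_norm_sum _ _ _) _; apply: ler_sum => z _.
rewrite normrM ger0_norm; last exact: ((eltE mM hK x).1 xK).
by rewrite ler_piMl// lam_le1.
Qed.

(** The elements whose defects influence [sE1] on [K]: the coefficient at a face of [K] averages
    over the two elements that share it. *)
Definition nbr K : {set {set I}} :=
  [set K' in elts M | (K' == K) || (#|K :&: K'| == n.+1)]%SET.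

Lemma nbr_sym K K' : K \in elts M -> K' \in nbr K -> K \in nbr K'.
Proof.
by move=> hK; rewrite !inE hK => /andP[hK']; rewrite eq_sym finset.setIC.
Qed.

Lemma nbr_refl K : K \in elts M -> K \in nbr K.
Proof. by move=> hK; rewrite inE hK eqxx. Qed.

(** A neighbour has one of the [n.+2] vertices of [K] in common with it, and each star has at most
    [N] elements. *)
Lemma nbr_card K : K \in elts M -> (#|nbr K| <= n.+2 * N)%N.
Proof.
move=> hK; have sub : nbr K \subset (\bigcup_(z in K) star z)%SET.
  apply/fintype.subsetP => K'; rewrite inE => /andP[hK' H].
  have : (0 < #|K :&: K'|)%N.
    by case/orP: H => [/eqP ->|/eqP ->//]; rewrite finset.setIid (elt_card mM hK).
  move=> /card_gt0P[z]; rewrite inE => /andP[zK zK'].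
  by apply/finset.bigcupP; exists z => //; rewrite inE hK'.
apply: leq_trans (subset_leq_card sub) _.
have : (#|(\bigcup_(z in K) star z)%SET| <= \sum_(z in K) #|star z|)%N.
  elim/big_ind2: _ => [|A a B b Aa Bb|//]; first by rewrite cards0.
  exact: leq_trans (leq_card_setU a b).1 (leq_add Aa Bb).
move=> /leq_trans; apply; rewrite -(elt_card mM hK) -sum_nat_const.
by apply: leq_sum => z _; exact: (star_le mM d1 gam1 shape).
Qed.

Lemma nbr_h K K' : K \in elts M -> K' \in nbr K -> h K <= gam * h K'.
Proof.
move=> hK; rewrite inE => /andP[hK' /orP[/eqP->|/eqP cI]].
  by rewrite ler_peMl// diam_ge0.
apply: le_trans (h_le_face mM d1 gam1 shape hK (finset.subsetIl _ _) cI) _.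
rewrite ler_pM2l ?(lt_le_trans ltr01)//.
exact: face_le_h (finset.subsetIr _ _) cI.
Qed.

Definition nsum K : R := \sum_(K' in nbr K) dsum K'.

Lemma nsum_ge K K' : K' \in nbr K -> dsum K' <= nsum K.
Proof.
move=> h'; rewrite /nsum (bigD1 K')//= lerDl sumr_ge0// => K1 _; exact: dsum_ge0.
Qed.

Lemma nsum_ge0 K : 0 <= nsum K.
Proof. by apply: sumr_ge0 => K' _; exact: dsum_ge0. Qed.

Lemma int_face_pair F K : F \in faces M -> int_face Omega F -> K \in elts M -> F \subset K ->
  [/\ face_elt F 0 \in nbr K & face_elt F 1 \in nbr K].
Proof.
move=> hF iF hK FK; have [h0 F0] := face_elt0 hF; have [h1 F1] := face_elt1 mM isT oOmega hF iF.
have [cF _] := (facesP F).1 hF.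
have H K' : K' \in elts M -> F \subset K' -> K' \in nbr K.
  move=> hK' FK'; rewrite inE hK' /=; have [->//|KK'] := eqVneq K' K.
  have FI : F \subset K :&: K' by rewrite finset.subsetI FK.
  have := subset_leq_card FI; rewrite cF eqn_leq => ->; rewrite andbT.
  have : (#|K :&: K'| < #|K|)%N.
    apply: proper_card; rewrite properE finset.subsetIl /= finset.subsetI subxx /=.
    by apply: contra KK' => KK'; apply/eqP/esym; exact: (elt_sub_eq mM).
  by rewrite (elt_card mM hK) ltnS.
by split; apply: H.
Qed.

(** [2 ^+ n] bounds the measure of the reference simplex, and [bubble_mass] bounds the integral of
    the bubble from below; in [scoef] the Jacobians cancel. *)
Definition bubble_cst : R := 2 ^+ n / bubble_mass R n.

Lemma bubble_cst_ge0 : 0 <= bubble_cst.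
Proof. by rewrite divr_ge0 ?exprn_ge0// ltW// bubble_mass_gt0. Qed.

Lemma savg_integrable F : F \in faces M -> int_face Omega F ->
(leb R n).-integrable S (EFin \o (fun y => savg F (face_param F y))).
Proof.
move=> hF iF; have [cF _] := (facesP F).1 hF.
have [h0 F0] := face_elt0 hF; have [h1 F1] := face_elt1 mM isT oOmega hF iF.
pose q k := 2^-1 * (defect (face_elt F 0) (face_idx cF k) + defect (face_elt F 1) (face_idx cF k)).
apply: (L2_integrable mS (ref_simplex_lty R n)).
apply: (@L2_eq _ _ _ (fun y => \sum_k q k * ref_bary k y)); last first.
  by apply: continuous_ref_L2; exact: continuous_ref_sum.
move=> y yS; have xF := face_param_simplex cF yS.
have sE K' : K' \in elts M -> F \subset K' ->
    sg K' (face_param F y) - sA1 (face_param F y) =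
    \sum_k ref_bary k y * defect K' (face_idx cF k).
  move=> hK' FK'; rewrite (sg_defect hK' (simplexS FK' xF)) (bigID (mem F)) /=.
  rewrite [X in _ + X]big1 ?addr0; last first.
    by move=> z zF; rewrite ((simplexE mM hK' _ FK').1 xF).2// mul0r.
  rewrite (big_face cF); apply: eq_bigr => k _.
  by rewrite (lam_face_param mM).
rewrite /savg !sE// -big_split mulr_sumr; apply: eq_bigr => k _.
by rewrite /q /=; ring.
Qed.

Lemma scoef_le F K : F \in faces M -> int_face Omega F -> K \in elts M -> F \subset K ->
  `|scoef F| <= bubble_cst * nsum K.
Proof.
move=> hF iF hK FK; have [cF _] := (facesP F).1 hF.
have [h0 F0] := face_elt0 hF; have [h1 F1] := face_elt1 mM isT oOmega hF iF.
have [nb0 nb1] := int_face_pair hF iF hK FK.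
have jp := face_jac_gt0 mM n0 hK FK cF.
pose f y := savg F (face_param F y).
have fle y : S y -> `|f y| <= nsum K.
  move=> yS; have xF := face_param_simplex cF yS.
  have e0 := sg_defect_le h0 (simplexS F0 xF).
  have e1 := sg_defect_le h1 (simplexS F1 xF).
  have m0 := nsum_ge nb0; have m1 := nsum_ge nb1.
  rewrite /f /savg normrM ger0_norm ?invr_ge0//.
  have := ler_normD (sg (face_elt F 0) (face_param F y) - sA1 (face_param F y))
    (sg (face_elt F 1) (face_param F y) - sA1 (face_param F y)).
  move: e0 e1 m0 m1.
  move: (`|sg (face_elt F 0) _ - _|) (`|sg (face_elt F 1) _ - _|) (dsum _) (dsum _) (nsum K).
  move: (`|_ + _|) => a b c e k m; lra.
have If : (leb R n).-integrable S (EFin \o f) := savg_integrable hF iF.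
have Sle : fine (leb R n S) <= 2 ^+ n.
  rewrite -lee_fin fineK ?ge0_fin_numE ?measure_ge0//; last exact: ref_simplex_lty.
  rewrite -[2]mulr1 -(leb_cube (0 : 'rV[R]_n) ler01).
  by apply: le_measure; rewrite ?inE//; [exact: measurable_cube|exact: ref_simplex_cube].
have fint : `|\int[leb R n]_(y in S) f y| <= nsum K * 2 ^+ n.
  apply: le_trans (le_normr_Rintegral mS If) _.
  apply: (@le_trans _ _ (\int[leb R n]_(y in S) nsum K)).
    apply: le_Rintegral => //; first exact: integrable_norm.
    apply: (L2_integrable mS (ref_simplex_lty R n)).
    by apply: continuous_ref_L2; exact: cst_continuous.
  by rewrite Rintegral_cst// ler_wpM2l// nsum_ge0.
have bint : bubble_mass R n <= \int[leb R n]_(y in S) bubble F (face_param F y).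
  apply: le_trans (ref_bubble_ge R n) _; apply: eq_implies_le.
  apply: eq_Rintegral => y; rewrite inE => yS.
  by rewrite (bubble_face_param mM cF hK FK yS).
have b0 := bubble_mass_gt0 R n; have bp := lt_le_trans b0 bint.
rewrite /scoef /face_int -mulf_div divff ?gt_eqF// mul1r normrM normfV.
rewrite [`|\int[_]_(y in _) bubble _ _|]gtr0_norm// ler_pdivrMr//.
apply: le_trans fint _; rewrite /bubble_cst.
set J := \int[leb R n]_(y in S) _.
have -> : 2 ^+ n / bubble_mass R n * nsum K * J = nsum K * 2 ^+ n * (J / bubble_mass R n).
  by rewrite -!mulrA; ring.
by rewrite ler_peMr ?mulr_ge0 ?nsum_ge0 ?exprn_ge0// ler_pdivlMr// mul1r.
Qed.

(** The 1 accounts for sigma - A_1 sigma. A bubble that is nonzero on [K] belongs to a face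
    contained in the [n.+2] vertices of [K], so there are at most [2 ^+ n.+2] of them. *)
Definition est_cst : R := 1 + 2 ^+ n.+2 * bubble_cst.

Lemma sE1_le K x : K \in elts M -> simplex K x -> `|sE1 x - sg K x| <= est_cst * nsum K.
Proof.
move=> hK xK; rewrite /sE1 addrAC.
apply: le_trans (ler_normD _ _) _; rewrite mulrDl mul1r; apply: lerD.
  rewrite distrC; apply: le_trans (sg_defect_le hK xK) _.
  exact: nsum_ge (nbr_refl hK).
apply: le_trans (ler_norm_sum _ _ _) _.
have term F : F \in faces M -> int_face Omega F ->
    `|bubble F x * scoef F| <= if F \subset K then bubble_cst * nsum K else 0.
  move=> hF iF; have lx := (eltE mM hK x).1 xK.
  case: ifPn => FK; last first.
    have [z zF zK] : exists2 z, z \in F & z \notin K.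
      by move: FK => /fintype.subsetPn[z zF zK]; exists z.
    by rewrite /bubble (bigD1 z)//= (hatE mM _ hK xK) (lam_notin mM)// !mul0r normr0.
  rewrite normrM -[leRHS]mul1r ler_pM// ?scoef_le//.
  rewrite /bubble normr_prod prodr_ile1// => z _.
  by rewrite (hatE mM _ hK xK) normr_ge0 ger0_norm// lam_le1.
apply: (@le_trans _ _ (\sum_(F in powerset K) bubble_cst * nsum K)).
  rewrite big_mkcond [leRHS]big_mkcond /=; apply: ler_sum => F _.
  rewrite powersetE; case: ifPn => [/andP[hF iF]|_]; first exact: term.
  by case: ifP => // _; rewrite mulr_ge0 ?bubble_cst_ge0 ?nsum_ge0.
rewrite sumr_const card_powerset (elt_card mM hK) -[leLHS]mulr_natl natrX mulrA.
by [].
Qed.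

Definition nbr_jumps K : R := \sum_(K' in nbr K) \sum_(z in K') jumps K' z.

(** Cauchy-Schwarz over at most [n.+2 * N] neighbours and then over the [n.+2] vertices of each,
    followed by [defect_le]. *)
Definition nsum_cst : R := (n.+2 * N)%:R * (n.+2%:R * N.+1%:R ^+ 2).

Lemma nsum_le K : K \in elts M -> nsum K ^+ 2 <= nsum_cst * nbr_jumps K.
Proof.
move=> hK; rewrite /nsum; apply: le_trans (sqr_sum_le _ _) _.
rewrite /nsum_cst -mulrA; apply: ler_pM => //.
- by apply: sumr_ge0 => K' _; exact: sqr_ge0.
- by rewrite ler_nat nbr_card.
rewrite /nbr_jumps mulr_sumr; apply: ler_sum => K'; rewrite inE => /andP[hK' _].
apply: le_trans (sqr_sum_le _ _) _; rewrite (elt_card mM hK') -mulrA ler_wpM2l// mulr_sumr.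
apply: ler_sum => z zK; rewrite real_normK ?num_real//.
exact: defect_le.
Qed.

Lemma sE1_sqr_le K x : K \in elts M -> simplex K x ->
  (sE1 x - sg K x) ^+ 2 <= est_cst ^+ 2 * nsum_cst * nbr_jumps K.
Proof.
move=> hK xK; have e0 : 0 <= est_cst.
  by rewrite addr_ge0// mulr_ge0 ?exprn_ge0// bubble_cst_ge0.
apply: (@le_trans _ _ ((est_cst * nsum K) ^+ 2)).
  rewrite -[leLHS]real_normK ?num_real// lerXn2r ?nnegrE ?mulr_ge0 ?nsum_ge0//.
  exact: sE1_le.
by rewrite exprMn -mulrA ler_wpM2l ?exprn_ge0// nsum_le.
Qed.

Variable eta : R.
Hypothesis eta0 : 0 < eta.

Let g0 : 0 < gam. Proof. exact: lt_le_trans ltr01 gam1. Qed.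

Lemma elt_volume K : K \in elts M -> (leb R n.+1 (simplex K) <= ((2 * h K) ^+ n.+1)%:E)%E.
Proof.
move=> hK; have : (0 < #|K|)%N by rewrite (elt_card mM hK).
move=> /card_gt0P[z zK]; rewrite -(leb_cube (vtx z) (diam_ge0 K)).
apply: le_measure; rewrite ?inE; [exact: (measurable_elt mM hK)|exact: measurable_cube|].
move=> x xK i; have := coord_le_enorm (x - vtx z) i; rewrite !mxE => /le_trans; apply.
by apply: le_diam => //; exact: vtx_elt.
Qed.

(** One factor [gam] for each of at most [N] steps of the chain, and one from the last element to
    its face. *)
Lemma linked_h K z F : K \in elts M -> z \in K -> linked K z F ->
  h K <= gam ^+ N.+1 * h F.
Proof.
move=> hK zK /and3P[hF zF /existsP[K1 /andP[c1 F1]]].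
have [h1 z1] := adj_connect_elt hK zK c1; have [cF _] := (facesP F).1 hF.
apply: le_trans (connect_h mM d1 gam1 shape hK zK c1) _.
rewrite exprSr -mulrA ler_wpM2l ?exprn_ge0 ?(ltW g0)//.
exact: (h_le_face mM d1 gam1 shape h1 F1 cF).
Qed.

Lemma sjump_affine F : F \in faces M -> exists g c, forall x, sjump F x = dot x g + c.
Proof.
move=> hF; have [e0 F0] := face_elt0 hF; rewrite /sjump.
case: (boolP (int_face Omega F)) => iF; last first.
  by exists (gs (face_elt F 0)), (cs (face_elt F 0)) => x; rewrite sgE.
have [e1 F1] := face_elt1 mM isT oOmega hF iF.
exists (gs (face_elt F 0) - gs (face_elt F 1)), (cs (face_elt F 0) - cs (face_elt F 1)) => x.
by rewrite !sgE// dotBr; ring.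
Qed.

Definition face_energy F : R := face_int F (fun x => eta / h F * sjump F x ^+ 2).

Lemma face_energyE F : F \in faces M ->
  face_energy F = eta / h F * face_int F (fun x => sjump F x ^+ 2).
Proof.
move=> hF; rewrite /face_energy /face_int mulrCA; congr (_ * _).
have [cF _] := (facesP F).1 hF.
have [g [c H]] := sjump_affine hF.
rewrite RintegralZl//; apply: L2_sqr_integrable.
apply: (@L2_eq _ _ _ (fun y => dot (face_param F y) g + c)); first by move=> y _; rewrite H.
by apply: continuous_ref_L2; exact: continuous_face_param.
Qed.

Lemma face_energy_ge0 F : 0 <= face_energy F.
Proof.
apply: mulr_ge0; first exact: sqrtr_ge0.
apply: Rintegral_ge0 => y _; rewrite mulr_ge0 ?sqr_ge0// divr_ge0 ?diam_ge0//.
exact: ltW.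
Qed.

Definition jac_cst : R := gam ^+ n.+1 * (n.+1)`!%:R.

(** Shape regularity gives [h K ^+ n.+1 <= (gam * rho K) ^+ n.+1]; after [face_jac_ge] one power of
    [h K] cancels. *)
Lemma h_le_jac F : F \in faces M -> h F ^+ n <= jac_cst * face_jac F.
Proof.
move=> hF; have [cF [K hK FK]] := (facesP F).1 hF.
have hp := h_gt0 mM d1 hK; have hr := h_le_rho mM d1 shape hK.
have jg := face_jac_ge mM n0 hK FK cF.
apply: (@le_trans _ _ (h K ^+ n)).
  by rewrite lerXn2r ?nnegrE ?diam_ge0//; exact: (face_le_h d1).
rewrite -(ler_pM2r hp) -exprSr.
apply: (@le_trans _ _ ((gam * indiam (simplex K)) ^+ n.+1)).
  by rewrite lerXn2r ?nnegrE ?diam_ge0// (le_trans (diam_ge0 _) hr).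
rewrite exprMn /jac_cst -mulrA -mulrA ler_wpM2l ?exprn_ge0 ?(ltW g0)//.
by apply: le_trans jg _; apply: eq_implies_le; ring.
Qed.

Definition term_cst : R := (2 * gam ^+ N.+1) ^+ n.+1 * jac_cst / (ref_mass R n * eta).

(** The volume is at most a constant times [h F * face_jac F]. The Jacobian turns the squared jump
    at [z] into a face integral, and [h F = h F ^+ 2 / h F] yields both [hmax M ^+ 2] and the weight
    of the stabilization. *)
Lemma jump_energy K z F : K \in elts M -> z \in K -> linked K z F ->
  (2 * h K) ^+ n.+1 * sjump F (vtx z) ^+ 2 <= term_cst * hmax M ^+ 2 * face_energy F.
Proof.
move=> hK zK lF; have /and3P[hF zF _] := lF.
have [cF [K1 h1 F1]] := (facesP F).1 hF.
have hFp := h_face_gt0 mM d1 h1 F1 cF.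
have mp := ref_mass_gt0 R n.
have [g [c H]] := sjump_affine hF.
have J := affine_face_int cF g c zF.
rewrite -H in J.
have {}J : sjump F (vtx z) ^+ 2 * (ref_mass R n * face_jac F) <=
    face_int F (fun x => sjump F x ^+ 2).
  apply: le_trans J _; apply: eq_implies_le.
  by congr (_ * _); apply: eq_Rintegral => y _; rewrite H.
have step1 : (2 * h K) ^+ n.+1 <= (2 * gam ^+ N.+1) ^+ n.+1 * (h F * (jac_cst * face_jac F)).
  apply: (@le_trans _ _ ((2 * gam ^+ N.+1 * h F) ^+ n.+1)).
    rewrite lerXn2r ?nnegrE ?mulr_ge0 ?diam_ge0 ?exprn_ge0 ?(ltW g0)// -mulrA.
    by rewrite ler_pM2l//; exact: (linked_h hK zK lF).
  rewrite exprMn [h F ^+ _]exprS; apply: ler_wpM2l.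
    by rewrite exprn_ge0// mulr_ge0// exprn_ge0// ltW.
  by rewrite ler_pM2l// h_le_jac.
have A0 : 0 <= (2 * gam ^+ N.+1) ^+ n.+1 * jac_cst.
  by rewrite !mulr_ge0// ?exprn_ge0// ?mulr_ge0// ?exprn_ge0// ltW.
apply: (@le_trans _ _ ((2 * gam ^+ N.+1) ^+ n.+1 * jac_cst / ref_mass R n * h F *
   face_int F (fun x => sjump F x ^+ 2))).
  apply: le_trans (ler_wpM2r (sqr_ge0 _) step1) _.
  have -> : (2 * gam ^+ N.+1) ^+ n.+1 * (h F * (jac_cst * face_jac F)) * sjump F (vtx z) ^+ 2 =
    (2 * gam ^+ N.+1) ^+ n.+1 * jac_cst / ref_mass R n * h F *
      (sjump F (vtx z) ^+ 2 * (ref_mass R n * face_jac F)).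
    move: ((2 * gam ^+ N.+1) ^+ n.+1) (sjump F (vtx z)) => a b.
    by field; rewrite gt_eqF.
  by apply: (ler_wpM2l _ J); rewrite mulr_ge0 ?(ltW hFp)// divr_ge0 ?(ltW mp).
rewrite face_energyE// /term_cst.
have -> : (2 * gam ^+ N.+1) ^+ n.+1 * jac_cst / (ref_mass R n * eta) * hmax M ^+ 2 *
   (eta / h F * face_int F (fun x => sjump F x ^+ 2)) =
   (2 * gam ^+ N.+1) ^+ n.+1 * jac_cst / ref_mass R n * (hmax M ^+ 2 / h F) *
   face_int F (fun x => sjump F x ^+ 2).
  move: ((2 * gam ^+ N.+1) ^+ n.+1) (face_int _ _) => a b.
  by field; rewrite !gt_eqF.
have fi0 : 0 <= face_int F (fun x => sjump F x ^+ 2).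
  by apply: (face_int_ge0 cF) => x _; exact: sqr_ge0.
rewrite ler_wpM2r// ler_wpM2l ?divr_ge0 ?(ltW mp)//.
rewrite ler_pdivlMr// -expr2 lerXn2r ?nnegrE ?diam_ge0 ?hmax_ge0//.
exact: le_trans (face_le_h d1 h1 F1 cF) (hmax_ge h1).
Qed.

(** Multiplicity of one face in the sum: an element is a neighbour of at most [n.+2 * N] others,
    whose volumes are adjusted by [gam ^+ n.+1], and each of the [n.+1] vertices of the face belongs
    to at most [N] elements. *)
Definition count_cst : R := (n.+2 * N)%:R * gam ^+ n.+1 * (N%:R * n.+1%:R).

Lemma sum_nbr_jumps : \sum_(K in elts M) (2 * h K) ^+ n.+1 * nbr_jumps K <=
  count_cst * (term_cst * hmax M ^+ 2) * \sum_(F in faces M) face_energy F.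
Proof.
pose G K := (2 * h K) ^+ n.+1 * \sum_(z in K) jumps K z.
have G0 K : 0 <= G K.
  rewrite mulr_ge0 ?exprn_ge0 ?mulr_ge0 ?diam_ge0// sumr_ge0// => z _.
  exact: jumps_ge0.
have step1 : \sum_(K in elts M) (2 * h K) ^+ n.+1 * nbr_jumps K <=
    (n.+2 * N)%:R * gam ^+ n.+1 * \sum_(K in elts M) G K.
  apply: (@le_trans _ _ (\sum_(K in elts M) \sum_(K' in nbr K) gam ^+ n.+1 * G K')).
    apply: ler_sum => K hK; rewrite /nbr_jumps mulr_sumr; apply: ler_sum => K' nK'.
    rewrite /G mulrA ler_wpM2r//; first by apply: sumr_ge0 => z _; exact: jumps_ge0.
    rewrite -exprMn lerXn2r ?nnegrE ?mulr_ge0 ?diam_ge0 ?(ltW g0)//.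
    by rewrite mulrCA ler_pM2l// nbr_h.
  rewrite (exchange_big_dep (mem (elts M))) /=; last first.
    by move=> K K' _; rewrite inE => /andP[].
  rewrite mulr_sumr; apply: ler_sum => K' hK'.
  (* Symmetry of [nbr] turns the elements having [K'] as a neighbour into the neighbours of [K']. *)
  apply: (@le_trans _ _ (\sum_(K in nbr K') gam ^+ n.+1 * G K')).
    rewrite big_mkcond [leRHS]big_mkcond; apply: ler_sum => K _.
    case: ifPn => [/andP[hK nK]|_]; first by rewrite (nbr_sym hK nK).
    by case: ifP => // _; rewrite mulr_ge0 ?exprn_ge0// ltW.
  rewrite sumr_const -[leLHS]mulr_natl -[leRHS]mulrA; apply: ler_wpM2r.
    by apply: mulr_ge0 => //; rewrite exprn_ge0// ltW.
  by rewrite ler_nat (nbr_card hK').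
have t0 : 0 <= term_cst.
  apply: divr_ge0; last by rewrite mulr_ge0 ?(ltW (ref_mass_gt0 R n)) ?(ltW eta0).
  have gp k : 0 <= gam ^+ k by rewrite exprn_ge0// ltW.
  by apply: mulr_ge0; [rewrite exprn_ge0// mulr_ge0|rewrite mulr_ge0].
have c0 F : 0 <= term_cst * hmax M ^+ 2 * face_energy F.
  by rewrite mulr_ge0 ?face_energy_ge0// mulr_ge0 ?sqr_ge0.
have step2 : \sum_(K in elts M) G K <= (N%:R * n.+1%:R) *
    (term_cst * hmax M ^+ 2 * \sum_(F in faces M) face_energy F).
  apply: (@le_trans _ _ (\sum_(K in elts M) \sum_(z in K)
      \sum_(F in faces M | z \in F) term_cst * hmax M ^+ 2 * face_energy F)).
    apply: ler_sum => K hK; rewrite /G mulr_sumr; apply: ler_sum => z zK.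
    rewrite /jumps mulr_sumr.
    rewrite big_mkcond [leRHS]big_mkcond; apply: ler_sum => F _.
    case: ifPn => [lF|_]; last by case: ifP.
    have /and3P[hF zF _] := lF; rewrite hF zF /=.
    exact: jump_energy.
  rewrite (exchange_big_dep predT)//=.
  rewrite mulr_sumr mulr_sumr.
  apply: (@le_trans _ _ (\sum_z N%:R * \sum_(F in faces M | z \in F)
      term_cst * hmax M ^+ 2 * face_energy F)).
    apply: ler_sum => z _.
    rewrite (eq_bigl (mem (star z))); last by move=> K; rewrite [RHS]inE.
    rewrite sumr_const -[leLHS]mulr_natl; apply: ler_wpM2r.
      by apply: sumr_ge0 => F _; exact: c0.
    by rewrite ler_nat (star_le mM d1 gam1 shape).
  rewrite -mulr_sumr (exchange_big_dep (mem (faces M))) /=; last by move=> z F _ /andP[].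
  rewrite mulr_sumr; apply: ler_sum => F hF; have [cF _] := (facesP F).1 hF.
  rewrite (eq_bigl (mem F)); last by move=> z; rewrite hF.
  rewrite sumr_const cF; move: (term_cst * _ * _) => X.
  by rewrite -[X *+ _]mulr_natl mulrA.
rewrite /count_cst; apply: le_trans step1 _.
rewrite -!mulrA in step2 *; rewrite ler_wpM2l// ler_wpM2l ?exprn_ge0 ?(ltW g0)//.
Qed.

(** [hat] is defined by a pointwise choice. On each element it equals the affine function [lam], so
    on [Omega] the smoother is assembled from the continuous functions [loc K]. *)
Lemma sE1_L2 : L2 Omega sE1.
Proof.
pose loc K x := \sum_z lam K z x * snode z +
  \sum_(F in faces M | int_face Omega F) (\prod_(z in F) lam K z x) * scoef F.
have cloc K : continuous (loc K).
  apply: continuous_rowD; apply: continuous_row_sum => t; (apply: continuous_rowM; last exact: cst_continuous).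
    exact: continuous_lam.
  by apply: continuous_row_prod => z; exact: continuous_lam.
apply: (@L2_eq _ _ _ (assemble (loc : efun M R))); last first.
  apply: (assemble_L2 mM oOmega) => K hK; have [B B0 KB] := simplex_sub_cube K.
  have [C HC] := continuous_bounded_cube B0 (cloc K).
  apply: (L2_bounded (measurable_elt mM hK) (M := C)).
  - exact: (leb_sub_cube_lty (measurable_elt mM hK) B0 KB).
  - by apply: measurable_funTS; exact: continuous_row_measurable.
  - by move=> x /KB; exact: HC.
move=> x xO; have [K E] := elt_at_ex mM (subset_closure xO).
have [hK xK] := elt_at_some E; rewrite assembleE E /loc /sE1 (sA1E hK xK).
congr (_ + _); apply: eq_bigr => F _; congr (_ * _).
by apply: eq_bigr => z _; rewrite (hatE mM _ hK xK).
Qed.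

Lemma sg_L2 : L2 Omega (assemble (sg : efun M R)).
Proof.
apply: (assemble_L2 mM oOmega) => K hK.
apply: (@L2_eq _ _ _ (fun x => dot x (gs K) + cs K)); first by move=> x _; rewrite sgE.
exact: (affine_simplex_L2 mM (gs K) (cs K) hK).
Qed.

Definition smoother_cst : R := est_cst ^+ 2 * nsum_cst * (count_cst * term_cst).

(** The bound of [sE1_sqr_le] is constant on each element, so the integrand is dominated by
    multiples of indicators of closed elements. Points shared by several elements are counted
    repeatedly, which an upper bound allows. *)
Lemma smoother_L2_le : \int[leb R n.+1]_(x in Omega) (sE1 x - assemble (sg : efun M R) x) ^+ 2 <=
  smoother_cst * hmax M ^+ 2 * \sum_(F in faces M) face_energy F.
Proof.
have mO := open_row_measurable oOmega.
pose c K := est_cst ^+ 2 * nsum_cst * nbr_jumps K.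
have e0 : 0 <= est_cst ^+ 2 * nsum_cst.
  by rewrite mulr_ge0 ?sqr_ge0// !mulr_ge0// exprn_ge0.
have c0 K : 0 <= c K.
  by rewrite mulr_ge0//; do 2 !apply: sumr_ge0 => ? _; exact: jumps_ge0.
have Ldiff : L2 Omega (fun x => sE1 x + -1 * assemble (sg : efun M R) x).
  by apply: L2D => //; [exact: sE1_L2|apply: L2Z => //; exact: sg_L2].
have Idiff := L2_sqr_integrable Ldiff.
have Ie : (leb R n.+1).-integrable Omega
    (EFin \o (fun x => (sE1 x - assemble (sg : efun M R) x) ^+ 2)).
  by apply: eq_integrable Idiff => // x _; rewrite /= mulN1r.
apply: (@le_trans _ _ (\sum_(K in elts M) (2 * h K) ^+ n.+1 * c K)).
  rewrite -lee_fin /Rintegral fineK; last exact: integrable_fin_num.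
  pose phi K : E -> \bar R :=
    if K \in elts M then EFin \o (fun x => c K * \1_(simplex K) x) else cst 0%E.
  have phi0 K x : (0 <= phi K x)%E.
    by rewrite /phi; case: ifP => // _; rewrite lee_fin mulr_ge0// indicE.
  have mphi K : measurable_fun Omega (phi K).
    rewrite /phi; case: ifPn => hK; last exact: measurable_cst.
    apply/measurable_EFinP; apply: measurable_funTS.
    apply: measurable_funM; first exact: measurable_cst.
    exact: measurable_indic (measurable_elt mM hK).
  apply: (@le_trans _ _ (\int[leb R n.+1]_(x in Omega) \sum_K phi K x)%E).
    apply: ge0_le_integral => //.
    - by move=> x _; rewrite lee_fin sqr_ge0.
    - exact: measurable_int Ie.
    - exact: emeasurable_sum.
    - move=> x xO; have [K E] := elt_at_ex mM (subset_closure xO).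
      have [hK xK] := elt_at_some E; rewrite assembleE E.
      rewrite (bigD1 K)//= -[leLHS]adde0; apply: leeD; last exact: sume_ge0.
      rewrite /phi hK /= lee_fin indicE mem_set// mulr1.
      exact: (sE1_sqr_le hK xK).
  rewrite ge0_integral_sum// -sumEFin [leRHS]big_mkcond /=; apply: lee_sum => K _.
  rewrite /phi; case: ifPn => hK; last by rewrite integral0.
  have mK := measurable_elt mM hK.
  under eq_integral do rewrite /= (EFinM (c K)).
  rewrite ge0_integralZl//; last 2 first.
  - by apply/measurable_EFinP; apply: measurable_funTS; exact: measurable_indic.
  - by rewrite lee_fin.
  rewrite integral_indic// mulrC (EFinM (c K)); apply: lee_wpmul2l; first by rewrite lee_fin.
  apply: le_trans (elt_volume hK); apply: le_measure; rewrite ?inE//.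
  exact: measurableI.
rewrite /c; under eq_bigr do rewrite mulrCA.
rewrite -mulr_sumr; apply: le_trans (ler_wpM2l e0 sum_nbr_jumps) _.
by rewrite /smoother_cst !mulrA.
Qed.

End Smoother.

Lemma Rintegral_sum (R : realType) (n : nat) (D : set 'rV[R]_n) (I : Type) (s : seq I)
    (f : I -> 'rV[R]_n -> R) : measurable D ->
  (forall i, (leb R n).-integrable D (EFin \o f i)) ->
  \int[leb R n]_(x in D) (\sum_(i <- s) f i x) =
  \sum_(i <- s) \int[leb R n]_(x in D) f i x.
Proof.
move=> mD If; elim: s => [|i s IH].
  rewrite big_nil; under eq_Rintegral do rewrite big_nil.
  by rewrite Rintegral_cst// mul0r.
rewrite big_cons -IH -RintegralD//; last exact: Rint_sum.
by apply: eq_Rintegral => x _; rewrite big_cons.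
Qed.

Section VectorL2.
Context (R : realType) (d : nat) (Omega : set 'rV[R]_d) (mO : measurable Omega).
Implicit Types f g : 'rV[R]_d -> 'rV[R]_d.

Lemma L2v_dot_integrable f g : L2v Omega f -> L2v Omega g ->
  (leb R d).-integrable Omega (EFin \o (fun x => dot (f x) (g x))).
Proof.
move=> Lf Lg; apply: Rint_sum => // i.
exact: L2_mul_integrable.
Qed.

Lemma L2v_lin a f g : L2v Omega f -> L2v Omega g -> L2v Omega (fun x => a *: f x + g x).
Proof.
move=> Lf Lg i; apply: (@L2_eq _ _ _ (fun x => a * f x 0 i + g x 0 i)).
  by move=> x _; rewrite !mxE.
by apply: L2D => //; exact: L2Z.
Qed.

Lemma L2v_cauchy f g : L2v Omega f -> L2v Omega g ->
  (\int[leb R d]_(x in Omega) dot (f x) (g x)) ^+ 2 <=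
  (\int[leb R d]_(x in Omega) dot (f x) (f x)) * (\int[leb R d]_(x in Omega) dot (g x) (g x)).
Proof.
move=> Lf Lg; apply: quad_nonneg_disc; first by apply: Rintegral_ge0 => x _; exact: dotxx_ge0.
move=> t; have Lh := L2v_lin t Lg Lf.
have : 0 <= \int[leb R d]_(x in Omega) dot (t *: g x + f x) (t *: g x + f x).
  by apply: Rintegral_ge0 => x _; exact: dotxx_ge0.
have -> : \int[leb R d]_(x in Omega) dot (t *: g x + f x) (t *: g x + f x) =
    \int[leb R d]_(x in Omega) (t * dot (g x) (t *: g x + f x) + dot (f x) (t *: g x + f x)).
  by apply: eq_Rintegral => x _; rewrite dotDl dotZl.
have lin u : L2v Omega u -> \int[leb R d]_(x in Omega) dot (u x) (t *: g x + f x) =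
    t * \int[leb R d]_(x in Omega) dot (u x) (g x) + \int[leb R d]_(x in Omega) dot (u x) (f x).
  move=> Lu; rewrite -RintegralZD//; try exact: L2v_dot_integrable.
  by apply: eq_Rintegral => x _; rewrite dotDr dotZr.
rewrite RintegralZD//; try exact: L2v_dot_integrable.
rewrite !lin// => h; apply: le_trans h _; apply: eq_implies_le.
have -> : \int[leb R d]_(x in Omega) dot (g x) (f x) = \int[leb R d]_(x in Omega) dot (f x) (g x).
  by apply: eq_Rintegral => x _; rewrite dotC.
ring.
Qed.
End VectorL2.

Lemma smoother_cst_ge0 (R : realType) (n : nat) (gam eta : R) : 1 <= gam -> 0 < eta ->
  0 <= smoother_cst n gam eta.
Proof.
move=> gam1 eta0; have g0 := le_trans ler01 gam1.
have m0 := ltW (ref_mass_gt0 R n); have e0 := ltW eta0.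
rewrite /smoother_cst /nsum_cst /count_cst /term_cst.
apply: mulr_ge0; first by rewrite mulr_ge0 ?sqr_ge0// mulr_ge0// mulr_ge0// exprn_ge0.
have j0 : 0 <= jac_cst n gam by rewrite mulr_ge0// exprn_ge0.
have t0 : 0 <= (2 * gam ^+ (star_bound n.+1 gam).+1) ^+ n.+1 by rewrite exprn_ge0// mulr_ge0// exprn_ge0.
apply: mulr_ge0; last by rewrite divr_ge0// mulr_ge0.
by rewrite mulr_ge0// mulr_ge0// exprn_ge0.
Qed.

(** * Vector fields: the smoother estimate, the corrector and shifted errors *)

Section VectorSmoother.
Context (R : realType) (n : nat) (Omega : set 'rV[R]_n.+1) (M : mesh R n.+1).
Local Notation E := 'rV[R]_n.+1.
Local Notation I := 'I_(nvert M).
Local Notation S := (@ref_simplex R n.+1 : set 'rV[R]_n).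
Let mS : measurable S := @measurable_ref_simplex R n.
Implicit Types (K F : {set I}) (z : I) (x : E) (y : 'rV[R]_n).
Implicit Types (s t : efun M E).
Hypothesis mM : is_mesh Omega M.
Hypothesis n0 : (0 < n)%N.
Hypothesis oOmega : open Omega.
Hypothesis lipOmega : lipschitz_boundary Omega.
Variable Kz : I -> {set I}.
Hypothesis hKz : forall z, ~ bdry Omega (vtx z) -> Kz z \in elts M /\ z \in Kz z.

Definition component s (i : 'I_n.+1) : {set I} -> E -> R := fun K x => s K x 0 i.

Definition component_grad s (i : 'I_n.+1) K : E :=
  xget 0 [set g | exists c, forall x, s K x 0 i = dot x g + c].

Definition component_cst s (i : 'I_n.+1) K : R := s K 0 0 i.

Lemma componentE s i K : S01 s -> K \in elts M ->
  forall x, component s i K x = dot x (component_grad s i K) + component_cst s i K.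
Proof.
move=> Ss hK; have [g [c H]] := S01_affine Ss hK.
have [c' H'] : exists c, forall x, s K x 0 i = dot x (component_grad s i K) + c.
  apply: (@xgetPex _ 0 [set g | exists c, forall x, s K x 0 i = dot x g + c]).
  by exists (g i), (c i).
move=> x; rewrite /component /component_cst !H'; congr (_ + _).
by rewrite dot0l add0r.
Qed.

Definition sadd a s t : efun M E := fun K x => a *: s K x + t K x.

Lemma S01_sadd a s t : S01 s -> S01 t -> S01 (sadd a s t).
Proof.
move=> Ss St K hK; have [A [b H]] := Ss K hK; have [A' [b' H']] := St K hK.
exists (a *: A + A'), (a *: b + b') => x.
by rewrite /sadd H H' mulmxDr -scalemxAr scalerDr addrACA.
Qed.

Lemma E1_comp s x i : E1 Omega Kz s x 0 i = sE1 Omega Kz (component s i) x.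
Proof.
have A1E (y : E) : A1 Omega Kz s y 0 i = sA1 Omega Kz (component s i) y.
  by rewrite /A1 summxE; apply: eq_bigr => z _; rewrite mxE.
rewrite /E1 /sE1 mxE A1E; congr (_ + _).
rewrite /B1 summxE; apply: eq_bigr => F /andP[_ iF]; rewrite !mxE.
congr (_ * (_ / _)); congr (_ * _); apply: eq_Rintegral => y _.
by rewrite /avg iF !mxE !A1E.
Qed.

Lemma E1_L2v s : S01 s -> L2v Omega (E1 Omega Kz s).
Proof.
move=> Ss i; apply: (@L2_eq _ _ _ (sE1 Omega Kz (component s i))).
  by move=> x _; rewrite E1_comp.
exact: (sE1_L2 mM oOmega).
Qed.

Lemma assemble_comp s x i : assemble s x 0 i = assemble (component s i : efun M R) x.
Proof. by rewrite !assembleE; case: elt_at => // ; rewrite mxE. Qed.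

Lemma assemble_L2v s : S01 s -> L2v Omega (assemble s).
Proof.
move=> Ss i; apply: (@L2_eq _ _ _ (assemble (component s i : efun M R))).
  by move=> x _; rewrite assemble_comp.
exact: (sg_L2 mM oOmega (fun K hK x => componentE i Ss hK x)).
Qed.

Lemma smoother_defect_comp s x i : (-1 *: assemble s x + E1 Omega Kz s x) 0 i =
  sE1 Omega Kz (component s i) x - assemble (component s i : efun M R) x.
Proof. by rewrite [LHS]mxE [X in X + _]mxE E1_comp assemble_comp mulN1r addrC. Qed.

Lemma sE1_add a s t i x : S01 s -> S01 t -> sE1 Omega Kz (component (sadd a s t) i) x =
  a * sE1 Omega Kz (component s i) x + sE1 Omega Kz (component t i) x.
Proof.
move=> Ss St.
have A1E (y : E) : sA1 Omega Kz (component (sadd a s t) i) y =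
    a * sA1 Omega Kz (component s i) y + sA1 Omega Kz (component t i) y.
  rewrite /sA1 mulr_sumr -big_split; apply: eq_bigr => z _ /=.
  by rewrite /component /sadd !mxE; ring.
rewrite /sE1 A1E mulrDr addrACA; congr (_ + _).
rewrite mulr_sumr -big_split; apply: eq_bigr => F /andP[hF iF] /=.
rewrite (mulrCA a) -(mulrDr (bubble F x)); congr (_ * _).
rewrite /scoef mulrA -mulrDl; congr (_ / _).
rewrite /face_int mulrCA -mulrDr; congr (_ * _).
rewrite -RintegralZD//.
- apply: eq_Rintegral => y _; rewrite /savg !A1E /component /sadd !mxE; ring.
- exact: (savg_integrable mM oOmega Kz (fun K hK x => componentE i Ss hK x) hF iF).
- exact: (savg_integrable mM oOmega Kz (fun K hK x => componentE i St hK x) hF iF).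
Qed.

Lemma E1_add a s t x : S01 s -> S01 t ->
  E1 Omega Kz (sadd a s t) x = a *: E1 Omega Kz s x + E1 Omega Kz t x.
Proof. by move=> Ss St; apply/rowP => i; rewrite E1_comp sE1_add// -!E1_comp [RHS]mxE [in RHS]mxE. Qed.

Lemma assemble_add a s t x : assemble (sadd a s t) x = a *: assemble s x + assemble t x.
Proof. by rewrite !assembleE; case: elt_at => //; rewrite scaler0 addr0. Qed.

Lemma jump_add a s t F x : jump Omega (sadd a s t) F x = a *: jump Omega s F x + jump Omega t F x.
Proof. by rewrite /jump; case: ifP => // _; rewrite /sadd scalerBr opprD addrACA. Qed.

Lemma jump_integrable s F i : S01 s -> F \in faces M ->
  (leb R n).-integrable S (EFin \o (fun y => jump Omega s F (face_param F y) 0 i)).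
Proof.
move=> Ss hF; apply: (L2_integrable mS (ref_simplex_lty R n)).
exact: (tjump_L2 mM oOmega i (affine_form_field mM Ss) hF).
Qed.

Lemma CR_sadd a s t : CR Omega s -> CR Omega t -> CR Omega (sadd a s t).
Proof.
move=> [Ss Js] [St Jt]; split; first exact: S01_sadd.
move=> F hF i; have := Js F hF i; have := Jt F hF i; rewrite /face_int => ht hs.
have -> : \int[leb R n]_(y in S) jump Omega (sadd a s t) F (face_param F y) 0 i =
    a * \int[leb R n]_(y in S) jump Omega s F (face_param F y) 0 i +
    \int[leb R n]_(y in S) jump Omega t F (face_param F y) 0 i.
  rewrite -RintegralZD//; try exact: jump_integrable.
  by apply: eq_Rintegral => y _; rewrite jump_add !mxE.
by rewrite mulrDr mulrCA hs ht mulr0 addr0.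
Qed.

Lemma of_affine_grad s (K : {set I}) (x : E) i j : S01 s -> K \in elts M ->
  eD (of_affine s) K x i j = component_grad s i K 0 j.
Proof.
move=> Ss hK; rewrite mxE.
have -> : (fun y : E => s K y 0 i) = fun y : E => dot y (component_grad s i K) + component_cst s i K.
  by apply/funext => y; exact: componentE.
by have [] := partial_affine (component_grad s i K) (component_cst s i K) j x.
Qed.

Lemma of_affine_add a s t (K : {set I}) (x : E) : S01 s -> S01 t -> K \in elts M ->
  eD (of_affine (sadd a s t)) K x = a *: eD (of_affine s) K x + eD (of_affine t) K x.
Proof.
move=> Ss St hK; apply/matrixP => i j; rewrite [RHS]mxE [X in _ = X + _]mxE.
rewrite (of_affine_grad x i j Ss hK) (of_affine_grad x i j St hK) [LHS]mxE.
have -> : (fun y : E => sadd a s t K y 0 i) = fun y : E =>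
    dot y (a *: component_grad s i K + component_grad t i K) + (a * component_cst s i K + component_cst t i K).
  apply/funext => y; rewrite /sadd !mxE -/(component s i K y) -/(component t i K y) !componentE//.
  by rewrite dotDr dotZr; ring.
by have [-> _] := partial_affine (a *: component_grad s i K + component_grad t i K)
  (a * component_cst s i K + component_cst t i K) j x; rewrite !mxE.
Qed.

Variables (mu lambda eta : R).

Lemma a_form_sadd a s t (v : efield M) : S01 s -> S01 t -> form_field v ->
  a_form Omega mu lambda eta (of_affine (sadd a s t)) v =
  a * a_form Omega mu lambda eta (of_affine s) v + a_form Omega mu lambda eta (of_affine t) v.
Proof.
move=> Ss St gv; rewrite -(a_form_add mM oOmega)//; try exact: (affine_form_field mM).
apply: (a_form_ext mM oOmega) => [K hK x|F K hF hK FK x]; [exact: of_affine_add|by []].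
Qed.

(** Equality on elements only. It lets an arbitrary [S01] family be replaced by one with finitely
    many coefficients without changing [CR], [E1], [assemble] or the form. *)
Definition agree s t := forall K, K \in elts M -> s K = t K.

Lemma agree_face0 s t F : agree s t -> F \in faces M -> s (face_elt F 0) = t (face_elt F 0).
Proof. by move=> st hF; rewrite st//; have [] := face_elt0 hF. Qed.

Lemma agree_face1 s t F : agree s t -> F \in faces M -> int_face Omega F ->
  s (face_elt F 1) = t (face_elt F 1).
Proof. by move=> st hF iF; rewrite st//; have [] := face_elt1 mM isT oOmega hF iF. Qed.

Lemma agree_CR s t : agree s t -> CR Omega s -> CR Omega t.
Proof.
move=> st [Ss Js]; split=> [K hK|F hF i]; first by rewrite -st//; exact: Ss.
rewrite -[RHS](Js F hF i); congr (_ * _); apply: eq_Rintegral => y _.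
rewrite /jump (agree_face0 st hF); case: (boolP (int_face Omega F)) => // iF.
by rewrite (agree_face1 st hF iF).
Qed.

Lemma agree_assemble s t : agree s t -> assemble s = assemble t.
Proof.
move=> st; apply/funext => x; rewrite !assembleE.
by case E: elt_at => [K|//]; rewrite st//; have [] := elt_at_some E.
Qed.

Lemma agree_E1 s t : agree s t -> E1 Omega Kz s = E1 Omega Kz t.
Proof.
move=> st.
have A1E : A1 Omega Kz s = A1 Omega Kz t.
  apply/funext => x; apply: eq_bigr => z /asboolP bz; rewrite st//.
  by have [] := hKz bz.
apply/funext => x; rewrite /E1 A1E; congr (_ + _).
apply: eq_bigr => F /andP[hF iF]; congr (_ *: _); apply/rowP => i; rewrite [LHS]mxE [RHS]mxE.
congr (_ * _ / _); apply: eq_Rintegral => y _.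
by rewrite /avg iF (agree_face0 st hF) (agree_face1 st hF iF).
Qed.

Lemma agree_a_form s t (v : efield M) : agree s t ->
  a_form Omega mu lambda eta (of_affine s) v = a_form Omega mu lambda eta (of_affine t) v.
Proof.
move=> st; apply: (a_form_ext mM oOmega) => [K hK x|F K hF hK FK x] /=.
  by apply/matrixP => i j; rewrite !mxE st.
by rewrite st.
Qed.

(** The finite-dimensional space for [psd_riesz]. The [S01] families themselves are unrestricted at
    index sets that are not elements. *)
Definition affine_coeff := {ffun {set I} -> 'M[R]_n.+1 * E}.

Definition of_coeff (c : affine_coeff) : efun M E :=
  fun K x => x *m (c K).1 + (c K).2.

Lemma of_coeff_S01 c : S01 (of_coeff c).
Proof. by move=> K _; exists (c K).1, (c K).2. Qed.

Lemma of_coeff_add a c c' : of_coeff (a *: c + c') = sadd a (of_coeff c) (of_coeff c').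
Proof.
apply/funext => K; apply/funext => x; rewrite /of_coeff /sadd !ffunE /=.
by rewrite mulmxDr -scalemxAr scalerDr addrACA.
Qed.

Lemma of_coeff0 K x : of_coeff 0 K x = 0.
Proof. by rewrite /of_coeff ffunE /= mulmx0 addr0. Qed.

Lemma of_coeff_ex s : S01 s -> exists c, agree s (of_coeff c).
Proof.
move=> Ss; exists [ffun K => xget 0 [set p : 'M[R]_n.+1 * E |
   forall x, s K x = x *m p.1 + p.2]].
move=> K hK; have [A [b H]] := Ss K hK.
apply/funext => x; rewrite /of_coeff ffunE.
move: x; apply: (@xgetPex _ 0 [set p : 'M[R]_n.+1 * E |
   forall x, s K x = x *m p.1 + p.2]).
by exists (A, b).
Qed.

Definition smoother_defect s x : E := -1 *: assemble s x + E1 Omega Kz s x.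

Lemma smoother_defect_L2v s : S01 s -> L2v Omega (smoother_defect s).
Proof.
move=> Ss; apply: L2v_lin; first exact: open_row_measurable.
  exact: assemble_L2v.
exact: E1_L2v.
Qed.

Lemma smoother_defect_add a s t x : S01 s -> S01 t ->
  smoother_defect (sadd a s t) x = a *: smoother_defect s x + smoother_defect t x.
Proof.
move=> Ss St; rewrite /smoother_defect assemble_add E1_add//.
by rewrite !scalerDr !scalerA mulrC addrACA.
Qed.

Section Estimate.
Variable gam : R.
Hypothesis gam1 : 1 <= gam.
Hypothesis shape : shape_coef M <= gam.
Hypotheses (mu0 : 0 <= mu) (lambda0 : 0 <= lambda) (eta0 : 0 < eta).

Lemma face_form_comp s F : S01 s -> F \in faces M ->
  face_form Omega eta (of_affine s) (of_affine s) F =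
  \sum_i face_energy Omega (component s i) eta F.
Proof.
move=> Ss hF; rewrite /face_form /face_energy /face_int -mulr_sumr; congr (_ * _).
rewrite -Rintegral_sum//.
  apply: eq_Rintegral => y _; rewrite /dot mulr_sumr; apply: eq_bigr => i _.
  rewrite -expr2 /tjump /jump /sjump; congr (_ * _ ^+ 2).
  by case: ifP => _; rewrite ?mxE.
move=> i; apply: RintZ => //; apply: L2_sqr_integrable.
apply: (@L2_eq _ _ _ (fun y => tjump Omega (of_affine s) F (face_param F y) 0 i)).
  by move=> y _; rewrite /tjump /jump /sjump; case: ifP => _; rewrite ?mxE.
exact: (tjump_L2 mM oOmega i (affine_form_field mM Ss) hF).
Qed.

(** [smoother_L2_le] summed over the components; the volume part of the form is nonnegative, so the
    stabilization is at most the whole form. *)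
Lemma smoother_le s : S01 s ->
  \int[leb R n.+1]_(x in Omega) dot (-1 *: assemble s x + E1 Omega Kz s x)
     (-1 *: assemble s x + E1 Omega Kz s x) <=
  smoother_cst n gam eta * hmax M ^+ 2 *
    a_form Omega mu lambda eta (of_affine s) (of_affine s).
Proof.
move=> Ss; have mO := open_row_measurable oOmega.
have c0 : 0 <= smoother_cst n gam eta * hmax M ^+ 2 by rewrite mulr_ge0 ?sqr_ge0// smoother_cst_ge0.
apply: (@le_trans _ _ (smoother_cst n gam eta * hmax M ^+ 2 *
   \sum_(F in faces M) face_form Omega eta (of_affine s) (of_affine s) F)); last first.
  by apply: ler_wpM2l => //; exact: face_form_le.
rewrite (eq_bigr _ (fun F hF => face_form_comp Ss hF)) exchange_big mulr_sumr /=.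
apply: (@le_trans _ _ (\sum_i \int[leb R n.+1]_(x in Omega)
    (sE1 Omega Kz (component s i) x - assemble (component s i : efun M R) x) ^+ 2)).
  rewrite -Rintegral_sum//.
    apply: eq_implies_le; apply: eq_Rintegral => x _.
    by apply: eq_bigr => i _; rewrite smoother_defect_comp expr2.
  move=> i; apply: L2_sqr_integrable.
  have := L2v_lin mO (-1) (assemble_L2v Ss) (E1_L2v Ss) i.
  by apply: L2_eq => x _; exact: smoother_defect_comp.
apply: ler_sum => i _.
exact: (smoother_L2_le mM n0 oOmega lipOmega gam1 shape hKz (fun K hK x => componentE i Ss hK x) eta0).
Qed.

Local Notation aform v w := (a_form Omega mu lambda eta v w).

(* The difference of the two discrete solutions represents the functional
   [s |-> int f . (E_1 s - s)], which the stabilization alone controls; hence no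
   Korn inequality, and no dependence on [lambda]. *)
Lemma corrector_exists f : L2v Omega f ->
  exists W, [/\ CR Omega W,
    forall s, CR Omega s -> aform (of_affine W) (of_affine s) =
      \int[leb R n.+1]_(x in Omega) dot (f x) (E1 Omega Kz s x) -
      \int[leb R n.+1]_(x in Omega) dot (f x) (assemble s x) &
    a_norm Omega mu lambda eta (of_affine W) <=
      Num.sqrt (smoother_cst n gam eta) * (hmax M * L2norm Omega f)].
Proof.
move=> Lf; have mO := open_row_measurable oOmega.
pose P c := CR Omega (of_coeff c).
pose B c c' := aform (of_affine (of_coeff c)) (of_affine (of_coeff c')).
pose l c := \int[leb R n.+1]_(x in Omega) dot (f x) (smoother_defect (of_coeff c) x).
pose C := \int[leb R n.+1]_(x in Omega) dot (f x) (f x) *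
  (smoother_cst n gam eta * hmax M ^+ 2).
have IdE c : (leb R n.+1).-integrable Omega
    (EFin \o (fun x => dot (f x) (smoother_defect (of_coeff c) x))).
  by apply: L2v_dot_integrable => //; exact: smoother_defect_L2v (of_coeff_S01 _).
have I0 : 0 <= \int[leb R n.+1]_(x in Omega) dot (f x) (f x).
  by apply: Rintegral_ge0 => x _; exact: dotxx_ge0.
have cst0 := smoother_cst_ge0 n gam1 eta0.
have affF c := affine_form_field mM (of_coeff_S01 c).
have [|||||||w [Pw Hw]] := @psd_riesz R affine_coeff P B l C.
- split; first exact: of_coeff_S01.
  move=> F hF i; rewrite /face_int.
  under eq_Rintegral do rewrite /jump !of_coeff0 subr0 if_same mxE.
  by rewrite Rintegral_cst ?mul0r ?mulr0//; exact: mS.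
- by move=> a u v Pu Pv; rewrite /P of_coeff_add; exact: CR_sadd.
- move=> a u v w _ _ _; rewrite /B of_coeff_add a_form_sadd//; exact: of_coeff_S01.
- by move=> u v _ _; exact: a_formC.
- by move=> u _; exact: (a_form_ge0 Omega mu0 lambda0 (ltW eta0)).
- move=> a u v _ _; rewrite /l -RintegralZD//; apply: eq_Rintegral => x _.
  rewrite of_coeff_add (smoother_defect_add a x (of_coeff_S01 u) (of_coeff_S01 v)).
  rewrite dotDr; congr (_ + _); exact: dotZr.
- move=> u _; apply: le_trans (L2v_cauchy mO Lf (smoother_defect_L2v (of_coeff_S01 u))) _.
  rewrite -mulrA ler_wpM2l//.
  exact: (smoother_le (of_coeff_S01 u)).
exists (of_coeff w); split => //.
  move=> s Cs; have [c sc] := of_coeff_ex Cs.1.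
  rewrite (agree_E1 sc) (agree_assemble sc) a_formC (agree_a_form _ sc) a_formC.
  have Pc : P c := agree_CR sc Cs.
  rewrite -/(B w c) (Hw c Pc) /l.
  have -> : \int[leb R n.+1]_(x in Omega) dot (f x) (smoother_defect (of_coeff c) x) =
    \int[leb R n.+1]_(x in Omega) (-1 * dot (f x) (assemble (of_coeff c) x) +
       dot (f x) (E1 Omega Kz (of_coeff c) x)).
    by apply: eq_Rintegral => x _; rewrite dotDr dotZr.
  rewrite RintegralZD//.
  - by rewrite mulN1r addrC.
  - by apply: L2v_dot_integrable => //; exact: assemble_L2v (of_coeff_S01 _).
  - by apply: L2v_dot_integrable => //; exact: E1_L2v (of_coeff_S01 _).
have Bw0 : 0 <= B w w := a_form_ge0 Omega mu0 lambda0 (ltW eta0) _.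
(* Testing with the corrector itself: [B w w ^+ 2 <= C * B w w], and one factor is cancelled unless
   it is 0. *)
have Bw : B w w <= C.
  have := L2v_cauchy mO Lf (smoother_defect_L2v (of_coeff_S01 w)).
  rewrite -/(l w) -(Hw w Pw) => h.
  have : B w w ^+ 2 <= C * B w w.
    apply: le_trans h _; rewrite -mulrA ler_wpM2l//.
    exact: (smoother_le (of_coeff_S01 w)).
  have [->|Bn] := eqVneq (B w w) 0.
    by move=> _; rewrite mulr_ge0// mulr_ge0// sqr_ge0.
  by rewrite expr2 ler_pM2r// lt_def Bn.
apply: le_trans (ler_wsqrtr Bw) _.
rewrite /C mulrC (sqrtrM _ (mulr_ge0 cst0 (sqr_ge0 _))) (sqrtrM _ cst0) sqrtr_sqr.
by rewrite ger0_norm ?mulrA//; exact: hmax_ge0.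
Qed.

End Estimate.

Implicit Types (U W : efun M E) (w : efield M) (g : E) (c : R).

Lemma smooth_sub_affine (phi : E -> R) g c : smooth phi ->
  smooth (fun x => phi x - (dot x g + c)).
Proof. by move=> sp k; apply: Cn_sub; [exact: sp|exact: smooth_affine]. Qed.

Lemma partial_sub_affine (phi : E -> R) g c j x : smooth phi ->
  partial j (fun x => phi x - (dot x g + c)) x = partial j phi x - g 0 j.
Proof.
move=> sp; have [_ /(_ j)[dp _]] := sp 1; have [e d] := partial_affine g c j x.
by rewrite -e; exact: deriveB.
Qed.

Lemma L2faceP F (t : E -> R) : F \in faces M ->
  L2face F t <-> L2 S (t \o face_param F).
Proof.
move=> /facesP[cF [K hK FK]]; have jp := face_jac_gt0 mM n0 hK FK cF.
have X0 : (0 <= \int[leb R n]_(y in S) ((t (face_param F y)) ^+ 2)%:E)%E.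
  by apply: integral_ge0 => y _; rewrite lee_fin sqr_ge0.
suff E : (face_inte F (fun x => (t x ^+ 2)%:E) < +oo)%E <->
    (\int[leb R n]_(y in S) ((t (face_param F y)) ^+ 2)%:E < +oo)%E.
  by split=> -[mt ft]; split => //; exact/E.
rewrite /face_inte; move: X0.
case: (\int[leb R n]_(y in S) _)%E => [r| |]//.
  by move=> _; split => _; rewrite ?ltry// -EFinM ltry.
by move=> _; split => //; rewrite gt0_muley ?lte_fin.
Qed.

(** The smooth approximations are shifted by the same affine function, which leaves all differences
    in the limits unchanged. *)
Lemma is_trace_sub_affine K F (v t : E -> R) Dv g c : F \in faces M ->
  is_trace K F v Dv t ->
  is_trace K F (fun x => v x - (dot x g + c)) (fun x => Dv x - g)
    (fun x => t x - (dot x g + c)).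
Proof.
move=> hF [/(L2faceP t hF) Lt [phi [sphi [cv cD] ct]]]; split.
  apply/L2faceP => //; have [cF _] := (facesP F).1 hF.
  apply: (@L2_eq _ _ _ (fun y => t (face_param F y) + -1 * (dot (face_param F y) g + c))).
    by move=> y _; rewrite mulN1r.
  by apply: L2D => //; apply: L2Z => //; apply: continuous_ref_L2; exact: continuous_face_param.
exists (fun k x => phi k x - (dot x g + c)).
have cancel (a b e : R) : a - e - (b - e) = a - b by ring.
split; first by move=> k; exact: smooth_sub_affine.
  split=> [|j].
    by under eq_fun do under eq_integral do rewrite cancel.
  under eq_fun do under eq_integral do rewrite partial_sub_affine// !mxE cancel.
  exact: cD.
by under eq_fun do rewrite /face_inte; under eq_fun do under eq_integral do rewrite cancel.
Qed.

(** From u - U to u - (a W + U), together with gradients and traces, as [best_const] demands of an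
    error field. *)
Lemma error_field_sadd a W U u w : S01 W -> error_field u U w ->
  error_field u (sadd a W U) (field_add (- a) (of_affine W) w).
Proof.
move=> SW [Hw Ew]; split; last first.
  by move=> K hK x xK; rewrite /= Ew// /sadd opprD scaleNr addrCA.
move=> K hK i; have [H1w Tw] := Hw K hK i.
pose g := a *: component_grad W i K; pose c := a * component_cst W i K.
have valE (f : E -> E) :
    (fun x => (- a *: W K x + f x) 0 i) = fun x => f x 0 i - (dot x g + c).
  apply/funext => x; rewrite !mxE -/(component W i K x) componentE// /g /c dotZr; ring.
have gradE : (fun x => row i (eD (field_add (- a) (of_affine W) w) K x)) =
    fun x => row i (eD w K x) - g.
  apply/funext => x; apply/rowP => j.
  rewrite mxE [LHS]mxE [X in X + _]mxE of_affine_grad// /g !mxE; ring.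
have evE : (fun x => ev (field_add (- a) (of_affine W) w) K x 0 i) =
    fun x => ev w K x 0 i - (dot x g + c) by exact: valE.
rewrite evE gradE; split.
  have [N N0 KN] := simplex_sub_cube K.
  exact: (H1_sub_affine g c (measurable_elt mM hK) N0 KN H1w).
move=> F hF FK.
have -> : (fun x => etr (field_add (- a) (of_affine W) w) K F x 0 i) =
    fun x => etr w K F x 0 i - (dot x g + c) by exact: valE.
exact: is_trace_sub_affine (Tw F hF FK).
Qed.

(** Triangle inequality for [w = a W + (w - a W)]. This identity is only needed for gradients and
    traces, so [a_form_ext] applies. *)
Lemma a_norm_transfer a W w : 0 <= mu -> 0 <= lambda -> 0 <= eta -> S01 W -> eH1 w ->
  a_norm Omega mu lambda eta w <=
  `|a| * a_norm Omega mu lambda eta (of_affine W) +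
  a_norm Omega mu lambda eta (field_add (- a) (of_affine W) w).
Proof.
move=> mu0 lambda0 eta0 SW Hw.
have gW := affine_form_field mM SW; have gw := eH1_form_field mM n0 Hw.
have gd := form_field_add mM (- a) gW gw.
apply: le_trans (a_norm_add mM oOmega mu0 lambda0 eta0 a gW gd).
apply: eq_implies_le; congr Num.sqrt.
pose w' := field_add a (of_affine W) (field_add (- a) (of_affine W) w).
have ext v : a_form Omega mu lambda eta w v = a_form Omega mu lambda eta w' v.
  apply: (a_form_ext mM oOmega) => [K hK x|F K hF hK FK x] /=;
    by rewrite addrA scaleNr subrr add0r.
by rewrite ext a_formC ext.
Qed.

Lemma HL_sol_sadd a W U (rhs rhs' rhsW : efun M E -> R) :
  CR Omega W ->
  (forall s, CR Omega s -> a_form Omega mu lambda eta (of_affine W) (of_affine s) = rhsW s) ->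
  (forall s, rhs' s = a * rhsW s + rhs s) ->
  HL_sol Omega mu lambda eta rhs U -> HL_sol Omega mu lambda eta rhs' (sadd a W U).
Proof.
move=> CW HW Hr [CU HU]; split; first exact: CR_sadd.
move=> s Cs; rewrite a_form_sadd ?HW ?HU//; [exact: CW.1|exact: CU.1|].
exact: (affine_form_field mM Cs.1).
Qed.

End VectorSmoother.

(** * Comparison of the best constants *)

Section BestConstants.
Context (R : realType) (n : nat) (Omega : set 'rV[R]_n.+1) (MM : set (mesh R n.+1)).
Variables (mu lambda eta k : R).
Local Notation sol_type :=
  (forall M : mesh R n.+1, ('rV[R]_n.+1 -> 'rV[R]_n.+1) -> efun M 'rV[R]_n.+1 -> Prop).
Local Notation best sol := (best_const Omega MM mu lambda eta sol).

(** A constant admissible for [sol'] becomes admissible for [sol] when [k] is added: a solution of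
    [sol] is shifted into one of [sol'], and the shift costs at most [k] in the norm. *)
Lemma best_const_le (sol sol' : sol_type) : (0 < n)%N -> open Omega ->
  (forall M, MM M -> is_mesh Omega M) ->
  0 <= mu -> 0 <= lambda -> 0 <= eta -> 0 <= k ->
  (forall M f, MM M -> L2v Omega f -> exists a W,
    [/\ `|a| <= 1, S01 W, (forall U, sol M f U -> sol' M f (sadd a W U)) &
      a_norm Omega mu lambda eta (of_affine W) <= k * (hmax M * L2norm Omega f)]) ->
  (best sol <= best sol' + k%:E)%E.
Proof.
move=> n0 oOmega mMM mu0 lambda0 eta0 k0 H.
(* Since [k] is finite it can be moved to the left, after which the infimum on the right is treated
   one constant [C], possibly infinite, at a time. *)
rewrite -leeBlDr//; apply: le_ereal_inf_tmp => C [C0 HC]; rewrite leeBlDr//.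
apply: ereal_inf_lbound; split; first by rewrite adde_ge0.
move=> M f u U w hM Lf su sU eU; have mM := mMM M hM.
have [a [W [a1 SW sW nW]]] := H M f hM Lf.
have h := HC M f u _ _ hM Lf su (sW U sU) (error_field_sadd mM n0 a SW eU).
have := a_norm_transfer mM n0 oOmega a mu0 lambda0 eta0 SW eU.1.
rewrite -lee_fin => /le_trans; apply.
rewrite ge0_muleDl// -?EFinM addeC EFinD; apply: leeD => //.
rewrite lee_fin; apply: le_trans nW; rewrite ler_piMl//; exact: sqrtr_ge0.
Qed.

End BestConstants.

Lemma sup_best_lty (R : realType) (A : set R) (f g : R -> \bar R) (k : R) :
  (forall x, A x -> f x <= g x + k%:E)%E ->
  (ereal_sup [set g x | x in A] < +oo)%E -> (ereal_sup [set f x | x in A] < +oo)%E.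
Proof.
move=> fg /lte_add_pinfty /(_ (ltry k)); apply: le_lt_trans.
apply: ge_ereal_sup => _ [x Ax <-]; apply: le_trans (fg x Ax) _.
by rewrite leeD2r//; apply: ereal_sup_ubound; exists x.
Qed.

Theorem mainTheorem6 (R : realType) (d : nat) (hd : (2 <= d)%N)
    (Omega : set 'rV[R]_d) (hOmega : polyhedral_domain Omega)
    (mu eta : R) (hmu : 0 < mu) (heta : 0 < eta)
    (gamma0 : R) (MM : set (mesh R d))
    (hMM : forall M, MM M -> is_mesh Omega M /\ shape_coef M <= gamma0)
    (Kz : forall M : mesh R d, 'I_(nvert M) -> {set 'I_(nvert M)})
    (hKz : forall M, MM M -> forall z : 'I_(nvert M),
       ~ bdry Omega (vtx z) -> Kz M z \in elts M /\ z \in Kz M z) :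
  let C := fun lambda : R =>
    best_const Omega MM mu lambda eta
      (fun M f => HL_sol_smoothed Omega mu lambda eta (Kz M) f) in
  let Chat := fun lambda : R =>
    best_const Omega MM mu lambda eta
      (fun M f => HL_sol_plain Omega mu lambda eta f) in
  (ereal_sup [set C lambda | lambda in [set l : R | (0 < l)%R]] < +oo)%E <->
  (ereal_sup [set Chat lambda | lambda in [set l : R | (0 < l)%R]] < +oo)%E.
Proof.
move=> C Chat; subst C Chat.
have [oOmega _ _ _ lipOmega] := hOmega.
case: d hd Omega hOmega MM hMM Kz hKz oOmega lipOmega => [|[|n]]// _ Omega _ MM hMM Kz hKz oOmega lipOmega.
(* At least 1, so that powers of [gam] increase with the exponent and chains shorter than
   [star_bound] obey the same bound. *)
pose gam := Num.max gamma0 1.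
have gam1 : 1 <= gam by rewrite le_max lexx orbT.
have shape M : MM M -> shape_coef M <= gam.
  by move=> /hMM[_ h]; rewrite le_max h.
have mMM M : MM M -> is_mesh Omega M by move=> /hMM[].
have k0 := sqrtr_ge0 (smoother_cst n.+1 gam eta).
have mu0 := ltW hmu; have eta0 := ltW heta.
(* One corrector serves both directions: adding it solves the smoothed problem from the plain one,
   subtracting it does the reverse. *)
split; apply: sup_best_lty => lambda l0; have l0' := ltW l0;
  apply: best_const_le k0 _ => // M f hM Lf;
  have [W [CW HW nW]] := corrector_exists (mMM M hM) isT oOmega lipOmega (hKz M hM) gam1
    (shape M hM) mu0 l0' heta Lf.
- exists 1, W; split; [by rewrite normr1|exact: CW.1| |exact: nW] => U.
  by apply: (HL_sol_sadd (mMM M hM) oOmega CW HW) => s; rewrite mul1r subrK.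
- exists (-1), W; split; [by rewrite normrN normr1|exact: CW.1| |exact: nW] => U.
  by apply: (HL_sol_sadd (mMM M hM) oOmega CW HW) => s; rewrite mulN1r opprB subrK.
Qed.
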